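(* There exists a locally compact metrizable topological space $B$ such that the classification problem $(\mathrm{Bun}_{\mathbb C}(B),\simeq_{\mathrm{iso}})$, of Hermitian line bundles over $B$ up to isomorphism, is not classifiable by TSI-group actions. In fact, $B$ can be taken to be the geometric realization of a countable, locally-finite CW-complex.
   Context: Spaces $B$ are locally compact metrizable with a countable basis. Let $F$ be a Polish $G$-space for a Polish group $G$. A (locally trivial) fibre bundle over $B$ with fibre $F$ and structure group $G$ consists of a Polish space $E$, a continuous $p:E\to B$, a locally finite open cover $\mathcal U$ of $B$, and homeomorphisms (charts) $h_U:p^{-1}(U)\to U\times F$ for $U\in\mathcal U$, such that: (i) for $b\in U\in\mathcal U$, $h_U$ restricts to a homeomorphism from $p^{-1}(b)$ to $\{b\}\times F$; (ii) for $U,V\in\mathcal U$ there is a continuous transition map $t_{(U,V)}:U\cap V\to G$ with $(h_V\circ h_U^{-1})(b,f)=(b,t_{(U,V)}(b)f)$ for all $b\in U\cap V$, $f\in F$. One may take $\mathcal U\subseteq\mathcal B$ for a fixed countable basis $\mathcal B$ of $B$, and $E$ is recovered (as a colimit) from $\mathcal U$ and the maps $t_{(U,V)}$, which satisfy the $1$-cocycle condition. In this way $\mathrm{Bun}(B,G,F)$, the space of all such bundles, is identified with a subset of the Polish space $2^{\mathcal B}\times\prod_{(U,V)\in\mathcal B^2}C(U\cap V,G)$, from which it inherits its (standard) Borel structure. A Hermitian line bundle over $B$ is such a bundle with $F=\mathbb C$ and $G=\mathrm U(\mathbb C)=\mathbb T$ acting on $\mathbb C$ by rotations; $\mathrm{Bun}_{\mathbb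 C}(B)$ is the space of all of them. Isomorphism: let $p:E\to B$ and $q:E'\to B$ be two bundles in $\mathrm{Bun}(B,G,F)$ with covers $\mathcal U,\mathcal V$ and charts $(h_U)_{U\in\mathcal U}$, $(k_V)_{V\in\mathcal V}$. Then $p\simeq_{\mathrm{iso}}q$ if there are homeomorphisms $\pi:E\to E'$ and $\rho:B\to B$ with $q\circ\pi=\rho\circ p$, and continuous maps $e_{(U,V)}:U\cap\rho^{-1}(V)\to G$ for $U\in\mathcal U,V\in\mathcal V$, such that $(k_V\circ\pi\circ h_U^{-1})(b,f)=(\rho(b),e_{(U,V)}(b)f)$ for all $b\in U\cap\rho^{-1}(V)$ and $f\in F$. (Note that $\rho$ need not be the identity.) A Polish group is TSI if it admits a compatible two-side invariant metric. A classification problem $(X,E)$ is classifiable by TSI-group actions if there are a TSI Polish group $H$, a Polish $H$-space $Y$ (Polish space with continuous $H$-action) with orbit equivalence relation $E^H_Y$, and a Borel map $f:X\to Y$ with $x\,E\,x'\iff f(x)\,E^H_Y\,f(x')$ for all $x,x'\in X$. *)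

(* Defs.v *)
From HB Require Import structures.
From mathcomp Require Import all_boot all_order all_algebra.
From mathcomp Require Import all_classical all_reals all_analysis.
From mathcomp Require Import complex.

Set Implicit Arguments.
Unset Strict Implicit.
Unset Printing Implicit Defensive.

Import Order.TTheory GRing.Theory Num.Theory.
Import numFieldNormedType.Exports.

Local Open Scope classical_set_scope.
Local Open Scope ring_scope.

Section Metrics.
Context {R : realType} {X : topologicalType}.

Definition is_metric (d : X -> X -> R) : Prop :=
  [/\ forall x y, 0 <= d x y,
      forall x y, d x y = 0 <-> x = y,
      forall x y, d x y = d y x &
      forall x y z, d x z <= d x y + d y z].

Definition compatible_metric (d : X -> X -> R) : Prop :=
  is_metric d /\
  forall (x : X) (A : set X),
    nbhs x A <-> exists2 e : R, 0 < e & [set y | d x y < e] `<=` A.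

Definition complete_metric (d : X -> X -> R) : Prop :=
  forall u : nat -> X,
    (forall e : R, 0 < e ->
      exists N : nat, forall m n : nat,
        (N <= m)%N -> (N <= n)%N -> d (u m) (u n) < e) ->
    exists l : X, forall e : R, 0 < e ->
      exists N : nat, forall n : nat, (N <= n)%N -> d (u n) l < e.

End Metrics.

Definition metrizable (R : realType) (X : topologicalType) : Prop :=
  exists d : X -> X -> R, compatible_metric d.

Definition polish (R : realType) (X : topologicalType) : Prop :=
  (exists2 S : set X, countable S & dense S) /\
  (exists2 d : X -> X -> R, compatible_metric d & complete_metric d).

HB.mixin Record isTopologicalGroup (G : Type) & Group G & Topological G := {
  mulg_continuous : continuous (fun gh : G * G => (gh.1 * gh.2)%g) ;
  invg_continuous : continuous (fun g : G => g^-1%g)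
}.

#[short(type="topologicalGroupType")]
HB.structure Definition TopologicalGroup :=
  {G of Group G & Topological G & isTopologicalGroup G}.

Definition tsi (R : realType) (H : topologicalGroupType) : Prop :=
  exists2 d : H -> H -> R, compatible_metric d &
    forall g h k : H,
      d (g * h)%g (g * k)%g = d h k /\ d (h * g)%g (k * g)%g = d h k.

Definition continuous_action (G : topologicalGroupType) (F : topologicalType)
    (act : G -> F -> F) : Prop :=
  [/\ forall f, act 1%g f = f,
      forall g h f, act (g * h)%g f = act g (act h f) &
      continuous (fun gf : G * F => act gf.1 gf.2)].

Definition orbit_equiv (G : topologicalGroupType) (F : topologicalType)
    (act : G -> F -> F) (x y : F) : Prop :=
  exists g : G, act g x = y.

Definition borel_set (X : topologicalType) : set (set X) := <<s @open X >>.

Definition borel_map (X Y : topologicalType) (f : X -> Y) : Prop :=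
  forall A : set Y, borel_set A -> borel_set (f @^-1` A).

(* The topology of [X] matters only through its Borel sets. *)
Definition classifiable_by_TSI (R : realType) (X : topologicalType)
    (E : X -> X -> Prop) : Prop :=
  exists (H : topologicalGroupType) (Y : topologicalType) (act : H -> Y -> Y),
    [/\ polish R H, tsi R H, polish R Y & continuous_action act] /\
    exists2 f : X -> Y, borel_map f &
      forall x x' : X, E x x' <-> orbit_equiv act (f x) (f x').

Definition homeomorphism (X Y : topologicalType) (f : X -> Y) : Prop :=
  continuous f /\
  exists g : Y -> X, [/\ continuous g, cancel f g & cancel g f].

(* [f] and [g] restrict to mutually inverse homeomorphisms between the
   subspaces [A] and [C]; their values elsewhere are irrelevant. *)
Definition homeo_between (X Y : topologicalType) (A : set X) (C : set Y)
    (f : X -> Y) (g : Y -> X) : Prop :=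
  [/\ set_fun A C f, set_fun C A g,
      (forall x, A x -> g (f x) = x), (forall y, C y -> f (g y) = y) &
      {within A, continuous f} /\ {within C, continuous g}].

Definition locally_finite (X : topologicalType) (I : Type) (D : set I)
    (S : I -> set X) : Prop :=
  forall x : X, exists2 N : set X, nbhs x N &
    finite_set [set i | D i /\ N `&` S i !=set0].

Section FibreBundles.
Context (R : realType) (B F : topologicalType) (G : topologicalGroupType).
Context (act : G -> F -> F).

(* Charts, their inverses and transition maps are indexed by all subsets of [B]
   and are total functions; only the sets [U], [V] of the cover, and only the
   values over [U] (resp. [U `&` V]), carry meaning. *)
Record fibre_bundle := FibreBundle {
  bundle_total : topologicalType ;
  bundle_proj : bundle_total -> B ;
  bundle_cover : set (set B) ;
  chart : set B -> bundle_total -> B * F ;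
  chart_inv : set B -> B * F -> bundle_total ;
  transition : set B -> set B -> B -> G ;
  bundle_total_polish : polish R bundle_total ;
  bundle_proj_continuous : continuous bundle_proj ;
  bundle_cover_open : bundle_cover `<=` open ;
  bundle_coverT : \bigcup_(U in bundle_cover) U = [set: B] ;
  bundle_cover_locally_finite : locally_finite bundle_cover id ;
  chart_homeo : forall U, bundle_cover U ->
    homeo_between (bundle_proj @^-1` U) (U `*` [set: F])
      (chart U) (chart_inv U) ;
  chart_fibre : forall U b, bundle_cover U -> U b ->
    homeo_between (bundle_proj @^-1` [set b]) ([set b] `*` [set: F])
      (chart U) (chart_inv U) ;
  transition_continuous : forall U V, bundle_cover U -> bundle_cover V ->
    {within U `&` V, continuous (transition U V)} ;
  transitionE : forall U V, bundle_cover U -> bundle_cover V ->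
    forall b f, U b -> V b ->
    chart V (chart_inv U (b, f)) = (b, act (transition U V b) f)
}.

Arguments bundle_proj : clear implicits.
Arguments bundle_cover : clear implicits.
Arguments chart : clear implicits.
Arguments chart_inv : clear implicits.
Arguments transition : clear implicits.

Definition bundle_iso (p q : fibre_bundle) : Prop :=
  exists (pi : bundle_total p -> bundle_total q) (rho : B -> B)
         (e : set B -> set B -> B -> G),
    [/\ homeomorphism pi, homeomorphism rho,
        forall x, bundle_proj q (pi x) = rho (bundle_proj p x) &
        forall U V, bundle_cover p U -> bundle_cover q V ->
          {within U `&` rho @^-1` V, continuous (e U V)} /\
          forall b f, U b -> V (rho b) ->
            chart q V (pi (chart_inv p U (b, f)))
            = (rho b, act (e U V b) f)].

End FibreBundles.

Arguments bundle_cover {R B F G act} _.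
Arguments transition {R B F G act} _.

Definition cont_maps (X Y : topologicalType) : Type :=
  initial_topology (fun f : continuousType X Y => f : {compact-open, X -> Y}).
HB.instance Definition _ (X Y : topologicalType) :=
  Topological.on (cont_maps X Y).

Section BundleSpace.
Context (R : realType) (B F : topologicalType) (G : topologicalGroupType).
Context (act : G -> F -> F) (BB : set (set B)).

Local Notation inter UV := (set_val UV.1 `&` set_val UV.2 : set B).

Definition transition_space : Type :=
  prod_topology (fun UV : (BB * BB)%type => cont_maps (inter UV) G).
HB.instance Definition _ := Topological.on transition_space.

Definition code_space : Type := ({ptws BB -> bool} * transition_space)%type.
HB.instance Definition _ := Topological.on code_space.

Definition code_cover (c : code_space) : set BB := [set U | c.1 U].
Definition code_trans (c : code_space) (UV : (BB * BB)%type) :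
  continuousType (inter UV) G := c.2 UV.

(* [c] is the point of the code space given by the cover and the transition
   maps of [p]. Coordinates at pairs of basic open sets not both in the cover are
   set to [1], so that the code of a bundle is unique. *)
Definition codes (c : code_space) (p : fibre_bundle R B act) : Prop :=
  [/\ bundle_cover p = set_val @` code_cover c,
      forall U V, code_cover c U -> code_cover c V ->
        forall b : inter (U, V),
          code_trans c (U, V) b
          = transition p (set_val U) (set_val V) (set_val b) &
      forall U V, ~ (code_cover c U /\ code_cover c V) ->
        forall b : inter (U, V), code_trans c (U, V) b = 1%g].

Definition Bun : set code_space := [set c | exists p, codes c p].

(* Two bundles with the same code are isomorphic over the identity of [B], so
   the choice of [p] and [q] does not matter when the action is faithful. *)
Definition Bun_iso (c c' : Bun) : Prop :=
  exists p q : fibre_bundle R B act,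
    [/\ codes (set_val c) p, codes (set_val c') q & bundle_iso p q].

End BundleSpace.

Arguments Bun R {B F G} act BB _.

Section Circle.
Variable R : realType.

Definition circle : Type := [set z : R[i]^o | `|z| = 1].
HB.instance Definition _ := Topological.on circle.

Definition circle_val (z : circle) : R[i]^o := set_val z.

Fact circle_normr1 (z : circle) : `|circle_val z| = 1.
Proof. by case: z => z z1; exact: (set_mem z1). Qed.

Definition to_circle (z : R[i]^o) (z1 : `|z| = 1) : circle :=
  exist (fun z => z \in [set z : R[i]^o | `|z| = 1]) z (mem_set z1).

Fact circle_mul_subproof (z w : circle) : `|circle_val z * circle_val w| = 1.
Proof. by rewrite normrM !circle_normr1 mulr1. Qed.

Fact circle_inv_subproof (z : circle) : `|(circle_val z)^-1| = 1.
Proof. by rewrite normfV circle_normr1 invr1. Qed.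

Definition circle_mul (z w : circle) : circle :=
  to_circle (circle_mul_subproof z w).
Definition circle_inv (z : circle) : circle :=
  to_circle (circle_inv_subproof z).
Definition circle_one : circle := to_circle (normr1 _).

Fact circle_val_inj : injective circle_val.
Proof. by move=> z w zw; exact: val_inj. Qed.

Fact circle_neq0 (z : circle) : circle_val z != 0.
Proof. by rewrite -normr_gt0 circle_normr1. Qed.

Fact circle_mulA : associative circle_mul.
Proof. by move=> x y z; apply: circle_val_inj; exact: mulrA. Qed.

Fact circle_mul1g : left_id circle_one circle_mul.
Proof. by move=> x; apply: circle_val_inj; exact: mul1r. Qed.

Fact circle_mulg1 : right_id circle_one circle_mul.
Proof. by move=> x; apply: circle_val_inj; exact: mulr1. Qed.

Fact circle_mulVg : left_inverse circle_one circle_inv circle_mul.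
Proof.
by move=> x; apply: circle_val_inj; exact: mulVf (circle_neq0 x).
Qed.

Fact circle_mulgV : right_inverse circle_one circle_inv circle_mul.
Proof.
by move=> x; apply: circle_val_inj; exact: mulfV (circle_neq0 x).
Qed.

HB.instance Definition _ := isGroup.Build circle
  circle_mulA circle_mul1g circle_mulg1 circle_mulVg circle_mulgV.

Fact circle_val_continuous : continuous circle_val.
Proof. exact: initial_continuous. Qed.

Fact to_circle_continuous (T : topologicalType) (f : T -> circle) :
  continuous (circle_val \o f) -> continuous f.
Proof. by move=> cf; apply/continuous_comp_initial. Qed.

Fact circle_mulg_continuous :
  continuous (fun zw : circle * circle => (zw.1 * zw.2)%g).
Proof.
apply: to_circle_continuous => -[z w].
apply: (@continuousM R[i] _ (circle_val \o fst) (circle_val \o snd)).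
  by apply: continuous_comp; [exact: cvg_fst|exact: circle_val_continuous].
by apply: continuous_comp; [exact: cvg_snd|exact: circle_val_continuous].
Qed.

Fact circle_invg_continuous : continuous (fun z : circle => z^-1%g).
Proof.
apply: to_circle_continuous => z.
apply: (@continuousV R[i] _ circle_val); first exact: circle_neq0.
exact: circle_val_continuous.
Qed.

HB.instance Definition _ := isTopologicalGroup.Build circle
  circle_mulg_continuous circle_invg_continuous.

Definition rotation (z : circle) (w : R[i]^o) : R[i]^o := circle_val z * w.

End Circle.

Definition BunC (R : realType) (B : topologicalType) (BB : set (set B)) :
  set (code_space (circle R) BB) :=
  Bun R (@rotation R) BB.

Arguments BunC R {B} BB _.

Definition BunC_iso (R : realType) (B : topologicalType) (BB : set (set B))
    (c c' : BunC R BB) : Prop :=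
  Bun_iso c c'.

Unset Implicit Arguments.

Section CWComplexes.
Context {R : realType}.

Definition disc (n : nat) : set 'rV[R]_n :=
  [set x | \sum_(i < n) x ord0 i ^+ 2 <= 1].
Definition open_disc (n : nat) : set 'rV[R]_n :=
  [set x | \sum_(i < n) x ord0 i ^+ 2 < 1].
Definition sphere (n : nat) : set 'rV[R]_n :=
  [set x | \sum_(i < n) x ord0 i ^+ 2 = 1].

Record CW_structure (X : topologicalType) := CWStructure {
  cell : Type ;
  cell_dim : cell -> nat ;
  charac : forall i : cell, 'rV[R]_(cell_dim i) -> X ;
  open_cell := fun i => charac i @` open_disc (cell_dim i) ;
  closed_cell := fun i => charac i @` disc (cell_dim i) ;
  CW_hausdorff : hausdorff_space X ;
  charac_continuous : forall i, {within disc (cell_dim i), continuous charac i} ;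
  charac_homeo : forall i, exists g : X -> 'rV[R]_(cell_dim i),
    homeo_between (open_disc (cell_dim i)) (open_cell i) (charac i) g ;
  cells_disjoint : trivIset [set: cell] open_cell ;
  cells_cover : \bigcup_i open_cell i = [set: X] ;
  cells_closure_finite : forall i, exists J : set cell,
    [/\ finite_set J, forall j, J j -> (cell_dim j < cell_dim i)%N &
        charac i @` sphere (cell_dim i) `<=` \bigcup_(j in J) open_cell j] ;
  cells_weak_topology : forall A : set X,
    (forall i, closed (A `&` closed_cell i)) -> closed A
}.

Definition CW_countable (X : topologicalType) (S : CW_structure X) : Prop :=
  countable [set: cell X S].

Definition CW_locally_finite (X : topologicalType) (S : CW_structure X) : Prop :=
  locally_finite [set: cell X S] (closed_cell X S).

End CWComplexes.

(* Main.v *)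
From HB Require Import structures.
From mathcomp Require Import all_boot all_order all_algebra.
From mathcomp Require Import all_classical all_reals all_analysis.
From mathcomp Require Import complex ring lra zify.
Require Import Defs.

Set Implicit Arguments.
Unset Strict Implicit.
Unset Printing Implicit Defensive.

Import Order.TTheory GRing.Theory Num.Theory.
Import numFieldNormedType.Exports.

Local Open Scope classical_set_scope.

(** The space is a disjoint union of countably many chains; a chain is an
    infinite string of 2-spheres in which consecutive spheres touch at a pole. A
    double sequence [beta] of bits gives a line bundle: on the [k]-th sphere of
    the [n]-th chain it is the tautological bundle if [beta n k] and the trivial
    one otherwise. Over one locally finite cover the transition maps depend on
    finitely many bits each, so that the code of the bundle is a continuous
    function of [beta] ([line_bun_locally_determined]).

    Topology makes the bits invariants, up to a permutation of the chains. A
    homeomorphism of the base space has to map the [k]-th sphere of a chain to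
    the [k]-th sphere of a chain: the initial segments of the chains are the
    compact sets which become open and nonempty when a point is removed
    ([cap_inv], [homeomorphism_spheres]). The tautological bundle has no section
    without zeros, because the identity of the circle does not extend to a map
    from the disc to the nonzero complex numbers ([no_retraction],
    [tautological_no_section]). So isomorphic bundles have the same bit
    sequences up to order ([folded_not_tautological]), and conversely permuting
    the chains gives isomorphic bundles ([line_bundle_relabel]).

    What remains is that equality of families of bit sequences up to reordering
    is too complicated for groups with a two-sided invariant metric. Index the
    chains by pairs [(m, a)] of a natural number and an integer, and consider
    the permutations which shift each row [m] along [a], and those which
    exchange rows. Suppose a Borel map [F] sends the orbits into those of a
    Polish group [H] with an invariant metric. It is continuous on a comeager
    set. On an open set the group element which carries [F x] to the image of a
    shift of [x] is almost constant ([local_cocycle]), and an open set restricts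
    finitely many [m] only; hence shifts acting on the other [m] move [F x] by
    elements close to 1 ([high_rows_cheap]). An exchange carries the restricted
    [m] to unrestricted ones, and since the metric is invariant, conjugation
    does not change sizes: all shifts are cheap ([all_rows_cheap]). As any
    generic point can be shifted into any open set, a fusion argument in the
    complete group [H] puts the images of all generic points into one orbit
    ([generic_orbit_collapse], [classifiable_generic_collapse]). But there are
    generic [x] and [x'] such that no sequence of [x'] equals the one of [x] at
    [(0, 0)] ([generic_distinct_sequences]), and their bundles are not
    isomorphic. *)

(** * Baire category in countable powers of a countable set *)

Section BaireCategory.
Context {I V : countType}.
Implicit Types (x y : I -> V) (L : seq I) (A U C : set (I -> V)).

Definition agree L x y := forall i, i \in L -> y i = x i.

Definition locally_determined U :=
  forall x, U x -> exists L, forall y, agree L x y -> U y.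

Definition dense_open U :=
  locally_determined U /\ forall x L, exists2 y, agree L x y & U y.

Definition comeager A :=
  exists2 U : nat -> set (I -> V),
    forall n, dense_open (U n) & \bigcap_n U n `<=` A.

Lemma agree_refl L x : agree L x x. Proof. by []. Qed.

Lemma agree_trans L x y z : agree L x y -> agree L y z -> agree L x z.
Proof. by move=> xy yz i iL; rewrite yz// xy. Qed.

Lemma agree_sub L L' x y : {subset L <= L'} -> agree L' x y -> agree L x y.
Proof. by move=> LL' xy i /LL'; exact: xy. Qed.

Lemma agree_cat L L' x y :
  agree (L ++ L') x y <-> agree L x y /\ agree L' x y.
Proof.
split=> [xy|[xy xy'] i].
  by split; apply: agree_sub xy => i; rewrite mem_cat => ->//; rewrite orbT.
by rewrite mem_cat => /orP[/xy|/xy'].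
Qed.

Lemma dense_openT : dense_open setT.
Proof. by split=> [x _|x L]; [exists [::]|exists x]. Qed.

Lemma comeagerS A A' : A `<=` A' -> comeager A -> comeager A'.
Proof. by move=> AA' [U Uo UA]; exists U => //; exact: subset_trans AA'. Qed.

Lemma dense_open_comeager U : dense_open U -> comeager U.
Proof. by move=> oU; exists (fun=> U) => // x /(_ 0%N Logic.I). Qed.

Lemma comeagerT : comeager setT.
Proof. exact/dense_open_comeager/dense_openT. Qed.

Lemma comeager_bigcap (J : countType) (A : J -> set (I -> V)) :
  (forall j, comeager (A j)) -> comeager (\bigcap_j A j).
Proof.
move=> cA; have /choice[U hU] : forall j, exists U : nat -> set (I -> V),
    (forall n, dense_open (U n)) /\ \bigcap_n U n `<=` A j.
  by move=> j; have [U oU UA] := cA j; exists U.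
exists (fun n => if @pickle_inv (J * nat)%type n is Some jm
                 then U jm.1 jm.2 else setT).
  by move=> n; case: pickle_inv => [[j m]|]; [case: (hU j)|exact: dense_openT].
move=> x Ux j _; have [_] := hU j; apply => m _.
by have := Ux (pickle (j, m)) Logic.I; rewrite pickleK_inv.
Qed.

Lemma comeagerI A A' : comeager A -> comeager A' -> comeager (A `&` A').
Proof.
move=> cA cA'; have := @comeager_bigcap bool (fun b => if b then A else A').
move=> /(_ _)/comeagerS; apply=> [x Ax|[]//].
by split; [exact: (Ax true)|exact: (Ax false)].
Qed.

(** The nested-cylinder argument: at stage [n] one also freezes the coordinate
    with code [n], so that the successive points converge coordinatewise. *)
Lemma comeager_dense A x L : comeager A -> exists2 y, agree L x y & A y.
Proof.
move=> [U oU UA].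
have step (n : nat) (c : (I -> V) * seq I) : exists c' : (I -> V) * seq I,
    [/\ agree c.2 c.1 c'.1, {subset c.2 <= c'.2},
      forall i, pickle i = n -> i \in c'.2 &
      forall z, agree c'.2 c'.1 z -> U n z].
  have [y yc Uy] := (oU n).2 c.1 c.2; have [L' UL'] := (oU n).1 y Uy.
  exists (y, (c.2 ++ L') ++ (if @pickle_inv I n is Some i then [:: i] else [::])).
  split=> //= [i ic|i ni|z]; rewrite ?mem_cat ?ic//.
    by rewrite -ni pickleK_inv mem_head !orbT.
  by move=> /agree_cat[/agree_cat[_]] + _; exact: UL'.
have /choice[f fP] : forall nc : nat * ((I -> V) * seq I), exists c', [/\
    agree nc.2.2 nc.2.1 c'.1, {subset nc.2.2 <= c'.2},
    forall i, pickle i = nc.1 -> i \in c'.2 &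
    forall z, agree c'.2 c'.1 z -> U nc.1 z].
  by move=> [n c]; exact: step.
pose c := fix c n := if n is m.+1 then f (m, c m) else (x, L).
have cS n : [/\ agree (c n).2 (c n).1 (c n.+1).1,
    {subset (c n).2 <= (c n.+1).2}, forall i, pickle i = n -> i \in (c n.+1).2 &
    forall z, agree (c n.+1).2 (c n.+1).1 z -> U n z] by exact: (fP (n, c n)).
have mono n m : {subset (c n).2 <= (c (m + n)%N).2} /\
    agree (c n).2 (c n).1 (c (m + n)%N).1.
  elim: m => [|m [sm am]]; first by split; [|exact: agree_refl].
  have [a s _ _] := cS (m + n)%N.
  split; first by move=> i /sm /s.
  by apply: agree_trans am _; apply: agree_sub a.
pose y i := (c (pickle i).+1).1 i.
have yP n : agree (c n).2 (c n).1 y.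
  move=> i ic; rewrite /y.
  have [_ /(_ i) a] := mono (pickle i).+1 n.
  have [_ /(_ i ic) b] := mono n (pickle i).+1.
  have [_ _ /(_ i erefl) ic' _] := cS (pickle i).
  by rewrite -(a ic') -b addnC.
exists y; first exact: (yP 0%N).
by apply: UA => n _; have [_ _ _] := cS n; apply; exact: yP.
Qed.

Definition matches (s : seq (I * V)) x := forall iv, iv \in s -> x iv.1 = iv.2.

Definition pattern_of L x := [seq (i, x i) | i <- L].

Lemma matches_pattern L x y : matches (pattern_of L x) y <-> agree L x y.
Proof.
split=> [m i iL|xy _ /mapP[i iL ->]/=]; last exact: xy.
by apply: (m (i, x i)); apply/mapP; exists i.
Qed.

Lemma matches_local s x : matches s x ->
  exists L, forall y, agree L x y -> matches s y.
Proof.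
move=> sx; exists (map fst s) => y xy iv ivs.
by rewrite xy ?sx//; apply/mapP; exists iv.
Qed.

(** [heavy A] is the closed set of points near which [A] is nowhere meager. *)
Definition nonmeager_at L x A :=
  forall C, comeager C -> exists2 y, agree L x y & C y /\ A y.

Definition heavy A x := forall L, nonmeager_at L x A.

Definition inner A x := exists L, forall y, agree L x y -> A y.

(** Where [A] is not heavy, [A] is meager in a cylinder; there are countably many
    cylinders, so these parts of [A] form a meager set. *)
Lemma comeager_heavy A : comeager [set x | A x -> heavy A x].
Proof.
have /choice[C hC] : forall s : seq (I * V), exists C, comeager C /\
    ((exists2 C, comeager C & forall y, matches s y -> C y -> ~ A y) ->
     forall y, matches s y -> C y -> ~ A y).
  move=> s; have [[C cC CA]|no] :=
    pselect (exists2 C, comeager C & forall y, matches s y -> C y -> ~ A y).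
    by exists C; split.
  by exists setT; split=> //; exact: comeagerT.
have := comeager_bigcap (fun s => (hC s).1); apply: comeagerS.
move=> x Cx Ax L C' cC'; apply: contrapT => no.
have [_ /(_ _ x)] := hC (pattern_of L x); apply => //; last exact: Cx.
  exists C' => // y /matches_pattern xy C'y Ay; apply: no; exists y => //.
exact/matches_pattern.
Qed.

(** [heavy A] is closed, and the boundary of a closed set is nowhere dense. *)
Lemma dense_open_inner A : dense_open [set x | heavy A x -> inner (heavy A) x].
Proof.
split=> [x Ax|x L].
  have [hx|] := pselect (heavy A x).
    have [L LA] := Ax hx; exists L => y xy _; exists L => z yz.
    by apply: LA; exact: agree_trans xy yz.
  move=> /existsNP[L nL]; exists L => y xy hy; exfalso; apply: nL => C cC.
  have [z yz Cz] := hy L C cC; exists z => //; exact: agree_trans xy yz.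
have [[y xy hy]|no] := pselect (exists2 y, agree L x y & ~ heavy A y).
  by exists y.
exists x => // _; exists L => y xy; apply: contrapT => hy.
by apply: no; exists y.
Qed.

Lemma heavy_bigcup (J : countType) (P : set J) (A : J -> set (I -> V)) A0 L x :
  A0 `<=` \bigcup_(j in P) A j -> nonmeager_at L x A0 ->
  exists2 j, P j & nonmeager_at L x (A j).
Proof.
move=> AA nA; apply: contrapT => no.
have /choice[C hC] : forall j, exists C, comeager C /\
    (P j -> forall y, agree L x y -> C y -> ~ A j y).
  move=> j; have [Pj|nP] := pselect (P j); last first.
    by exists setT; split=> //; exact: comeagerT.
  have /existsNP[C /not_implyP[cC nC]] : ~ nonmeager_at L x (A j).
    by move=> nj; apply: no; exists j.
  by exists C; split=> // _ y xy Cy Ay; apply: nC; exists y.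
have [y xy [Cy Ay]] := nA _ (comeager_bigcap (fun j => (hC j).1)).
have [j Pj Ajy] := AA y Ay.
by have [_ /(_ Pj y xy (Cy j Logic.I))] := hC j.
Qed.

(** If a set is covered by countably many children then, generically, heaviness
    of the set passes to one of its children; iterating this along a scheme of
    shrinking balls is what makes projections of closed sets have the Baire
    property. *)
Lemma comeager_heavy_child (J : countType) (P : set J) (A : J -> set (I -> V))
    A0 : A0 `<=` \bigcup_(j in P) A j ->
  comeager [set x | heavy A0 x -> exists2 j, P j & heavy (A j) x].
Proof.
move=> AA.
pose G := [set x | (exists2 j, P j & inner (heavy (A j)) x) \/
  exists L, forall y, agree L x y -> ~ inner (heavy A0) y].
have oG : dense_open G.
  split=> [x [[j Pj [L Lj]]|[L nL]]|x L].
  - exists L => y xy; left; exists j => //; exists L => z yz; apply: Lj.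
    exact: agree_trans xy yz.
  - exists L => y xy; right; exists L => z yz; apply: nL.
    exact: agree_trans xy yz.
  have [[y xy [L1 L1A]]|no] :=
    pselect (exists2 y, agree L x y & inner (heavy A0) y); last first.
    by exists x => //; right; exists L => y xy iy; apply: no; exists y.
  have hy : heavy A0 y by apply: L1A.
  have [j Pj nj] := heavy_bigcup AA (hy L).
  have [z yz [[Cz C'z] Az]] := nj _ (comeagerI (comeager_heavy (A j))
    (dense_open_comeager (dense_open_inner (A j)))).
  exists z; first exact: agree_trans xy yz.
  by left; exists j => //; apply: C'z; apply: Cz.
have := comeagerI (dense_open_comeager oG)
  (dense_open_comeager (dense_open_inner A0)).
apply: comeagerS => x [[[j Pj [L Lj]] _ _|[L nL] hx]].
  by exists j => //; apply: Lj.
by move=> /hx /(nL x (agree_refl _)).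
Qed.

End BaireCategory.

Lemma comeager_preimage (I V J W : countType) (f : (I -> V) -> (J -> W))
    (A : set (J -> W)) :
  (forall U, dense_open U -> dense_open (f @^-1` U)) ->
  comeager A -> comeager (f @^-1` A).
Proof.
move=> fo [U oU UA]; exists (fun n => f @^-1` U n) => [n|x Ux].
  exact/fo/oU.
by apply: UA => n; exact: Ux.
Qed.

Section KuratowskiUlam.
Context {I J V : countType}.

Definition glue (x : I -> V) (g : J -> V) : (I + J)%type -> V :=
  fun k => match k with inl i => x i | inr j => g j end.

Lemma glueE (z : (I + J)%type -> V) : z = glue (z \o inl) (z \o inr).
Proof. by apply/funext => -[]. Qed.

Lemma agree_glue (LI : seq I) (LJ : seq J) x x' g g' :
  agree (map inl LI ++ map inr LJ) (glue x g) (glue x' g') <->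
  agree LI x x' /\ agree LJ g g'.
Proof.
split=> [a|[a b] k].
  split=> i iL; [have := a (inl i)|have := a (inr i)]; apply.
    by rewrite mem_cat; apply/orP; left; apply/mapP; exists i.
  by rewrite mem_cat; apply/orP; right; apply/mapP; exists i.
by rewrite mem_cat => /orP[] /mapP[i iL ->]/=; [exact: a|exact: b].
Qed.

Lemma split_support (L : seq (I + J)%type) : exists LI LJ,
  {subset L <= map inl LI ++ map inr LJ}.
Proof.
exists (pmap (fun k => if k is inl i then Some i else None) L).
exists (pmap (fun k => if k is inr j then Some j else None) L).
move=> [i|j] kL; rewrite mem_cat; apply/orP; [left|right]; apply/mapP.
  by exists i => //; rewrite mem_pmap; apply/mapP; exists (inl i).
by exists j => //; rewrite mem_pmap; apply/mapP; exists (inr j).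
Qed.

(** One direction of the Kuratowski-Ulam theorem. *)
Lemma comeager_slice (M : set ((I + J)%type -> V)) : comeager M ->
  comeager [set g | comeager [set x | M (glue x g)]].
Proof.
move=> [U oU UM].
pose D (ns : nat * seq (I * V)) :=
  [set g | (exists2 x, matches ns.2 x & U ns.1 (glue x g)) \/
           ~ exists x : I -> V, matches ns.2 x].
have oD ns : dense_open (D ns).
  split=> [g [[x sx Ux]|no]|g L].
  - have [L UL] := (oU ns.1).1 _ Ux; have [LI [LJ sL]] := split_support L.
    exists LJ => g' gg'; left; exists x => //; apply: UL.
    by apply: (agree_sub sL); apply/agree_glue.
  - by exists [::] => g' _; right.
  have [[x sx]|no] := pselect (exists x : I -> V, matches ns.2 x); last first.
    by exists g => //; right.
  have [LI LIs] := matches_local sx.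
  have [z] := (oU ns.1).2 (glue x g) (map inl LI ++ map inr L).
  rewrite (glueE z) => /agree_glue[az bz] Uz.
  by exists (z \o inr) => //; left; exists (z \o inl) => //; exact: LIs.
have := comeager_bigcap (fun ns => dense_open_comeager (oD ns)).
apply: comeagerS => g Dg.
exists (fun n => [set x | U n (glue x g)]) => [n|x Ux]; last first.
  by apply: UM => n; exact: Ux.
split=> [x Ux|x L].
  have [L UL] := (oU n).1 _ Ux; have [LI [LJ sL]] := split_support L.
  exists LI => y xy; apply: UL; apply: (agree_sub sL).
  by apply/agree_glue.
have [[y /matches_pattern xy Uy]|[]] := Dg (n, pattern_of L x) Logic.I.
  by exists y.
by exists x; apply/matches_pattern.
Qed.

End KuratowskiUlam.

Local Open Scope ring_scope.

(** * Metric preliminaries *)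

Section MetricTopology.
Context {R : realType} {X : topologicalType} (d : X -> X -> R).
Hypothesis dX : compatible_metric d.

Lemma metric_ge0 x y : 0 <= d x y.
Proof. by have [[h _ _ _] _] := dX. Qed.

Lemma metric_xx x : d x x = 0.
Proof. by have [[_ h _ _] _] := dX; apply/h. Qed.

Lemma metric_eq0 x y : d x y = 0 -> x = y.
Proof. by have [[_ h _ _] _] := dX; move/h. Qed.

Lemma metric_sym x y : d x y = d y x.
Proof. by have [[_ _ h _] _] := dX. Qed.

Lemma metric_triangle y x z : d x z <= d x y + d y z.
Proof. by have [[_ _ _ h] _] := dX. Qed.

Lemma metric_nbhs x (A : set X) :
  nbhs x A <-> exists2 e : R, 0 < e & [set y | d x y < e] `<=` A.
Proof. exact: dX.2. Qed.

Lemma nbhs_metric_ball x (e : R) : 0 < e -> nbhs x [set y | d x y < e].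
Proof. by move=> e0; apply/metric_nbhs; exists e. Qed.

Lemma metric_ball_open x (e : R) : open [set y | d x y < e].
Proof.
rewrite openE => y /= dxy; apply/metric_nbhs.
exists (e - d x y); first by rewrite subr_gt0.
by move=> z /= yz; have := metric_triangle y x z; lra.
Qed.

Lemma metric_cvgP (u : nat -> X) l : u @ \oo --> l <->
  forall e : R, 0 < e -> exists N, forall n, (N <= n)%N -> d (u n) l < e.
Proof.
split=> [ul e e0|ul A /metric_nbhs[e /ul[N Nu] eA]].
  have [N _ Nu] := ul _ (nbhs_metric_ball l e0).
  by exists N => n /Nu /=; rewrite metric_sym.
by exists N => // n /Nu un; apply: eA => /=; rewrite metric_sym.
Qed.

Lemma metric_hausdorff : hausdorff_space X.
Proof.
move=> x y xy; apply: metric_eq0; apply/eqP; apply: contrapT => /negP dxy0.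
have dxy : 0 < d x y / 2.
  by rewrite divr_gt0// lt_neqAle eq_sym dxy0 metric_ge0.
have [z [/= xz yz]] := xy _ _ (nbhs_metric_ball x dxy) (nbhs_metric_ball y dxy).
by have := metric_triangle z x y; rewrite (metric_sym z y); lra.
Qed.

Lemma countable_dense_seq (S : set X) (x0 : X) : countable S -> dense S ->
  exists q : nat -> X, forall x (e : R), 0 < e -> exists n, d x (q n) < e.
Proof.
move=> /countable_injP[f finj] dS.
exists (fun n => if pselect (exists2 s, S s & f s = n) is left w
                 then projT1 (cid2 w) else x0) => x e e0.
have [|s [xs Ss]] := dS [set y | d x y < e] _ (metric_ball_open x e).
  by exists x => /=; rewrite metric_xx.
exists (f s); case: pselect => [w|[]]; last by exists s.
case: (cid2 w) => s' Ss' /= fs'.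
by rewrite (finj s' s)// inE.
Qed.

End MetricTopology.

Section GroupMetric.
Context {R : realType} {H : topologicalGroupType}.

Definition two_sided_invariant (d : H -> H -> R) :=
  forall g h k : H, d (g * h)%g (g * k)%g = d h k /\ d (h * g)%g (k * g)%g = d h k.

(** A sequence Cauchy for the invariant metric [d] need not be Cauchy for the
    complete metric [d'], but it becomes so after suitable right translations:
    one moves a point [h] inside smaller and smaller [d]-balls so that both [h]
    and [u i * h] are under control for [d'].  This is the classical argument
    that a Polish group, being comeager in its [d]-completion, meets each of its
    translates there. *)
Lemma tsi_complete (d d' : H -> H -> R) : compatible_metric d ->
  two_sided_invariant d -> compatible_metric d' -> complete_metric d' ->
  complete_metric d.
Proof.
move=> dH dinv d'H d'complete u uC.
pose osc (i : nat) (e : R) :=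
  forall m n, (i <= m)%N -> (i <= n)%N -> d (u m) (u n) < e.
have oscW i j e e' : (i <= j)%N -> e <= e' -> osc i e -> osc j e'.
  move=> ij ee oi m n jm jn; apply: lt_le_trans ee.
  by apply: oi; exact: leq_trans ij _.
have osc_ex (i : nat) (e : R) : 0 < e -> exists2 j, (i <= j)%N & osc j e.
  move=> /uC[N oN]; exists (maxn i N); first exact: leq_maxl.
  by apply: oscW oN => //; exact: leq_maxr.
have ctrl (x : H) (a e : R) : 0 < a -> 0 < e -> exists r : R,
    [/\ 0 < r, r <= a & forall z, d x z < r -> d' x z < e].
  move=> a0 e0; have /(metric_nbhs dH)[r r0 rA] := nbhs_metric_ball d'H x e0.
  exists (Num.min a r); split; first by rewrite lt_min a0.
    by rewrite ge_min lexx.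
  by move=> z zr; apply: rA => /=; apply: lt_le_trans zr _; rewrite ge_min lexx orbT.
(* a state is a translation, a radius and an index from which the oscillation of
   [u] is small compared with the radius *)
pose st := (H * R * nat)%type.
pose valid (c : st) := 0 < c.1.2 /\ osc c.2 (c.1.2 / 8).
pose small (n : nat) : R := n.+1%:R^-1.
have small0 n : 0 < small n by rewrite /small invr_gt0.
have /choice[f fP] : forall nc : nat * st, exists c' : st, valid nc.2 ->
    [/\ valid c', c'.1.2 <= nc.2.1.2 / 8, d c'.1.1 nc.2.1.1 < nc.2.1.2 / 8,
      forall z, d c'.1.1 z < c'.1.2 -> d' c'.1.1 z < small nc.1 &
      exists r' : R, [/\ forall z,
          d (u nc.2.2 * nc.2.1.1)%g z < r' ->
          d' (u nc.2.2 * nc.2.1.1)%g z < small nc.1,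
        c'.1.2 <= r' / 4 &
        exists i', [/\ (nc.2.2 <= i' <= c'.2)%N, osc i' (r' / 4) &
          (u i' * c'.1.1 = u nc.2.2 * nc.2.1.1)%g]]].
  move=> [n [[h r] i]] /=.
  have [[/= r0 oi]|nv] := pselect (valid (h, r, i)); last by exists (h, r, i).
  pose g := (u i * h)%g.
  have [r' [r'0 _ r'g]] := ctrl g 1 (small n) ltr01 (small0 n).
  have r'4 : 0 < r' / 4 by rewrite divr_gt0.
  have [i' ii' oi'] := osc_ex i _ r'4.
  pose h' := ((u i')^-1 * g)%g.
  have m0 : 0 < Num.min (r / 8) (r' / 4) by rewrite lt_min; apply/andP; split; lra.
  have [r2 [r20 r2m r2h]] := ctrl h' _ (small n) m0 (small0 n).
  have [i2 i'i2 oi2] := osc_ex i' (r2 / 8) ltac:(lra).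
  move: r2m; rewrite le_min => /andP[r2r r2r'].
  exists (h', r2, i2) => _; split => //=.
    rewrite /h' /g -(dinv (u i') _ _).1 mulgA mulgV mul1g (dinv h _ _).2.
    by apply: oi => //.
  exists r'; split=> //; exists i'; split=> //; first by rewrite ii'.
  by rewrite /h' mulgA mulgV mul1g.
have [i0 _ oi0] := osc_ex 0%N (1 / 8 : R) ltac:(lra).
pose c := fix c n := if n is m.+1 then f (m, c m) else ((1%g, 1, i0) : st).
have cv n : valid (c n).
  elim: n => [|n cn]; first by split=> //=; exact: ltr01.
  by have [] := fP (n, c n) cn.
have cS n := fP (n, c n) (cv n).
pose h n := (c n).1.1; pose r n := (c n).1.2; pose i n := (c n).2.
have r0 n : 0 < r n by have [] := cv n.
have rS n : r n.+1 <= r n / 8 by have [] := cS n.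
have hS n : d (h n.+1) (h n) < r n / 8 by have [] := cS n.
have hd n m : d (h (m + n)%N) (h n) <= (r n - r (m + n)%N) / 4.
  elim: m => [|m IH]; first by rewrite add0n metric_xx// subrr mul0r.
  have := metric_triangle dH (h (m + n)%N) (h (m + n).+1) (h n).
  have := hS (m + n)%N; have := rS (m + n)%N; have := r0 (m + n)%N.
  by rewrite addSn; move: IH; lra.
have hdlt n m : d (h (m + n)%N) (h n) < r n / 4.
  by have := hd n m; have := r0 (m + n)%N; lra.
have iS n m : (i n <= i (m + n))%N.
  elim: m => [|m IH]//; apply: leq_trans IH _; rewrite addSn.
  have [_ _ _ _ [r' [_ _ [i' [/andP[ii' i'i] _ _]]]]] := cS (m + n)%N.
  exact: leq_trans ii' i'i.
have small_lt (e : R) : 0 < e -> exists N, forall n, (N <= n)%N -> small n < e.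
  move=> e0; have [N _ NP] := near_infty_natSinv_lt (PosNum e0).
  by exists N => n /NP.
(* both [h n] and [u (i n) * h n] are Cauchy for the complete metric *)
pose g n := (u (i n) * h n)%g.
have hC : exists l : H, h @ \oo --> l.
  have [|l ll] := d'complete h; last by exists l; apply/(metric_cvgP d'H).
  move=> e e0; have [N NP] := small_lt (e / 2) ltac:(lra).
  have hN m : (N.+1 <= m)%N -> d' (h N.+1) (h m) < e / 2.
    move=> Nm; apply: (@lt_trans _ _ (small N)); last exact: NP.
    have [_ _ _ + _] := cS N; apply; change (is_true (d (h N.+1) (h m) < r N.+1)).
    rewrite (metric_sym dH).
    by have := hdlt N.+1 (m - N.+1)%N; rewrite subnK//; have := r0 N.+1; lra.
  exists N.+1 => m n /hN Nm /hN Nn.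
  by have := metric_triangle d'H (h N.+1) (h m) (h n);
     rewrite (metric_sym d'H (h m) (h N.+1)); lra.
have gC : exists l : H, g @ \oo --> l.
  have [|l ll] := d'complete g; last by exists l; apply/(metric_cvgP d'H).
  move=> e e0; have [N NP] := small_lt (e / 2) ltac:(lra).
  have gN m : (N.+1 <= m)%N -> d' (g N) (g m) < e / 2.
    move=> Nm; apply: (@lt_trans _ _ (small N)); last exact: NP.
    have [_ _ _ _ [r' [r'P rr' [i' [/andP[_ i'i] oi' uh]]]]] := cS N.
    apply: r'P; rewrite -/(h N) -/(i N) -uh.
    have := metric_triangle dH (u i' * h m)%g (u i' * h N.+1)%g (g m).
    rewrite (dinv (u i') _ _).1 (dinv (h m) _ _).2 (metric_sym dH _ (h m)).
    have := hdlt N.+1 (m - N.+1)%N; rewrite subnK// => hh.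
    have := oi' i' (i m) (leqnn _).
    have := iS N.+1 (m - N.+1)%N; rewrite subnK// => /(leq_trans i'i) i'm /(_ i'm).
    change (is_true (r N.+1 <= r' / 4)) in rr'; rewrite -/(h N.+1).
    by move: hh rr'; have := r0 N.+1; lra.
  exists N.+1 => m n /gN Nm /gN Nn.
  by have := metric_triangle d'H (g N) (g m) (g n);
     rewrite (metric_sym d'H (g m) (g N)); lra.
have [[hl hhl] [gl ggl]] := (hC, gC).
(* the translations are undone to get the limit of [u] *)
have ul : u \o i @ \oo --> (gl * hl^-1)%g.
  have -> : u \o i = fun n => (g n * (h n)^-1)%g.
    by apply/funext => n /=; rewrite /g -mulgA mulgV mulg1.
  have hV : (fun n => (h n)^-1)%g @ \oo --> (hl^-1)%g.
    exact: (cvg_comp _ _ hhl (invg_continuous hl)).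
  have gh : (fun n => (g n, (h n)^-1)%g) @ \oo --> (gl, hl^-1)%g.
    exact: cvg_pair.
  exact: (cvg_comp _ _ gh (mulg_continuous (gl, hl^-1)%g)).
exists (gl * hl^-1)%g => e e0.
have /(metric_cvgP dH)/(_ (e / 2) ltac:(lra))[N NP] := ul.
have [M _ oM] := osc_ex 0%N (e / 2) ltac:(lra).
have r8 n : r n <= small n.
  elim: n => [|n IH]; first by rewrite /small /r /= invr1.
  apply: (le_trans (rS n)); apply: (@le_trans _ _ (small n / 8)); first by lra.
  clear -R; rewrite /small -invfM lef_pV2 ?posrE ?mulr_gt0// [n.+2%:R]mulrSr.
  have : (1 : R) <= n.+1%:R by rewrite ler1n.
  lra.
have [K KP] := small_lt e e0.
pose k := maxn N K.
exists (i k) => n kn; have [_ /(_ n (i k) kn (leqnn _))] := cv k.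
have := NP k (leq_maxl _ _); have := KP k (leq_maxr _ _); have := r8 k.
have := metric_triangle dH (u (i k)) (u n) (gl * hl^-1)%g.
by rewrite /= -/(r k) -/(i k); lra.
Qed.

End GroupMetric.

(** * Borel maps and generic continuity *)

Section BaireProperty.
Context {I V : countType}.
Implicit Types A U C : set (I -> V).

Definition baire_property A :=
  exists2 U, locally_determined U & comeager [set x | A x <-> U x].

(** The complement of an open set differs from its interior by a nowhere dense
    set. *)
Lemma baire_propertyC A : baire_property A -> baire_property (~` A).
Proof.
move=> [U oU cU].
pose E : set (I -> V) := [set x | exists L, forall y, agree L x y -> ~ U y].
have oE : locally_determined E.
  move=> x [L LU]; exists L => y xy; exists L => z yz; apply: LU.
  exact: agree_trans xy yz.
exists E => //; have oUE : dense_open (U `|` E).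
  split=> [x [/oU[L LU]|/oE[L LE]]|x L].
  - by exists L => y /LU; left.
  - by exists L => y /LE; right.
  have [[y xy Uy]|no] := pselect (exists2 y, agree L x y & U y).
    by exists y => //; left.
  by exists x => //; right; exists L => y xy Uy; apply: no; exists y.
apply: comeagerS (comeagerI cU (dense_open_comeager oUE)) => x [AU [Ux|Ex]] /=.
  split=> [nA|[L /(_ x (agree_refl _))//]]; exfalso; exact/nA/AU.
split=> // _ Ax; have [L /(_ x (agree_refl _))] := Ex; apply; exact/AU.
Qed.

Lemma baire_property_bigcup (A : nat -> set (I -> V)) :
  (forall n, baire_property (A n)) -> baire_property (\bigcup_n A n).
Proof.
move=> bA; have /choice[U hU] : forall n, exists U,
    locally_determined U /\ comeager [set x | A n x <-> U x].
  by move=> n; have [U] := bA n; exists U.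
exists (\bigcup_n U n).
  move=> x [n _ Ux]; have [L LU] := (hU n).1 x Ux.
  by exists L => y /LU; exists n.
apply: comeagerS (comeager_bigcap (fun n => (hU n).2)) => x hx /=.
by split=> -[n _ xn]; exists n => //; apply/(hx n Logic.I).
Qed.

Lemma open_baire_property U : locally_determined U -> baire_property U.
Proof. by move=> oU; exists U => //; apply: comeagerS comeagerT. Qed.

(** The sets with the Baire property form a sigma-algebra, and preimages of open
    sets belong to it. *)
Lemma borel_baire_property (Z : topologicalType) (c : (I -> V) -> Z) :
  (forall O, open O -> locally_determined (c @^-1` O)) ->
  forall A : set Z, borel_set A -> baire_property (c @^-1` A).
Proof.
move=> oc.
suff : @borel_set Z `<=` [set A : set Z | baire_property (c @^-1` A)] by [].
apply: smallest_sub => [|A oA]; last exact/open_baire_property/oc.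
split=> [|A bA|A bA].
- by rewrite /= preimage_set0; exact: open_baire_property.
- by rewrite /= setTD; exact: baire_propertyC.
- by rewrite /= preimage_bigcup; exact: baire_property_bigcup.
Qed.

Definition continuous_on (Y : topologicalType) (C : set (I -> V))
    (f : (I -> V) -> Y) :=
  forall x, C x -> forall O, nbhs (f x) O ->
    exists L, forall y, agree L x y -> C y -> O (f y).

(** For each ball of a countable base, its preimage is replaced by an open set at
    the cost of a meager set. *)
Lemma generically_continuous (R : realType) (Y : topologicalType)
    (d : Y -> Y -> R) (q : nat -> Y) (f : (I -> V) -> Y) :
  compatible_metric d ->
  (forall x (e : R), 0 < e -> exists n, d x (q n) < e) ->
  (forall O, open O -> baire_property (f @^-1` O)) ->
  exists2 C, comeager C & continuous_on C f.
Proof.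
move=> dY qP bf.
pose O (nm : nat * nat) := [set y | d (q nm.1) y < nm.2.+1%:R^-1].
have /choice[U hU] : forall nm, exists U,
    locally_determined U /\ comeager [set x | O nm (f x) <-> U x].
  move=> nm; have [U] := bf (O nm) (metric_ball_open dY _ _).
  by exists U.
exists (\bigcap_nm [set x | O nm (f x) <-> U nm x]).
  by apply: comeager_bigcap => nm; exact: (hU nm).2.
move=> x Cx A /(metric_nbhs dY)[e e0 eA].
have [m _ mP] := near_infty_natSinv_lt (PosNum (divr_gt0 e0 (ltr0n R 2))).
have me : m.+1%:R^-1 < e / 2 := mP m (leqnn m).
have [n qn] := qP (f x) m.+1%:R^-1 ltac:(by rewrite invr_gt0).
have [L LU] := (hU (n, m)).1 x ltac:(apply/(Cx (n, m) Logic.I);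
  by rewrite /O/= (metric_sym dY)).
exists L => y xy Cy; apply: eA => /=.
have := metric_triangle dY (q n) (f x) (f y).
have : O (n, m) (f y) by apply/(Cy (n, m) Logic.I); exact: LU.
by rewrite /O/=; move: me qn => /=; move: (_^-1) => r; lra.
Qed.

End BaireProperty.

(** * Orbit relations of Polish group actions *)

(** The form in which completeness is applied: the increments are bounded by a
    geometric progression, and the limit is not far from the first term. *)
Lemma complete_geometric (R : realType) (X : topologicalType) (d : X -> X -> R)
    (c : nat -> X) (r : R) : compatible_metric d -> complete_metric d ->
  (forall n, d (c n) (c n.+1) <= r * 2^-1 ^+ n) ->
  exists2 l, c @ \oo --> l & d (c 0%N) l <= 2 * r.
Proof.
move=> dX dcomplete cr.
have r0 : 0 <= r.
  by have := cr 0%N; rewrite expr0 mulr1; apply: le_trans; exact: metric_ge0.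
have p0 n : (0 : R) < 2^-1 ^+ n by rewrite exprn_gt0.
have cd n m : d (c n) (c (m + n)%N) <= 2 * r * (2^-1 ^+ n - 2^-1 ^+ (m + n)).
  elim: m => [|m IH]; first by rewrite add0n metric_xx// subrr mulr0.
  have := metric_triangle dX (c (m + n)%N) (c n) (c (m + n).+1).
  have := cr (m + n)%N; rewrite addSn exprSr; move: IH.
  by move: (2^-1 ^+ (m + n)) => p; lra.
have cd' n m : (n <= m)%N -> d (c n) (c m) <= 2 * r * 2^-1 ^+ n.
  move=> nm; rewrite -(subnK nm); apply: le_trans (cd _ _) _.
  by rewrite ler_wpM2l ?mulr_ge0// gerBl ltW.
have pow (e : R) : 0 < e -> exists n, 2^-1 ^+ n < e.
  move=> e0; have /cvgrPdist_lt/(_ e e0)[N _ NP] : (2^-1 : R) ^+ n @[n --> \oo] --> 0.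
    by apply: cvg_expr; rewrite ger0_norm ?invr_ge0//; lra.
  exists N; have := NP N (leqnn _).
  by rewrite /= sub0r normrN (ger0_norm (ltW (p0 N))).
have [|l ll] := dcomplete c.
  move=> e e0; have [n ne] := pow (e / (4 * r + 1)) ltac:(by rewrite divr_gt0//; lra).
  have nr : 4 * r * 2^-1 ^+ n < e.
    move: ne; rewrite ltr_pdivlMr; last by lra.
    by have := p0 n; move: (2^-1 ^+ n) => p; nra.
  exists n => k m nk nm; have := metric_triangle dX (c n) (c k) (c m).
  rewrite (metric_sym dX (c k) (c n)).
  by have := cd' n k nk; have := cd' n m nm; lra.
exists l; first exact/(metric_cvgP dX).
apply/ler_addgt0Pr => e e0; have [N NP] := ll e e0.
have := cd' 0%N N (leq0n _); rewrite expr0 mulr1.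
have := NP N (leqnn _); have := metric_triangle dX (c N) (c 0%N) l.
lra.
Qed.

Section LocalCocycle.
Context {R : realType} {H : topologicalGroupType} {Y : topologicalType}.
Context {I V : countType}.
Variables (d : H -> H -> R) (dY : Y -> Y -> R) (act : H -> Y -> Y).
Variable q : nat -> H.
Hypotheses (dH : compatible_metric d) (dcomplete : complete_metric d).
Hypothesis qP : forall x (e : R), 0 < e -> exists n, d x (q n) < e.
Hypothesis dYP : compatible_metric dY.
Hypothesis actP : continuous_action act.

(** If [f1] and [f2] are generically in the same orbits, the group elements
    carrying one to the other may be chosen locally almost constant. The set of
    points where they can be found near [q] is the projection of a closed set;
    heaviness survives passing to smaller and smaller balls, and completeness
    turns the resulting chain of balls into a group element. *)
Lemma local_cocycle (C : set (I -> V)) (f1 f2 : (I -> V) -> Y) (e : R) x0 L0 :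
  comeager C -> continuous_on C f1 -> continuous_on C f2 ->
  (forall x, C x -> exists h, act h (f1 x) = f2 x) -> 0 < e ->
  exists x1 L1 k C', [/\ comeager C', agree L0 x0 x1, {subset L0 <= L1} &
    forall z, C' z -> agree L1 x1 z -> exists2 h, d h k < e & act h (f1 z) = f2 z].
Proof.
move=> cC c1 c2 f12 e0.
(* the balls of rank [j] are centred at the points of the dense sequence [q] *)
pose rad j : R := e / 8 * 2^-1 ^+ j.
have rad0 j : 0 < rad j by rewrite mulr_gt0 ?exprn_gt0// divr_gt0.
have radS j : rad j.+1 = rad j / 2 by rewrite /rad exprSr mulrA.
pose A (b : nat * nat) := [set z | C z /\
  exists2 h, d h (q b.1) < rad b.2 & act h (f1 z) = f2 z].
pose P (b : nat * nat) := [set b' : nat * nat | b'.2 = b.2.+1 /\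
  d (q b.1) (q b'.1) < 2 * rad b.2].
have AA b : A b `<=` \bigcup_(b' in P b) A b'.
  move=> z [Cz [h hb hz]]; have [l hl] := qP h (rad0 b.2.+1).
  exists (l, b.2.+1); last by split=> //; exists h.
  split=> //=; have := metric_triangle dH h (q b.1) (q l).
  rewrite (metric_sym dH (q b.1) h); move: hb hl; rewrite radS.
  by have := rad0 b.2; lra.
have cB := comeager_bigcap (fun b => comeager_heavy_child (AA b)).
set B := \bigcap_b _ in cB.
have [z [x0z [[Cz hz] iz]]] : exists z, agree L0 x0 z /\
    ((C z /\ forall b, A b z -> heavy (A b) z) /\
     forall b, heavy (A b) z -> inner (heavy (A b)) z).
  have := comeager_dense x0 L0 (comeagerI (comeagerI cC
    (comeager_bigcap (fun b => comeager_heavy (A b))))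
    (comeager_bigcap (fun b => dense_open_comeager (dense_open_inner (A b))))).
  by move=> [z xz [[Cz h1] h2]]; exists z; do !split=> //; move=> b;
     [exact: h1|exact: h2].
have [h hf] := f12 z Cz; have [l hl] := qP h (rad0 0%N).
have [L LA] := iz _ (hz (l, 0%N) ltac:(by split=> //; exists h)).
exists z, (L0 ++ L), (q l), (C `&` B); split=> //.
- exact: comeagerI.
- by move=> i iL; rewrite mem_cat iL.
move=> y [Cy By] /agree_cat[_ /LA hy].
have /choice[g gP] : forall b, exists b', heavy (A b) y -> P b b' /\ heavy (A b') y.
  move=> b; have [/(By b Logic.I)[b' Pb' hb']|nh] := pselect (heavy (A b) y).
    by exists b'.
  by exists b.
pose b n := iter n g (l, 0%N).
have hb n : heavy (A (b n)) y by elim: n => // n /gP[].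
have b2 n : (b n).2 = n by elim: n => // n IH; have [[/= -> _] _] := gP _ (hb n); rewrite IH.
have [k qk lk] : exists2 k, (fun n => q (b n).1) @ \oo --> k &
    d (q (b 0%N).1) k <= 2 * (2 * (e / 8)).
  apply: complete_geometric => // n; have [[_ lt] _] := gP (b n) (hb n).
  by apply: ltW; rewrite -mulrA -[X in _ ^+ X]b2; exact: lt.
exists k; first by rewrite (metric_sym dH); move: lk => /=; lra.
(* near [y] there are generic points carried by elements near [k], whence the
   equality at [y] by continuity *)
apply: (metric_eq0 dYP); apply/eqP; rewrite eq_le metric_ge0// andbT leNgt.
apply/negP; set eta := dY _ _ => eta0.
have [_ _ cact] := actP.
have := cact (k, f1 y) _ (nbhs_metric_ball dYP (act k (f1 y)) (divr_gt0 eta0 (ltr0n R 2))).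
move=> [[N1 N2]/= [/(metric_nbhs dH)[r r0 rN] N2y] N12].
have [L1 L1P] := c1 y Cy _ N2y.
have [L2 L2P] := c2 y Cy _ (nbhs_metric_ball dYP (f2 y) (divr_gt0 eta0 (ltr0n R 2))).
have /(metric_cvgP dH)/(_ (r / 2) ltac:(lra))[M MP] := qk.
have [M' M'P] : exists M', forall n, (M' <= n)%N -> rad n < r / 2.
  have : rad n @[n --> \oo] --> (e / 8 * 0 : R).
    apply: cvgMr; apply: cvg_expr; rewrite ger0_norm ?invr_ge0//; lra.
  rewrite mulr0 => /cvgrPdist_lt/(_ (r / 2) ltac:(lra))[M' _ M'P].
  exists M' => n /M'P /=; rewrite sub0r normrN ger0_norm//; exact/ltW/rad0.
pose n := maxn M M'.
have [y' /agree_cat[yy1 yy2] [_ [Cy' [h' h'n hh']]]] := hb n (L1 ++ L2) setT comeagerT.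
have N1h : N1 h'.
  apply: rN => /=; have := metric_triangle dH (q (b n).1) k h'.
  move: h'n (M'P n (leq_maxr _ _)) (MP n (leq_maxl _ _)); rewrite b2.
  by rewrite (metric_sym dH h') (metric_sym dH k (q _)); lra.
have := N12 (h', f1 y') (conj N1h (L1P _ yy1 Cy')); rewrite /= hh' => a1.
have /= a2 := L2P _ yy2 Cy'.
have := metric_triangle dYP (f2 y') (act k (f1 y)) (f2 y).
by rewrite (metric_sym dYP (f2 y') (f2 y)) -/eta; lra.
Qed.

End LocalCocycle.

(** * Generic collapse of wreath-product orbits *)

(** The entries [(m, a, k)] for fixed [(m, a)] form a bit sequence; the wreath
    product of the integers by the permutations of [nat] acts on the set of these
    pairs. *)
Definition index := (nat * int * nat)%type.
Definition array := index -> int.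

Definition shift (g : nat -> int) (x : array) : array :=
  fun i => x (i.1.1, i.1.2 + g i.1.1, i.2).

Definition permute_rows (t : nat -> nat) (x : array) : array :=
  fun i => x (t i.1.1, i.1.2, i.2).

Definition finitely_supported (g : nat -> int) :=
  exists b : nat, forall m, (b <= m)%N -> g m = 0.

Definition gadd (g g' : nat -> int) : nat -> int := fun m => g m + g' m.
Definition gopp (g : nat -> int) : nat -> int := fun m => - g m.

Lemma shift_shift g g' x : shift g (shift g' x) = shift (gadd g g') x.
Proof. by apply/funext => -[[m a] k]; rewrite /shift/= -addrA. Qed.

Lemma shift0 g x : (forall m, g m = 0) -> shift g x = x.
Proof. by move=> g0; apply/funext => -[[m a] k]; rewrite /shift/= g0 addr0. Qed.

Lemma shiftKV g x : shift g (shift (gopp g) x) = x.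
Proof. by rewrite shift_shift; apply: shift0 => m; rewrite /gadd /gopp subrr. Qed.

Lemma permute_rows_shift t g x :
  permute_rows t (shift g x) = shift (g \o t) (permute_rows t x).
Proof. by []. Qed.

Lemma finitely_supported_seq g : finitely_supported g ->
  exists s : seq int, g = nth 0 s.
Proof.
move=> [b gb]; exists (mkseq g b); apply/funext => m.
have [mb|bm] := ltnP m b; first by rewrite nth_mkseq.
by rewrite nth_default ?size_mkseq// gb.
Qed.

Lemma dense_open_reindex (I V : countType) (phi psi : I -> I) (U : set (I -> V)) :
  cancel phi psi -> cancel psi phi -> dense_open U ->
  dense_open [set x : I -> V | U (x \o phi)].
Proof.
move=> phiK psiK [oU dU]; split=> [x /oU[L LU]|x L].
  exists (map phi L) => y xy; apply: LU => i iL /=.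
  by apply: xy; apply/mapP; exists i.
have [y xy Uy] := dU (x \o phi) (map psi L).
exists (y \o psi) => [i iL/=|/=].
  by rewrite xy /= ?psiK//; apply/mapP; exists i.
by congr U: Uy; apply/funext => i /=; rewrite phiK.
Qed.

Lemma comeager_shift g (A : set array) : comeager A -> comeager [set x | A (shift g x)].
Proof.
apply: (@comeager_preimage _ _ _ _ (shift g)) => U oU.
apply: (@dense_open_reindex _ _ (fun i : index => (i.1.1, i.1.2 + g i.1.1, i.2))
  (fun i => (i.1.1, i.1.2 - g i.1.1, i.2))) oU => -[[m a] k] /=.
  by rewrite addrK.
by rewrite subrK.
Qed.

Lemma comeager_permute_rows t (A : set array) : involutive t -> comeager A ->
  comeager [set x | A (permute_rows t x)].
Proof.
move=> tK; apply: (@comeager_preimage _ _ _ _ (permute_rows t)) => U oU.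
apply: (@dense_open_reindex _ _ (fun i : index => (t i.1.1, i.1.2, i.2))
  (fun i => (t i.1.1, i.1.2, i.2))) oU => -[[m a] k] /=; by rewrite tK.
Qed.

Lemma comeager_shifts (A : set array) : comeager A ->
  comeager [set x | forall g, finitely_supported g -> A (shift g x)].
Proof.
move=> cA; have := comeager_bigcap (fun s : seq int => comeager_shift (nth 0 s) cA).
apply: comeagerS => x Ax g /finitely_supported_seq[s ->]; exact: (Ax s).
Qed.

Lemma dense_open_translate (I : countType) (v : I -> int) (U : set (I -> int)) :
  dense_open U -> dense_open [set x : I -> int | U (fun i => x i + v i)].
Proof.
move=> [oU dU]; split=> [x /oU[L LU]|x L].
  by exists L => y xy; apply: LU => i iL /=; rewrite xy.
have [y xy Uy] := dU (fun i => x i + v i) L.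
exists (fun i => y i - v i) => [i iL/=|/=]; first by rewrite xy// addrK.
by congr U: Uy; apply/funext => i /=; rewrite subrK.
Qed.

Section WreathOrbits.
Context {R : realType} {H : topologicalGroupType} {Y : topologicalType}.
Variables (d : H -> H -> R) (dY : Y -> Y -> R) (act : H -> Y -> Y).
Variable q : nat -> H.
Hypotheses (dH : compatible_metric d) (dcomplete : complete_metric d).
Hypothesis dinv : two_sided_invariant d.
Hypothesis qP : forall x (e : R), 0 < e -> exists n, d x (q n) < e.
Hypothesis dYP : compatible_metric dY.
Hypothesis actP : continuous_action act.

Lemma act1 y : act 1%g y = y. Proof. by have [h _ _] := actP. Qed.

Lemma actM g h y : act (g * h)%g y = act g (act h y).
Proof. by have [_ h' _] := actP. Qed.

Lemma actK g y z : act g y = z -> act g^-1%g z = y.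
Proof. by move=> <-; rewrite -actM mulVg act1. Qed.

Definition close e y y' := exists2 h, d h 1%g < e & act h y = y'.

Lemma dinv1 g h : d (g * h^-1)%g 1%g = d g h.
Proof.
by rewrite -[d (g * _)%g _](dinv h _ _).2 -mulgA mulVg mulg1 mul1g.
Qed.

Lemma dinvM g h : d (g * h)%g h = d g 1%g.
Proof. by rewrite -(dinv h g 1%g).2 mul1g. Qed.

Lemma close_trans e e' y y' y'' :
  close e y y' -> close e' y' y'' -> close (e + e') y y''.
Proof.
move=> [h hd hy] [k kd ky]; exists (k * h)%g; last by rewrite actM hy.
have := metric_triangle dH h (k * h)%g 1%g.
by rewrite dinvM; lra.
Qed.

Lemma close_le e e' y y' : e <= e' -> close e y y' -> close e' y y'.
Proof. by move=> ee [h hd hy]; exists h => //; exact: lt_le_trans ee. Qed.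

Lemma close_of_common e h h' k y y' y'' : d h k < e -> d h' k < e ->
  act h y = y' -> act h' y = y'' -> close (2 * e) y' y''.
Proof.
move=> hk h'k hy h'y; exists (h' * h^-1)%g; last by rewrite actM (actK hy).
rewrite dinv1; have := metric_triangle dH k h' h.
by rewrite (metric_sym dH k h); lra.
Qed.

(** Closeness can be transported along an approximately constant cocycle: the
    element carrying [y] to [y'] is [h'^-1 * b * h], which by invariance on both
    sides is about as close to 1 as [b]. *)
Lemma close_transport e e' h h' k y y' z z' : d h k < e -> d h' k < e ->
  act h y = z -> act h' y' = z' -> close e' z z' -> close (2 * e + e') y y'.
Proof.
move=> hk h'k hy h'y [b b1 bz]; exists (h'^-1 * (b * h))%g.
  rewrite -(dinv h' _ _).1 mulgA mulgV mul1g mulg1.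
  have := metric_triangle dH h (b * h)%g h'; have := metric_triangle dH k h h'.
  by rewrite dinvM (metric_sym dH k h'); lra.
by rewrite !actM hy bz (actK h'y).
Qed.

Variable F : array -> Y.
Variable C : set array.
Hypotheses (cC : comeager C) (cF : continuous_on C F).
Hypothesis F_shift : forall g x, exists h, act h (F x) = F (shift g x).
Hypothesis F_permute : forall t x, involutive t ->
  exists h, act h (F x) = F (permute_rows t x).

Definition rows_below N (L : seq index) := forall i, i \in L -> (i.1.1 < N)%N.

Lemma rows_below_ex (L : seq index) : exists N, rows_below N L.
Proof.
exists (\max_(i <- L) i.1.1).+1 => i iL; rewrite ltnS.
exact: (@leq_bigmax_seq _ _ xpredT (fun i : index => i.1.1)).
Qed.

(** Applied to a generic pair (array, shift), the cocycle from [x] to its shift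
    is almost constant on an open set, which restricts only finitely many rows of
    the shift; comparing two shifts in this open set, the remaining rows can be
    shifted at small cost. *)
Lemma high_rows_cheap (e : R) (x0 : array) L0 : 0 < e ->
  exists x1 L1 N C', [/\ comeager C', agree L0 x0 x1, {subset L0 <= L1},
    rows_below N L1 & forall x g, C' x -> agree L1 x1 x ->
      (forall m, (m < N)%N -> g m = 0) -> finitely_supported g ->
      close e (F x) (F (shift g x))].
Proof.
move=> e0.
(* a point of the product codes an array and a shift *)
pose fst_ (z : (index + nat)%type -> int) : array := z \o inl.
pose sh (z : (index + nat)%type -> int) := shift (z \o inr) (fst_ z).
pose CT := [set z | C (fst_ z) /\ C (sh z)].
have inl_do U : dense_open U -> dense_open [set z | U (fst_ z)].
  move=> [oU dU]; split=> [z /oU[L LU]|z L].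
    exists (map inl L) => y zy; apply: LU => i iL; apply: zy.
    by apply/mapP; exists i.
  have [LI [LJ sL]] := split_support L; have [x zx Ux] := dU (fst_ z) LI.
  exists (glue x (z \o inr)) => //; apply: (agree_sub sL).
  by rewrite {1}(glueE z); apply/agree_glue.
have sh_local z L : exists L', forall y, agree L' z y -> agree L (sh z) (sh y).
  exists (map inl [seq (i.1.1, i.1.2 + z (inr i.1.1), i.2) | i <- L] ++
          map inr (map (fun i : index => i.1.1) L)) => y zy i iL.
  rewrite /sh /shift /fst_ /=; have -> : y (inr i.1.1) = z (inr i.1.1).
    apply: zy; rewrite mem_cat; apply/orP; right.
    by apply/mapP; exists i.1.1 => //; apply/mapP; exists i.
  apply: zy; rewrite mem_cat; apply/orP; left.
  by apply/mapP; eexists; last reflexivity; apply/mapP; exists i.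
have sh_do U : dense_open U -> dense_open [set z | U (sh z)].
  move=> [oU dU]; split=> [z /oU[L LU]|z L].
    by have [L' L'P] := sh_local z L; exists L' => y /L'P; exact: LU.
  have [LI [LJ sL]] := split_support L.
  pose g : nat -> int := z \o inr.
  have [x zx Ux] := dU (sh z) [seq (i.1.1, i.1.2 - g i.1.1, i.2) | i <- LI].
  exists (glue (shift (gopp g) x) g); last first.
    by rewrite /= /sh /= /fst_ -/g; congr U: Ux; rewrite -[LHS](shiftKV g).
  apply: (agree_sub sL); rewrite {1}(glueE z); apply/agree_glue; split=> // i iL.
  rewrite /shift /gopp zx /sh /shift /fst_ /= -/g ?subrK.
    by case: i {iL} => [[]].
  by apply/mapP; exists i.
have cCT : comeager CT.
  by apply: comeagerI; [exact: comeager_preimage inl_do cC|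
                        exact: comeager_preimage sh_do cC].
have fst_on : continuous_on CT (F \o fst_).
  move=> z [Cz _] O /(cF Cz)[L LO]; exists (map inl L) => y zy [Cy _].
  by apply: LO => // i iL; apply: zy; apply/mapP; exists i.
have sh_on : continuous_on CT (F \o sh).
  move=> z [_ Cz] O /(cF Cz)[L LO]; have [L' L'P] := sh_local z L.
  by exists L' => y /L'P zy [_ Cy]; exact: LO.
pose rows (L : seq index) := [seq i.1.1 | i <- L].
have [z1 [L1 [k [C1 [cC1 a01 s01 hk]]]]] := local_cocycle dH dcomplete qP dYP actP
  (glue x0 (fun=> 0)) (map inl L0 ++ map inr (rows L0)) cCT fst_on sh_on
  (fun z _ => F_shift _ _) (divr_gt0 e0 (ltr0n R 2)).
have [LI [LJ sL1]] := split_support L1.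
pose Call := \bigcap_(s : seq int) [set z : (index + nat)%type -> int |
  C1 (fun i => z i + (if i is inr m then nth 0 s m else 0))].
have cCall : comeager (C1 `&` Call).
  apply: comeagerI => //; apply: comeager_bigcap => s.
  apply: (@comeager_preimage _ _ _ _ (fun z i => z i + _)) cC1.
  by move=> U; exact: dense_open_translate.
(* a generic shift [g] such that almost all arrays are good with it, and also
   with its finite modifications *)
have [g z1g cMg] := comeager_dense (z1 \o inr) LJ (comeager_slice cCall).
have z1E : forall i, i \in L0 -> i \in LI /\ g i.1.1 = 0.
  move=> i iL.
  have iL0 : inl i \in map inl L0 ++ map inr (rows L0).
    by rewrite mem_cat; apply/orP; left; apply/mapP; exists i.
  have iL0' : inr i.1.1 \in map inl L0 ++ map inr (rows L0).
    rewrite mem_cat; apply/orP; right; apply/mapP.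
    by exists i.1.1 => //; apply/mapP; exists i.
  split.
    have := sL1 _ (s01 _ iL0); rewrite mem_cat => /orP[]/mapP[j jL]//.
    by move=> [->].
  rewrite z1g /=; first by rewrite (a01 _ iL0').
  have := sL1 _ (s01 _ iL0'); rewrite mem_cat => /orP[]/mapP[j jL]//.
  by move=> [->].
pose x1 := shift g (fst_ z1).
have [N1 N1P] := rows_below_ex LI.
pose N := maxn N1 (\max_(m <- LJ) m).+1.
exists x1, [seq (i.1.1, i.1.2 - g i.1.1, i.2) | i <- LI], N,
  [set x | (C1 `&` Call) (glue (shift (gopp g) x) g)].
split.
- exact: (comeager_shift (gopp g) cMg).
- move=> i iL; have [iLI g0] := z1E i iL.
  rewrite /x1 /shift g0 addr0 /fst_ /= (a01 (inl (i.1.1, i.1.2, i.2))) /=.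
    by case: i {iL iLI g0} => [[]].
  by rewrite mem_cat; apply/orP; left; apply/mapP; exists i => //; case: i {iL iLI g0} => [[]].
- move=> i iL; have [iLI g0] := z1E i iL; apply/mapP; exists i => //.
  by rewrite g0 subr0; case: i {iL iLI g0} => [[]].
- by move=> _ /mapP[i iL ->]/=; apply: leq_trans (N1P i iL) _; exact: leq_maxl.
move=> x h [Cx Callx] x1x h0 /finitely_supported_seq[s hs].
set x' := shift (gopp g) x in Cx Callx.
have x'x : shift g x' = x by exact: shiftKV.
have ax' : agree LI (fst_ z1) x'.
  move=> i iL; rewrite /x' /shift /gopp.
  rewrite x1x; last by apply/mapP; exists i.
  by rewrite /x1 /shift /= subrK; case: i {iL} => [[]].
have a1 : agree L1 z1 (glue x' g).
  by apply: (agree_sub sL1); rewrite {1}(glueE z1); apply/agree_glue.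
have a2 : agree L1 z1 (glue x' (gadd g h)).
  apply: (agree_sub sL1); rewrite {1}(glueE z1); apply/agree_glue; split=> //.
  move=> m mL; rewrite /gadd h0 ?addr0; first exact: z1g.
  rewrite /N leq_max; apply/orP; right; rewrite ltnS.
  exact: (@leq_bigmax_seq _ _ xpredT id).
have C2 : C1 (glue x' (gadd g h)).
  have := Callx s Logic.I; congr C1; apply/funext => -[i|m] /=; first by rewrite addr0.
  by rewrite /gadd hs.
have [h1 h1k h1x] := hk _ Cx a1; have [h2 h2k h2x] := hk _ C2 a2.
have -> : e = 2 * (e / 2) by lra.
have e1 : act h1 (F x') = F x by rewrite -[X in _ = F X]x'x; exact: h1x.
have e2 : act h2 (F x') = F (shift h x).
  rewrite -[X in _ = F (shift _ X)]x'x shift_shift; have -> : gadd h g = gadd g h.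
    by apply/funext => m; rewrite /gadd addrC.
  exact: h2x.
exact: close_of_common h1k h2k e1 e2.
Qed.

(** Conjugating by the row exchange [m <-> m + N] moves the first [N] rows, which
    were expensive to shift, among the cheap ones. Since the metric is invariant
    on both sides, the exchange does not affect closeness, so that all rows are
    cheap. This is the step which fails for general Polish groups. *)
Lemma all_rows_cheap (e : R) (x0 : array) L0 : 0 < e ->
  exists x1 L1 C', [/\ comeager C', agree L0 x0 x1, {subset L0 <= L1} &
    forall x g, C' x -> agree L1 x1 x -> agree L1 x1 (shift g x) ->
      finitely_supported g -> close e (F x) (F (shift g x))].
Proof.
move=> e0; have e40 : 0 < e / 4 by rewrite divr_gt0.
have [x1 [L1 [N [C1 [cC1 a01 s01 r1 cheap]]]]] := high_rows_cheap x0 L0 e40.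
pose t m := if (m < N)%N then (m + N)%N
            else if (m < N + N)%N then (m - N)%N else m.
have tK : involutive t by move=> m; rewrite /t; do ![case: ifPn => //]; lia.
(* [x2] is [x1] with a copy of its first [N] rows among the next ones *)
pose ti (i : index) : index := (t i.1.1, i.1.2, i.2).
pose x2 : array := fun i => if (i.1.1 < N)%N then x1 i else x1 (ti i).
have a12 : agree L1 x1 x2 by move=> i /r1 iN; rewrite /x2 iN.
pose Ct := C `&` [set x | C (permute_rows t x)].
have c1 : continuous_on Ct F.
  by move=> x [Cx _] O /(cF Cx)[L LO]; exists L => y xy [Cy _]; exact: LO.
have c2 : continuous_on Ct (F \o permute_rows t).
  move=> x [_ Cx] O /(cF Cx)[L LO]; exists (map ti L) => y xy [_ Cy].
  by apply: LO => // i iL; apply: xy; apply/mapP; exists i.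
have [x3 [L3 [k [C3 [cC3 a23 s23 coc]]]]] := local_cocycle dH dcomplete qP dYP actP
  x2 (L1 ++ map ti L1) (comeagerI cC (comeager_permute_rows tK cC)) c1 c2
  (fun x _ => F_permute x tK) e40.
have a13 : agree L1 x1 x3.
  apply: agree_trans a12 _; apply: agree_sub a23 => i iL.
  by rewrite mem_cat iL.
have s13 : {subset L1 <= L3} by move=> i iL; apply: s23; rewrite mem_cat iL.
have a13t : forall x, agree L3 x3 x -> agree L1 x1 (permute_rows t x).
  move=> x x3x i iL; have iL' : ti i \in L1 ++ map ti L1.
    by rewrite mem_cat; apply/orP; right; apply/mapP; exists i.
  change (x (ti i) = x1 i); rewrite (x3x _ (s23 _ iL')) (a23 _ iL') /x2 /ti /=.
  have := r1 i iL; rewrite tK /t => iN; rewrite iN ifF; last by lia.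
  by case: i {iL iL' iN} => [[]].
exists x3, L3, [set x | forall g, finitely_supported g ->
  (C1 `&` C3 `&` [set x | C1 (permute_rows t x)]) (shift g x)]; split.
- apply: comeager_shifts; apply: comeagerI; first exact: comeagerI.
  exact: comeager_permute_rows.
- apply: agree_trans a01 _; exact: agree_sub a13.
- by move=> i /s01 /s13.
move=> x g Cx x3x x3gx [b gb].
(* [g1] is cheap by itself, and [g2] after the exchange *)
pose g1 m : int := if (m < N)%N then 0 else g m.
pose g2 m : int := if (m < N)%N then g m else 0.
have fg1 : finitely_supported g1.
  by exists b => m /gb gm; rewrite /g1 gm; case: ifP.
have f0 : finitely_supported (fun=> 0) by exists 0%N.
have s0 : shift (fun=> 0) x = x by exact: shift0.
have ggE : shift g x = shift g2 (shift g1 x).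
  rewrite shift_shift; congr (shift _ x); apply/funext => m.
  by rewrite /gadd /g1 /g2; case: ifP => _; rewrite ?addr0 ?add0r.
have := Cx _ f0; rewrite s0 => -[[C1x C3x] C1tx].
have [[C1g1 C3g1] C1tg1] := Cx _ fg1.
have [[_ C3g] _] := Cx g (ex_intro _ b gb).
have cl1 : close (e / 4) (F x) (F (shift g1 x)).
  apply: cheap => //; first by apply: agree_trans a13 _; exact: agree_sub x3x.
  by move=> m mN; rewrite /g1 mN.
have x3g1 : agree L3 x3 (shift g1 x).
  move=> i iL; rewrite /shift /g1; case: ifPn => iN.
    by rewrite addr0; case: i iL {iN} => [[m a] k']; exact: x3x.
  exact: x3gx.
have [h hk hx] := coc _ C3g1 x3g1; have [h' h'k h'x] := coc _ C3g x3gx.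
have cl2 : close (e / 4) (F (permute_rows t (shift g1 x)))
                         (F (permute_rows t (shift g x))).
  rewrite ggE [X in close _ _ (F X)]permute_rows_shift; apply: cheap => //; first exact: a13t.
    by move=> m mN /=; rewrite /g2 /t mN ifF//; lia.
  exists (N + N)%N => m mN /=; rewrite /g2 /t.
  by rewrite !ifF//; lia.
have cl3 := close_transport hk h'k hx h'x cl2.
apply: close_le (close_trans cl1 cl3); lra.
Qed.

(** Shrinking open sets on which the orbit relation moves less and less, the
    images of one generic point converge inside a single orbit of [H]; by
    continuity the limit is the image of the point of intersection, which does
    not depend on the generic point. *)
Lemma generic_orbit_collapse :
  exists2 D, comeager D & forall x x', D x -> D x' -> exists h, act h (F x) = F x'.
Proof.
have [U oU UC] := cC.
pose st := (array * seq index)%type.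
have pow0 n : (0 : R) < 2^-1 ^+ n by rewrite exprn_gt0.
have /choice[f fP] : forall nc : nat * st, exists c' : st * set array, [/\
    comeager c'.2,
    agree nc.2.2 nc.2.1 c'.1.1, {subset nc.2.2 <= c'.1.2},
    (forall i, pickle i = nc.1 -> i \in c'.1.2) /\
      (forall z, agree c'.1.2 c'.1.1 z -> U nc.1 z) &
    forall x g, c'.2 x -> agree c'.1.2 c'.1.1 x -> agree c'.1.2 c'.1.1 (shift g x) ->
      finitely_supported g -> close (2^-1 ^+ nc.1) (F x) (F (shift g x))].
  move=> [n [x0 L0]] /=.
  have [x1 [L1 [C' [cC' a01 s01 hC']]]] := all_rows_cheap x0 L0 (pow0 n).
  have [y x1y Uy] := (oU n).2 x1 L1; have [L' UL'] := (oU n).1 y Uy.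
  pose L2 := (L1 ++ L') ++
    (if @pickle_inv index n is Some i then [:: i] else [::]).
  have s12 : {subset L1 <= L2} by move=> i iL; rewrite !mem_cat iL.
  have a1 z : agree L2 y z -> agree L1 x1 z.
    by move=> yz; apply: agree_trans x1y _; exact: agree_sub yz.
  exists ((y, L2), C'); split=> //=.
  - by apply: agree_trans a01 _; exact: agree_sub x1y.
  - by move=> i /s01 /s12.
  - split=> [i ni|z /agree_cat[/agree_cat[_ /UL']]//].
    by rewrite mem_cat -ni pickleK_inv mem_head orbT.
  by move=> x g Cx /a1 yx /a1 ygx; exact: hC'.
pose c := fix c n : st := if n is m.+1 then (f (m, c m)).1 else (fun=> 0, [::]).
pose D n := (f (n, c n)).2.
have cS n := fP (n, c n).
have mono n m : {subset (c n).2 <= (c (m + n)%N).2} /\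
    agree (c n).2 (c n).1 (c (m + n)%N).1.
  elim: m => [|m [sm am]]; first by split; [|exact: agree_refl].
  have [_ a s _ _] := cS (m + n)%N.
  split; first by move=> i /sm /s.
  by apply: agree_trans am _; apply: agree_sub a.
pose w : array := fun i => (c (pickle i).+1).1 i.
have wP n : agree (c n).2 (c n).1 w.
  move=> i ic; rewrite /w.
  have [_ /(_ i) a] := mono (pickle i).+1 n.
  have [_ /(_ i ic) b] := mono n (pickle i).+1.
  have [_ _ _ [/(_ i erefl) ic' _] _] := cS (pickle i).
  by rewrite -(a ic') -b addnC.
have Cw : C w.
  by apply: UC => n _; have [_ _ _ [_ Un] _] := cS n; exact: Un (wP n.+1).
have cover : forall L : seq index, exists n, {subset L <= (c n).2}.
  elim=> [|i L [n nL]]; first by exists 0%N.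
  exists ((pickle i).+1 + n)%N => j; rewrite inE => /orP[/eqP ->|/nL jL].
    have [_ _ _ [/(_ i erefl) ic' _] _] := cS (pickle i).
    by rewrite addnC; exact: (mono (pickle i).+1 n).1.
  exact: (mono n _).1.
pose near n := [set x | exists2 g, finitely_supported g &
                        agree (c n).2 (c n).1 (shift g x)].
have onear n : dense_open (near n).
  split=> [x [g fg xg]|x L].
    exists [seq (i.1.1, i.1.2 + g i.1.1, i.2) | i <- (c n).2] => y xy.
    exists g => // i iL; rewrite -(xg i iL) /shift; apply: xy.
    by apply/mapP; exists i.
  (* shifted far enough, [y] is not constrained by [L] any more *)
  pose Mx := \max_(i <- L ++ (c n).2) `|i.1.2|%N.
  have MxP i : i \in L ++ (c n).2 -> (`|i.1.2| <= Mx)%N.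
    by move=> iL; exact: (@leq_bigmax_seq _ _ xpredT (fun i : index => `|i.1.2|%N)).
  have [N NP] := rows_below_ex (L ++ (c n).2).
  pose g m : int := if (m < N)%N then (Mx + Mx).+1%:Z else 0.
  pose y : array := fun i => if i \in L then x i
     else (c n).1 (i.1.1, i.1.2 - g i.1.1, i.2).
  exists y; first by move=> i iL; rewrite /y iL.
  exists g; first by exists N => m mN; rewrite /g ifF//; lia.
  move=> i iL; rewrite /shift /y /= addrK.
  rewrite ifF; first by case: i {iL} => [[]].
  apply/negP => iL'; have := NP i; have := MxP i; have := MxP _ (_ : _ \in L ++ (c n).2).
  move=> /(_ (i.1.1, i.1.2 + g i.1.1, i.2)); rewrite !mem_cat iL' iL orbT.
  by move=> /(_ isT) + /(_ isT) + /(_ isT); rewrite /g /= => + + iN; rewrite iN; lia.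
pose D0 := [set x | forall g, finitely_supported g ->
  (C `&` \bigcap_n D n) (shift g x)] `&` \bigcap_n near n.
have cD0 : comeager D0.
  apply: comeagerI.
    apply: comeager_shifts; apply: comeagerI => //; apply: comeager_bigcap => n.
    by have [] := cS n.
  by apply: comeager_bigcap => n; exact: dense_open_comeager.
suff hw x : D0 x -> exists h, act h (F x) = F w.
  exists D0 => // x x' /hw[h hx] /hw[h' hx'].
  by exists (h'^-1 * h)%g; rewrite actM hx; exact: actK.
move=> [Dx nx].
have /choice[g gP] : forall n, exists g, finitely_supported g /\
    agree (c n).2 (c n).1 (shift g x).
  by move=> n; have [g fg xg] := nx n Logic.I; exists g.
have /choice[k kP] : forall n, exists k, d k 1%g < 2^-1 ^+ n /\
    act k (F (shift (g n.+1) x)) = F (shift (g n.+2) x).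
  move=> n; have [[b1 g1b] a1] := gP n.+1; have [[b2 g2b] a2] := gP n.+2.
  pose g' := gadd (g n.+2) (gopp (g n.+1)).
  have gE : shift (g n.+2) x = shift g' (shift (g n.+1) x).
    rewrite shift_shift; congr (shift _ x); apply/funext => m.
    by rewrite /g' /gadd /gopp subrK.
  have fg' : finitely_supported g'.
    exists (b1 + b2)%N => m mb.
    by rewrite /g' /gadd /gopp g1b ?g2b ?subrr//; lia.
  have [_ _ _ _] := cS n; move=> /(_ (shift (g n.+1) x) g') [].
  - by have [_ Dn] := Dx _ (gP n.+1).1; exact: Dn.
  - exact: a1.
  - rewrite -gE; apply: agree_trans (mono n.+1 1%N).2 _.
    by apply: agree_sub a2; exact: (mono n.+1 1%N).1.
  - exact: fg'.
  by move=> h h1; rewrite -gE; exists h.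
(* the successive shifts of [x] approach [w], and the product [K] of the elements
   relating their images converges *)
pose K := fix K n : H := if n is m.+1 then (k m * K m)%g else 1%g.
have KE n : act (K n) (F (shift (g 1%N) x)) = F (shift (g n.+1) x).
  by elim: n => [|n IH] /=; rewrite ?act1// actM IH; have [] := kP n.
have [l Kl _] : exists2 l, K @ \oo --> l & d (K 0%N) l <= 2 * 1.
  apply: complete_geometric => // n; rewrite mul1r /= (metric_sym dH) dinvM ltW//.
  by have [] := kP n.
have lw : act l (F (shift (g 1%N) x)) = F w.
  have [_ _ cact] := actP.
  have a1 : (fun n => act (K n) (F (shift (g 1%N) x))) @ \oo -->
            act l (F (shift (g 1%N) x)).
    have : (fun n => (K n, F (shift (g 1%N) x))) @ \oo --> (l, F (shift (g 1%N) x)).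
      by apply: cvg_pair => //; exact: cvg_cst.
    by move=> /cvg_comp; move: (cact (l, F (shift (g 1%N) x))) => cc /(_ _ _ _ cc).
  have a2 : (fun n => act (K n) (F (shift (g 1%N) x))) @ \oo --> F w.
    move=> O /(cF Cw)[L LO]; have [n nL] := cover L; exists n => // m /= nm.
    rewrite KE; apply: LO; last by have [] := Dx _ (gP m.+1).1.
    move=> i iL; have iL' : i \in (c m.+1).2.
      by rewrite -(subnK nm) -addSn; apply: (mono n _).1; exact: nL.
    by rewrite ((gP m.+1).2 i iL') (wP m.+1 i iL').
  exact: (cvg_unique (metric_hausdorff dYP) a1 a2).
have [h hx] := F_shift (g 1%N) x.
by exists (l * h)%g; rewrite actM hx.
Qed.

End WreathOrbits.

(** A reduction is a Borel function of the codes, hence a generically continuous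
    function of the array. *)
Lemma classifiable_generic_collapse (R : realType) (Z : topologicalType)
    (E : Z -> Z -> Prop) (c : array -> Z) :
  (forall O, open O -> locally_determined (c @^-1` O)) ->
  (forall g x, E (c x) (c (shift g x))) ->
  (forall t x, involutive t -> E (c x) (c (permute_rows t x))) ->
  classifiable_by_TSI R E ->
  exists2 D, comeager D & forall x x', D x -> D x' -> E (c x) (c x').
Proof.
move=> oc Es Ep [H [Y [act [[[sepH [d' d'H d'c]] [d dH dinv] [sepY [dY dYP _]] actP]
  [f bf fE]]]]].
have dc := tsi_complete dH dinv d'H d'c.
have [S cS dS] := sepH; have [q qP] := countable_dense_seq dH 1%g cS dS.
have [S' cS' dS'] := sepY.
have [q' q'P] := countable_dense_seq dYP (f (c (fun=> 0))) cS' dS'.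
have [C cC cF] : exists2 C, comeager C & continuous_on C (f \o c).
  apply: (@generically_continuous index int R Y dY q' (f \o c) dYP q'P) => O oO.
  apply: (@borel_baire_property _ _ _ c oc (f @^-1` O)).
  by apply: bf; exact: sub_gen_smallest.
have [D cD DP] := generic_orbit_collapse dH dc dinv qP dYP actP cC cF
  (fun g x => (fE _ _).1 (Es g x)) (fun t x tK => (fE _ _).1 (Ep t x tK)).
by exists D => // x x' Dx Dx'; apply/fE; exact: DP.
Qed.

(** Generically the sequence [x (0, 0, -)] is not eventually zero; this being so,
    a generic [x'] has in each of its sequences a zero at some [k] where
    [x (0, 0, k)] does not vanish. *)
Lemma generic_distinct_sequences (D : set array) : comeager D ->
  exists x x', [/\ D x, D x' & forall m a, exists k,
    x (0%N, 0, k) != 0 /\ x' (m, a, k) = 0].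
Proof.
move=> cD.
pose inf n := [set x : array | exists2 k, (n <= k)%N & x (0%N, 0, k) != 0].
have fresh (L : seq index) : exists K, forall i, i \in L -> (i.2 < K)%N.
  exists (\max_(i <- L) i.2).+1 => i iL; rewrite ltnS.
  exact: (@leq_bigmax_seq _ _ xpredT (fun i : index => i.2)).
have oinf n : dense_open (inf n).
  split=> [x [k nk xk]|x L].
    exists [:: (0%N, 0, k)] => y xy; exists k => //.
    by rewrite xy// mem_head.
  have [K KP] := fresh L.
  exists (fun i => if i \in L then x i else 1); first by move=> i ->.
  exists (n + K)%N; first exact: leq_addr.
  by rewrite ifF//; apply/negP => /KP /=; rewrite ltnNge leq_addl.
have [x _ [Dx ix]] := comeager_dense (fun=> 0) [::]
  (comeagerI cD (comeager_bigcap (fun n => dense_open_comeager (oinf n)))).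
pose dis ma := [set y : array | exists2 k, x (0%N, 0, k) != 0 & y (ma, k) = 0].
have odis ma : dense_open (dis ma).
  split=> [y [k xk yk]|y L].
    exists [:: (ma, k)] => z yz; exists k => //.
    by rewrite yz// mem_head.
  have [K KP] := fresh L; have [k Kk xk] := ix K Logic.I.
  exists (fun i => if i \in L then y i else 0); first by move=> i ->.
  by exists k => //; case: ifP => // /KP /=; rewrite ltnNge Kk.
have [x' _ [Dx' ix']] := comeager_dense (fun=> 0) [::]
  (comeagerI cD (comeager_bigcap (fun ma => dense_open_comeager (odis ma)))).
exists x, x'; split=> // m a; have [k xk yk] := ix' (m, a) Logic.I.
by exists k.
Qed.

(** * The plane as a topological field *)

Local Open Scope complex_scope.

Lemma cvg_continuous (T : Type) (X Y : topologicalType) (g : X -> Y)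
    (F : set_system T) (f : T -> X) (l : X) :
  {for l, continuous g} -> f x @[x --> F] --> l -> g (f x) @[x --> F] --> g l.
Proof. by move=> cg cf; exact: cvg_comp cf cg. Qed.

Section ComplexTopology.
Context {R : realType}.
Local Notation C := (R[i]^o).
Local Notation re := complex.Re.
Local Notation im := complex.Im.
Implicit Types z w : R[i].

Lemma normc_eq z : `|z| = (Num.sqrt (re z ^+ 2 + im z ^+ 2))%:C.
Proof. by case: z. Qed.

Lemma cvg_complex (T : Type) (F : set_system T) (f g : T -> R) (a b : R) :
  Filter F -> f x @[x --> F] --> a -> g x @[x --> F] --> b ->
  ((f x +i* g x : C) @[x --> F] --> (a +i* b : C)).
Proof.
move=> FF fa gb; apply/cvgrPdist_lt => e.
case: e => e e'; rewrite ltcE /= => /andP[/eqP -> e0].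
have e20 : 0 < e / 2 by rewrite divr_gt0.
have := (cvgrPdist_lt _ _).1 fa _ e20; have := (cvgrPdist_lt _ _).1 gb _ e20.
move=> gn fn; near=> x.
have fx : `|a - f x| < e / 2 by near: x; exact: fn.
have gx : `|b - g x| < e / 2 by near: x; exact: gn.
rewrite normc_eq ltcR /=.
have le1 : Num.sqrt ((a - f x) ^+ 2 + (b - g x) ^+ 2) <= `|a - f x| + `|b - g x|.
  rewrite -(@ger0_norm _ (`|a - f x| + _)) ?addr_ge0// -sqrtr_sqr.
  rewrite ler_sqrt ?sqr_ge0// -(real_normK (num_real (a - f x))).
  rewrite -(real_normK (num_real (b - g x))) sqrrD lerD2r lerDl.
  by apply: mulrn_wge0; apply: mulr_ge0.
by apply: (le_lt_trans le1); lra.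
Unshelve. all: by end_near. Qed.

Lemma continuous_complex_lipschitz (f : C -> R) :
  (forall z w, `|f z - f w|%:C <= `|z - w|) -> continuous f.
Proof.
move=> fl z; have FF : Filter (nbhs (z : C)) by exact: nbhs_filter.
apply/(@cvgrPdist_lt _ _ _ (nbhs (z : C)) FF) => e e0.
have /(@cvgrPdist_lt _ _ _ (nbhs (z : C)) FF)/(_ e%:C) : (fun w : C => w) @ z --> z.
  exact: cvg_id.
rewrite ltcR => /(_ e0); apply: (@filterS _ (nbhs (z : C))) => w.
by move=> h; rewrite -ltcR; apply: le_lt_trans h; exact: fl.
Qed.

Lemma continuous_Re : continuous (fun z : C => re z).
Proof.
apply: continuous_complex_lipschitz => z w; apply: le_trans (normc_ge_Re _).
by rewrite lecR; case: (z) (w) => [a b] [c d].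
Qed.

Lemma continuous_Im : continuous (fun z : C => im z).
Proof.
apply: continuous_complex_lipschitz => z w.
have -> : `|z - w| = `|(z - w) * - 'i%C|.
  rewrite normc_eq [RHS]normc_eq; congr (Num.sqrt _)%:C.
  by case: (z) (w) => [a b] [c d] /=; ring.
apply: le_trans (normc_ge_Re _); rewrite lecR le_eqVlt; apply/orP; left.
by apply/eqP; congr `|_|; case: (z) (w) => [a b] [c d] /=; ring.
Qed.

Lemma cvg_re (T : Type) (F : set_system T) (f : T -> C) (a : C) :
  f x @[x --> F] --> a -> re (f x) @[x --> F] --> re a.
Proof. by apply: cvg_continuous; exact: continuous_Re. Qed.

Lemma cvg_im (T : Type) (F : set_system T) (f : T -> C) (a : C) :
  f x @[x --> F] --> a -> im (f x) @[x --> F] --> im a.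
Proof. by apply: cvg_continuous; exact: continuous_Im. Qed.

Lemma cvg_complexM (T : Type) (F : set_system T) (f g : T -> C) (a b : C) :
  Filter F -> f x @[x --> F] --> a -> g x @[x --> F] --> b ->
  (f x * g x : C) @[x --> F] --> (a * b : C).
Proof.
move=> FF fa gb.
have -> : (fun x => f x * g x : C) = (fun x =>
    (re (f x) * re (g x) - im (f x) * im (g x)) +i*
    (re (f x) * im (g x) + im (f x) * re (g x)) : C).
  by apply/funext => x; case: (f x) (g x) => [? ?] [? ?].
have -> : a * b = (re a * re b - im a * im b) +i* (re a * im b + im a * re b).
  by case: (a) (b) => [? ?] [? ?].
have [far fai] := (cvg_re fa, cvg_im fa); have [gbr gbi] := (cvg_re gb, cvg_im gb).
apply: cvg_complex.
  exact: (cvgB (cvgM far gbr) (cvgM fai gbi)).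
exact: (cvgD (cvgM far gbi) (cvgM fai gbr)).
Qed.

Lemma cvg_complexV (T : Type) (F : set_system T) (f : T -> C) (a : C) :
  Filter F -> a != 0 -> f x @[x --> F] --> a ->
  ((f x)^-1 : C) @[x --> F] --> (a^-1 : C).
Proof.
move=> FF a0 fa.
pose n2 (z : C) := re z ^+ 2 + im z ^+ 2.
have invE z : z^-1 = (re z / n2 z) +i* - (im z / n2 z) :> C by case: z.
rewrite invE; have -> : (fun x => (f x)^-1 : C) = (fun x =>
    (re (f x) / n2 (f x)) +i* - (im (f x) / n2 (f x)) : C).
  by apply/funext => x; rewrite invE.
have [far fai] := (cvg_re fa, cvg_im fa).
have n20 : n2 a != 0.
  apply: contra a0; rewrite paddr_eq0 ?sqr_ge0// !sqrf_eq0.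
  by case: (a) => x y /= /andP[/eqP -> /eqP ->].
have n2a : (n2 (f x))^-1 @[x --> F] --> (n2 a)^-1.
  by apply: cvgV => //; apply: cvgD; rewrite !expr2;
     [exact: (cvgM far far)|exact: (cvgM fai fai)].
apply: cvg_complex; first exact: (cvgM far n2a).
exact: (cvgN (cvgM fai n2a)).
Qed.

End ComplexTopology.

(** * The degree of the identity of the circle *)
Section NoRetraction.
Context {R : realType}.
Local Notation C := (R[i]^o).
Local Notation re := complex.Re.
Local Notation im := complex.Im.

(** The principal square root on the right half plane, where its formula is
    visibly continuous. *)
Definition csqrt (z : C) : C :=
  let c := Num.sqrt ((Num.sqrt (re z ^+ 2 + im z ^+ 2) + re z) / 2) in
  c +i* (im z / (2 * c)).

Lemma csqrt_sqr (z : C) : 0 < re z -> csqrt z ^+ 2 = z.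
Proof.
case: z => x y /= x0; rewrite /csqrt /=.
set r := Num.sqrt (_ + _); set c := Num.sqrt _.
have r0 : 0 <= r by exact: sqrtr_ge0.
have rr : r ^+ 2 = x ^+ 2 + y ^+ 2 by rewrite sqr_sqrtr ?addr_ge0 ?sqr_ge0.
have cc : c ^+ 2 = (r + x) / 2 by rewrite sqr_sqrtr// divr_ge0// addr_ge0// ltW.
have c0 : c != 0.
  by apply/eqP => c0; move: cc; rewrite c0 expr0n/=; lra.
apply/eqP; rewrite eq_complex /=; apply/andP; split; apply/eqP; last by field.
have -> : c * c - y / (2 * c) * (y / (2 * c)) = c ^+ 2 - y ^+ 2 / (4 * c ^+ 2).
  by field.
have -> : y ^+ 2 = r ^+ 2 - x ^+ 2 by rewrite rr; ring.
by rewrite cc; field; rewrite gt_eqF//; lra.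
Qed.

Lemma csqrt_continuous (z : C) : 0 < re z -> {for z, continuous csqrt}.
Proof.
move=> z0; have FF : Filter (nbhs (z : C)) by exact: nbhs_filter.
have cre : re x @[x --> (z : C)] --> re z by exact: continuous_Re.
have cim : im x @[x --> (z : C)] --> im z by exact: continuous_Im.
pose c (x : C) := Num.sqrt ((Num.sqrt (re x ^+ 2 + im x ^+ 2) + re x) / 2).
have cc : c x @[x --> (z : C)] --> c z.
  apply: (@cvg_continuous _ _ _ Num.sqrt); first exact: sqrt_continuous.
  apply: cvgMl; apply: cvgD => //.
  apply: (@cvg_continuous _ _ _ Num.sqrt); first exact: sqrt_continuous.
  by apply: cvgD; rewrite !expr2; apply: cvgM.
apply: cvg_complex => //; apply: cvgM => //; apply: cvgV; last exact: cvgMr.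
rewrite mulf_neq0// gt_eqF// sqrtr_gt0 divr_gt0//.
by rewrite ltr_wpDl// sqrtr_ge0.
Qed.

Lemma telescope_ratio (K : fieldType) (u : nat -> K) n : (forall j, u j != 0) ->
  \prod_(j < n) (u j.+1 / u j) = u n / u 0%N.
Proof.
move=> u0; elim: n => [|n IH]; first by rewrite big_ord0 divff.
by rewrite big_ord_recr /= IH; field; rewrite !u0.
Qed.

Definition scale_pt (t : R) (p : R * R) : R * R := (t * p.1, t * p.2).

Lemma scale_pt_cvg (T : Type) (F : set_system T) (t : T -> R) (p : T -> R * R) t0 p0 :
  Filter F -> t x @[x --> F] --> t0 -> p x @[x --> F] --> p0 ->
  scale_pt (t x) (p x) @[x --> F] --> scale_pt t0 p0.
Proof.
move=> FF ct cp.
have cp1 : (p x).1 @[x --> F] --> p0.1 by apply: cvg_comp cp _; exact: cvg_fst.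
have cp2 : (p x).2 @[x --> F] --> p0.2 by apply: cvg_comp cp _; exact: cvg_snd.
exact: (cvg_pair (cvgM ct cp1) (cvgM ct cp2)).
Qed.

(** Along the segments from the origin, [a] turns by less than a right angle
    between consecutive points of a fine subdivision, and the square root can be
    taken on each of the successive ratios. *)
Lemma continuous_square_root (a : R * R -> C) : continuous a ->
  (forall p, a p != 0) ->
  exists b : R * R -> C, forall p, `|p.1| <= 1 -> `|p.2| <= 1 ->
    {for p, continuous b} /\ b p ^+ 2 = a p.
Proof.
move=> ca a0.
pose K : set (R * (R * R)) := `[0, 1] `*` (`[-1, 1] `*` `[-1, 1]).
have Kc : compact K.
  by do ?[apply: compact_setX]; exact: segment_compact.
have /compact_near_coveringP Kn := Kc.
have [N _ NP] : \forall n \near \oo, K `<=` (fun n x =>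
    0 < re (a (scale_pt (x.1 + n.+1%:R^-1) x.2) / a (scale_pt x.1 x.2))) n.
  apply: Kn => -[t0 p0] _.
  pose F := filter_prod (nbhs ((t0, p0) : R * (R * R))) (\oo : set_system nat).
  have FF : Filter F by exact: filter_prod_filter.
  have c1 : x.1 @[x --> F] --> (t0, p0) by exact: cvg_fst.
  have ct : x.1.1 @[x --> F] --> t0 by apply: cvg_comp c1 _; exact: cvg_fst.
  have cp : x.1.2 @[x --> F] --> p0 by apply: cvg_comp c1 _; exact: cvg_snd.
  have cn : (x.2.+1%:R^-1 : R) @[x --> F] --> (0 : R).
    by apply: (@cvg_comp _ _ _ snd (fun n => n.+1%:R^-1 : R) F \oo (nbhs 0));
      [exact: cvg_snd|exact: cvg_harmonic].
  have c2 : a (scale_pt (x.1.1 + x.2.+1%:R^-1) x.1.2) @[x --> F] --> a (scale_pt t0 p0).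
    apply: (@cvg_continuous _ _ _ a); first exact: ca.
    by apply: scale_pt_cvg => //; rewrite -[X in _ --> X]addr0; exact: cvgD.
  have c3 : a (scale_pt x.1.1 x.1.2) @[x --> F] --> a (scale_pt t0 p0).
    by apply: (@cvg_continuous _ _ _ a); [exact: ca|exact: scale_pt_cvg].
  have c4 : (a (scale_pt (x.1.1 + x.2.+1%:R^-1) x.1.2) / a (scale_pt x.1.1 x.1.2) : C)
      @[x --> F] --> (1 : C).
    rewrite -(divff (a0 (scale_pt t0 p0))).
    exact: (cvg_complexM FF c2 (cvg_complexV FF (a0 _) c3)).
  have c5 : re (a (scale_pt (x.1.1 + x.2.+1%:R^-1) x.1.2) / a (scale_pt x.1.1 x.1.2))
      @[x --> F] --> (1 : R).
    exact: (cvg_re c4).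
  exact: (cvgr_gt _ c5 _ ltr01).
pose n := N.+1.
pose u (p : R * R) (j : nat) : C := a (scale_pt (j%:R / n%:R) p).
have n0 : (0 : R) < n%:R by rewrite ltr0n.
have u_gt0 (p : R * R) (j : nat) : `|p.1| <= 1 -> `|p.2| <= 1 -> (j < n)%N ->
    0 < re (u p j.+1 / u p j).
  move=> p1 p2 jn; have := NP N (leqnn _) (j%:R / n%:R, p); rewrite /= -/n.
  have -> : j%:R / n%:R + n%:R^-1 = j.+1%:R / n%:R :> R by rewrite (mulrSr 1 j) mulrDl mul1r.
  apply; split => /=; rewrite ?in_itv/=.
    by rewrite divr_ge0// ler_pdivrMr// mul1r ler_nat ltnW.
  by split; rewrite /= ?in_itv /= -ler_norml.
have u_cont j : continuous (fun p => u p j).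
  move=> p; apply: (@cvg_continuous _ _ _ a); first exact: ca.
  by apply: scale_pt_cvg; [exact: cvg_cst|exact: cvg_id].
pose b (p : R * R) : C := sqrtc (a (0, 0)) * \prod_(j < n) csqrt (u p j.+1 / u p j).
have prod_cont (p : R * R) m : `|p.1| <= 1 -> `|p.2| <= 1 -> (m <= n)%N ->
    (\prod_(j < m) csqrt (u x j.+1 / u x j) : C) @[x --> p] -->
    (\prod_(j < m) csqrt (u p j.+1 / u p j) : C).
  move=> p1 p2; elim: m => [|m IH] mn.
    rewrite big_ord0 [X in X @ _ --> _](_ : _ = fun=> 1); first exact: cvg_cst.
    by apply/funext => x; rewrite big_ord0.
  rewrite [X in X @ _ --> _](_ : _ = fun x =>
      (\prod_(j < m) csqrt (u x j.+1 / u x j)) * csqrt (u x m.+1 / u x m)).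
    rewrite big_ord_recr /=; apply: cvg_complexM; first exact/IH/ltnW.
    apply: (@cvg_continuous _ _ _ csqrt).
      by apply: csqrt_continuous; exact: u_gt0.
    apply: cvg_complexM; first exact: u_cont.
    by apply: cvg_complexV; [exact: a0|exact: u_cont].
  by apply/funext => x; rewrite big_ord_recr.
exists b => p p1 p2; split.
  by apply: cvg_complexM; [exact: cvg_cst|exact: prod_cont].
rewrite /b exprMn sqr_sqrtc -prodrXl.
rewrite (eq_bigr (fun j : 'I_n => u p j.+1 / u p j)); last first.
  by move=> j _; rewrite csqrt_sqr// u_gt0.
(* the product telescopes from the value at the origin *)
rewrite (telescope_ratio n (fun j => a0 _)) /u /scale_pt !mul0r divff ?gt_eqF//.
rewrite !mul1r mulrC divfK//.
by case: (p).
Qed.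

(** A square root of the identity of the circle would satisfy
    [b (- w) = e w * 'i * b w] with [e] continuous, of values 1 and -1, and odd. *)
Lemma no_retraction (a : R * R -> C) : continuous a -> (forall p, a p != 0) ->
  (forall y z, y ^+ 2 + z ^+ 2 = 1 -> a (y, z) = y +i* z) -> False.
Proof.
move=> ca a0 aid; have [b bP] := continuous_square_root ca a0.
pose h (t : R) := Num.sqrt (1 - t ^+ 2).
(* [t] parametrizes the upper half circle, and [v t] is the function [e] *)
pose v (t : R) : C := - 'i * (b (- t, - h t) / b (t, h t)).
have ht t : -1 <= t <= 1 -> t ^+ 2 + h t ^+ 2 = 1.
  by move=> t1; rewrite /h sqr_sqrtr; [ring|nra].
have h1 t : -1 <= t <= 1 -> `|t| <= 1 /\ `|h t| <= 1.
  move=> t1; split; first by rewrite ler_norml.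
  rewrite ger0_norm ?sqrtr_ge0// -[leRHS]sqrtr1 ler_sqrt//.
  by rewrite gerBl sqr_ge0.
have bsq y z : `|y| <= 1 -> `|z| <= 1 -> b (y, z) ^+ 2 = a (y, z).
  by move=> y1 z1; have [] := bP (y, z) y1 z1.
have bn0 y z : `|y| <= 1 -> `|z| <= 1 -> b (y, z) != 0.
  by move=> y1 z1; apply: contra (a0 (y, z)); rewrite -bsq// => /eqP ->; rewrite expr0n.
have vv t : -1 <= t <= 1 -> v t ^+ 2 = 1.
  move=> t1; have [t2 t3] := h1 t t1; have tt := ht t t1.
  rewrite /v exprMn expr_div_n !bsq ?normrN// !aid ?sqrrN//.
  have -> : - t +i* - h t = - (t +i* h t) :> C by [].
  rewrite mulNr divff ?sqrrN ?sqr_i ?mulrNN ?mulr1//.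
  by rewrite -aid ?a0.
have vre t : -1 <= t <= 1 -> v t = 1 \/ v t = -1.
  move=> /vv /eqP; rewrite -subr_eq0 subr_sqr_1 mulf_eq0 => /orP[]/eqP E; [left|right].
    exact: subr0_eq.
  by apply/eqP; rewrite -addr_eq0 E.
have cv : {within `[-1, 1], continuous (fun t => re (v t))}.
  apply: continuous_in_subspaceT => t; rewrite inE /= in_itv /= => t1.
  have [t2 t3] := h1 t t1.
  have ch : {for t, continuous h}.
    apply: (@cvg_continuous _ _ _ Num.sqrt); first exact: sqrt_continuous.
    by apply: cvgB; [exact: cvg_cst|rewrite expr2; exact: cvgM].
  apply: cvg_re; apply: cvg_complexM; first exact: cvg_cst.
  apply: cvg_complexM.
    apply: (@cvg_continuous _ _ _ b); first by apply: (bP _ _ _).1; rewrite normrN.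
    exact: (cvg_pair (cvgN cvg_id) (cvgN ch)).
  apply: cvg_complexV; first exact: bn0.
  apply: (@cvg_continuous _ _ _ b); first by apply: (bP _ _ _).1.
  exact: (cvg_pair cvg_id ch).
have h0 : h 1 = 0 /\ h (-1) = 0 by rewrite /h sqrrN expr1n subrr sqrtr0.
have odd : v (-1) = - v 1.
  have v1 : v 1 ^+ 2 = 1 by apply: vv; lra.
  have b1 : b (1, 0) != 0 by apply: bn0; rewrite ?normr1 ?normr0.
  have b2 : b (-1, 0) != 0 by apply: bn0; rewrite ?normrN ?normr1 ?normr0.
  have E : v (-1) * v 1 = -1.
    rewrite /v h0.1 h0.2 opprK oppr0 mulrACA mulrNN -expr2 sqr_i.
    by rewrite [X in _ * X]mulrA divfK// divff// mulr1.
  by rewrite -[LHS]mulr1 -v1 expr2 mulrA E mulN1r.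
have lt11 : (-1 : R) <= 1 by lra.
have [|t] := IVT (v := 0) lt11 cv.
  rewrite /= odd; have [->|->] := vre 1 ltac:(lra);
  by rewrite ge_min le_max /= ?oppr0 ?opprK; apply/andP; split; apply/orP; lra.
rewrite in_itv /= => t1.
by have [->|->] := vre t t1 => /=; lra.
Qed.

End NoRetraction.

(** * Polish spaces *)

Lemma countable_image (T U : Type) (f : T -> U) (A : set T) :
  countable A -> countable (f @` A).
Proof. by apply: sub_countable; exact: card_image_le. Qed.

Section Polish.
Context {R : realType}.

Lemma polish_homeo (X Y : topologicalType) (f : X -> Y) (g : Y -> X) :
  continuous f -> continuous g -> cancel f g -> cancel g f ->
  polish R X -> polish R Y.
Proof.
move=> cf cg fK gK [[S cS dS] [d [dm dn] dc]]; split.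
  exists (f @` S); first exact: countable_image.
  move=> O [y Oy] oO; have [|x [Ox Sx]] := dS (f @^-1` O) _ ((continuousP f).1 cf O oO).
  - by exists (g y); rewrite /= gK.
  - by exists (f x); split=> //; exists x.
have [d1 d2 d3 d4] := dm.
exists (fun y y' => d (g y) (g y')).
  split.
    split=> [y y'|y y'|y y'|x y z]; [exact: d1| |exact: d3|exact: d4].
    split=> [/d2|->]; last exact/d2.
    exact: (can_inj gK).
  move=> y A; split.
    move=> yA; have /dn[e e0 eA] : nbhs (g y) (f @^-1` A).
      by apply: cf; rewrite gK.
    by exists e => // y' /eA /=; rewrite gK.
  move=> [e e0 eA]; have yB : nbhs (g y) [set x | d (g y) x < e].
    by apply/dn; exists e.
  by apply: (@filterS _ (nbhs y) _ _ _ _ (cg y _ yB)) => y'; exact: eA.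
move=> u uc; have [l ll] := dc (g \o u) uc.
by exists (f l) => e /ll; rewrite fK.
Qed.

Lemma polish_prod (X Y : topologicalType) :
  polish R X -> polish R Y -> polish R (X * Y)%type.
Proof.
move=> [[S cS dS] [d dX dc]] [[S' cS' dS'] [d' d'Y d'c]]; split.
  exists (S `*` S'); first exact: countableX.
  move=> O [[x y] Oxy] oO.
  have [[A B] /= [xA yB] ABO] : nbhs (x, y) O by exact: open_nbhs_nbhs.
  move: xA yB; rewrite nbhsE nbhsE => -[A' [oA' xA'] A'A] [B' [oB' yB'] B'B].
  have [|a [A'a Sa]] := dS A' _ oA'; first by exists x.
  have [|b [B'b Sb]] := dS' B' _ oB'; first by exists y.
  exists (a, b); split=> //; apply: ABO; split => /=; [exact: A'A|exact: B'B].
exists (fun p q => d p.1 q.1 + d' p.2 q.2).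
  split.
    split=> [p q|p q|p q|p q r].
    - by rewrite addr_ge0// (metric_ge0 dX, metric_ge0 d'Y).
    - split=> [/eqP|->]; last by rewrite (metric_xx dX) (metric_xx d'Y) addr0.
      rewrite paddr_eq0 ?(metric_ge0 dX)// ?(metric_ge0 d'Y)// => /andP[/eqP a /eqP b].
      case: p q a b => [p1 p2] [q1 q2] /= /(metric_eq0 dX) -> /(metric_eq0 d'Y) ->//.
    - by rewrite (metric_sym dX) (metric_sym d'Y).
    have := metric_triangle dX q.1 p.1 r.1.
    by have := metric_triangle d'Y q.2 p.2 r.2; lra.
  move=> [x y] A; split.
    move=> [[P Q] /= [/(metric_nbhs dX)[e e0 eP] /(metric_nbhs d'Y)[e' e'0 eQ]] PQ].
    exists (Num.min e e'); first by rewrite lt_min e0.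
    move=> [x' y'] /=; rewrite lt_min => /andP[h1 h2]; apply: PQ; split => /=.
      by apply: eP => /=; have := metric_ge0 d'Y y y'; lra.
    by apply: eQ => /=; have := metric_ge0 dX x x'; lra.
  move=> [e e0 eA]; exists ([set x' | d x x' < e / 2], [set y' | d' y y' < e / 2]).
    by split; apply: nbhs_metric_ball => //; rewrite divr_gt0.
  by move=> [x' y'] [/= h1 h2]; apply: eA => /=; lra.
move=> u uc.
have [|l ll] := dc (fun n => (u n).1).
  move=> e /uc[N NP]; exists N => m n Nm Nn.
  by have := NP m n Nm Nn; have := metric_ge0 d'Y (u m).2 (u n).2; lra.
have [|l' ll'] := d'c (fun n => (u n).2).
  move=> e /uc[N NP]; exists N => m n Nm Nn.
  by have := NP m n Nm Nn; have := metric_ge0 dX (u m).1 (u n).1; lra.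
exists (l, l') => e e0; have e20 : 0 < e / 2 by rewrite divr_gt0.
have [N NP] := ll _ e20; have [N' N'P] := ll' _ e20.
exists (maxn N N') => n; rewrite geq_max => /andP[/NP h1 /N'P h2] /=.
by move: h1 h2; lra.
Qed.

Lemma nbhs_set_type (X : topologicalType) (A : set X) (x : A) (U : set A) :
  nbhs x U <-> exists2 V, nbhs (set_val x) V & forall y : A, V (set_val y) -> U y.
Proof.
split.
  rewrite nbhsE => -[_ [[V oV <-] Vx] VU]; exists V; first by exists V.
  by move=> y Vy; apply: VU.
move=> [V xV VU]; have : nbhs x (set_val @^-1` V) by exact: initial_continuous.
by apply: filterS => y; exact: VU.
Qed.

Lemma polish_closed (X : topologicalType) (A : set X) :
  closed A -> polish R X -> polish R A.
Proof.
move=> cA [[S cS dS] [d dX dc]].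
have [[a0]|noA] := pselect (inhabited A); last first.
  split.
    exists set0 => // O [a]; exfalso; exact: noA (inhabits a).
  exists (fun _ _ => 0) => [|u]; last by exfalso; exact: noA (inhabits (u 0%N)).
  by split=> [|a]; [split=> a; exfalso; exact: noA (inhabits a)|
                    exfalso; exact: noA (inhabits a)].
pose dA (x y : A) := d (set_val x) (set_val y).
have dAm : compatible_metric dA.
  split.
    split=> [x y|x y|x y|x y z].
    - exact: (metric_ge0 dX).
    - split=> [/(metric_eq0 dX)|->]; [exact: val_inj|exact: (metric_xx dX)].
    - exact: (metric_sym dX).
    - exact: (metric_triangle dX).
  move=> x U; split.
    move=> /nbhs_set_type[V /(metric_nbhs dX)[e e0 eV] VU]; exists e => // y /= xy.
    by apply: VU; exact: eV.
  move=> [e e0 eU]; apply/nbhs_set_type; exists [set y | d (set_val x) y < e].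
    exact: nbhs_metric_ball.
  by move=> y; exact: eU.
split; last first.
  exists dA => // u uc; have [l ll] := dc (set_val \o u) uc.
  have Al : A l.
    apply: cA => V /(metric_nbhs dX)[e e0 eV]; have [N NP] := ll e e0.
    exists (set_val (u N)); split; first exact: set_valP.
    by apply: eV => /=; rewrite (metric_sym dX); exact: NP.
  exists (exist _ l (mem_set Al)) => e /ll[N NP]; exists N => n /NP.
  by rewrite /dA.
have [q qP] := countable_dense_seq dX (set_val a0) cS dS.
pose P (nk : nat * nat) (a : A) := d (set_val a) (q nk.1) < nk.2.+1%:R^-1.
have /choice[s sP] : forall nk, exists a, (exists b, P nk b) -> P nk a.
  move=> nk; have [[b Pb]|nb] := pselect (exists b, P nk b); first by exists b.
  by exists a0.
exists (range s); first exact: countable_image.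
move=> O [x Ox] oO.
have /(metric_nbhs dAm)[e e0 eO] : nbhs x O by exact: open_nbhs_nbhs.
have [k _ kP] := near_infty_natSinv_lt (PosNum (divr_gt0 e0 (ltr0n R 2))).
have ke : k.+1%:R^-1 < e / 2 := kP k (leqnn _).
have [n xn] := qP (set_val x) k.+1%:R^-1 ltac:(by rewrite invr_gt0).
have sn : P (n, k) (s (n, k)) by apply: sP; exists x.
exists (s (n, k)); split; last by exists (n, k).
apply: eO => /=; have := metric_triangle dX (q n) (set_val x) (set_val (s (n, k))).
move: sn; rewrite /P /= (metric_sym dX (q n)) /dA.
by move: (k.+1%:R^-1) ke xn => r; lra.
Qed.

Lemma polish_real : polish R R.
Proof.
split.
  exists (range (@ratr R)); last exact: dense_rat.
  exact: countable_image.
exists (fun x y : R => `|x - y|).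
  split.
    split=> [x y|x y|x y|x y z].
    - exact: normr_ge0.
    - by split=> [/normr0_eq0/subr0_eq|->]; rewrite ?subrr ?normr0.
    - exact: distrC.
    - by rewrite -[x - z](subrKA y); exact: ler_normD.
  move=> x A; split.
    by rewrite -nbhs_ballE => -[e e0 eA]; exists e.
  by move=> [e e0 eA]; rewrite -nbhs_ballE; exists e.
move=> u uc; have /cauchy_cvgP/cvg_ex[l ll] : cauchy (u @ \oo).
  apply: cauchy_exP => e /uc[N NP]; exists (u N); exists N => // n /= Nn.
  exact: NP.
exists l => e e0; have [N _ NP] := (cvgrPdist_lt _ _).1 ll e e0.
by exists N => n /NP; rewrite distrC.
Qed.

Lemma polish_complex : polish R R[i]^o.
Proof.
apply: (@polish_homeo _ _ (fun p : R * R => (p.1 +i* p.2 : R[i]^o))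
  (fun z => (complex.Re z, complex.Im z))) (polish_prod polish_real polish_real).
- by move=> p; apply: cvg_complex; [exact: cvg_fst|exact: cvg_snd].
- by move=> z; exact: (cvg_pair (@continuous_Re R z) (@continuous_Im R z)).
- by case.
- by case.
Qed.

Lemma polish_nat : polish R nat.
Proof.
split.
  by exists setT => [|O [n On] _]; [exact: countableP|exists n].
exists (fun m n => (m != n)%:R) => [|u uc].
  split.
    split=> [x y|x y|x y|x y z].
    - exact: ler0n.
    - by split=> [/eqP|->]; rewrite ?eqxx// pnatr_eq0 eqb0 negbK => /eqP.
    - by rewrite eq_sym.
    - rewrite -natrD ler_nat.
      by case: (eqVneq x y) => [->//|xy]; case: (eqVneq x z).
  move=> x A; split=> [/nbhs_singleton Ax|[e e0 eA]].
    exists 1 => // y /=; case: eqVneq => [<-//|_]; by rewrite ltxx.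
  by apply/principal_filterP; apply: eA; rewrite /= eqxx.
have [N NP] := uc 1 ltr01; exists (u N) => e e0; exists N => n Nn.
by have := NP n N Nn (leqnn _); case: eqVneq => // _; rewrite ltxx.
Qed.

Lemma polish_metrizable (X : topologicalType) : polish R X -> metrizable R X.
Proof. by move=> [_ [d dX _]]; exists d. Qed.

Lemma polish_second_countable (X : topologicalType) :
  polish R X -> @second_countable X.
Proof.
move=> [[S cS dS] [d dX _]].
pose ballN (sk : X * nat) := [set y | d sk.1 y < sk.2.+1%:R^-1].
exists (ballN @` (S `*` setT)).
  by apply: countable_image; exact: countableX.
split.
  by move=> _ [sk _ <-]; exact: metric_ball_open.
move=> x U /(metric_nbhs dX)[e e0 eU].
have [k _ kP] := near_infty_natSinv_lt (PosNum (divr_gt0 e0 (ltr0n R 2))).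
have ke : k.+1%:R^-1 < e / 2 := kP k (leqnn _).
have [|s [xs Ss]] := dS [set y | d x y < k.+1%:R^-1] _ (metric_ball_open dX _ _).
  by exists x; rewrite /= (metric_xx dX) invr_gt0.
exists (ballN (s, k)); last first.
  move=> y /= sy; apply: eU => /=; have := metric_triangle dX s x y.
  by move: xs sy ke; rewrite /ballN /=; move: (k.+1%:R^-1) => r; lra.
by split; [exists (s, k)|rewrite /ballN /= (metric_sym dX)].
Qed.

End Polish.

(** * The 2-sphere *)

Lemma cvg_set_type (T : Type) (X : topologicalType) (A : set X) (F : set_system T)
    (f : T -> A) (l : A) : Filter F ->
  set_val (f x) @[x --> F] --> set_val l -> f x @[x --> F] --> l.
Proof.
move=> FF fl U /nbhs_set_type[V /fl FV VU].
by apply: (@filterS _ F _ _ _ _ FV) => x; exact: VU.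
Qed.

Lemma cvg_set_val (T : Type) (X : topologicalType) (A : set X) (F : set_system T)
    (f : T -> A) (l : A) :
  f x @[x --> F] --> l -> set_val (f x) @[x --> F] --> set_val l.
Proof. by apply: cvg_continuous; exact: initial_continuous. Qed.

Lemma compact_set_type (X : topologicalType) (A : set X) :
  compact A -> compact [set: A].
Proof.
move=> cA F FF _; pose G : set_system X := [set V | F (set_val @^-1` V)].
have GF : ProperFilter G.
  split=> [/(filter_ex (F := F))[]//|]; split=> [|P Q|P Q PQ].
  - exact: filterT.
  - exact: filterI.
  - by rewrite /G /=; apply: filterS => x; exact: PQ.
have [|a [Aa Ga]] := cA G GF.
  by rewrite /G /=; apply: filterS filterT => x _; exact: set_valP.
exists (exist _ a (mem_set Aa)); split=> // P Q FP /nbhs_set_type[V aV VQ].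
have [|_ [[x Px <-] Vx]] := Ga (set_val @` P) V _ aV.
  by rewrite /G /=; apply: filterS FP => x Px; exists x.
by exists x; split=> //; exact: VQ.
Qed.

Section Sphere.
Context {R : realType}.
Local Notation pt := (R * (R * R))%type.

Definition dot (u v : pt) : R := u.1 * v.1 + u.2.1 * v.2.1 + u.2.2 * v.2.2.
Definition norm2 (v : pt) : R := dot v v.

Definition sphere_set : set pt := [set v | norm2 v = 1].
Definition sphere2 : Type := sphere_set.
HB.instance Definition _ := Topological.on sphere2.

Definition sval2 (q : sphere2) : pt := set_val q.

Lemma sval2P q : norm2 (sval2 q) = 1.
Proof. by case: q => q q1; exact: (set_mem q1). Qed.

Lemma sval2_inj : injective sval2. Proof. by move=> p q; exact: val_inj. Qed.

Lemma cvg_sval2 (T : Type) (F : set_system T) (f : T -> sphere2) (l : sphere2) :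
  f x @[x --> F] --> l -> sval2 (f x) @[x --> F] --> sval2 l.
Proof. exact: cvg_set_val. Qed.

Lemma cvg_sphere2 (T : Type) (F : set_system T) (f : T -> sphere2) (l : sphere2) :
  Filter F -> sval2 (f x) @[x --> F] --> sval2 l -> f x @[x --> F] --> l.
Proof. by move=> FF fl; exact: cvg_set_type. Qed.

Lemma cvg_pt (T : Type) (F : set_system T) (a b c : T -> R) (a0 b0 c0 : R) : Filter F ->
  a x @[x --> F] --> a0 -> b x @[x --> F] --> b0 -> c x @[x --> F] --> c0 ->
  (a x, (b x, c x)) @[x --> F] --> (a0, (b0, c0)).
Proof. by move=> FF ha hb hc; exact: (cvg_pair ha (cvg_pair hb hc)). Qed.

Lemma cvg_coord (T : Type) (F : set_system T) (v : T -> pt) (v0 : pt) : Filter F ->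
  v x @[x --> F] --> v0 ->
  [/\ (v x).1 @[x --> F] --> v0.1, (v x).2.1 @[x --> F] --> v0.2.1 &
      (v x).2.2 @[x --> F] --> v0.2.2].
Proof.
move=> FF vv.
have v2 : (v x).2 @[x --> F] --> v0.2 by apply: cvg_comp vv _; exact: cvg_snd.
split; first by apply: cvg_comp vv _; exact: cvg_fst.
  by apply: cvg_comp v2 _; exact: cvg_fst.
by apply: cvg_comp v2 _; exact: cvg_snd.
Qed.

Lemma cvg_dot (T : Type) (F : set_system T) (u v : T -> pt) (u0 v0 : pt) : Filter F ->
  u x @[x --> F] --> u0 -> v x @[x --> F] --> v0 ->
  dot (u x) (v x) @[x --> F] --> dot u0 v0.
Proof.
move=> FF /cvg_coord[u1 u2 u3] /cvg_coord[v1 v2 v3].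
exact: (cvgD (cvgD (cvgM u1 v1) (cvgM u2 v2)) (cvgM u3 v3)).
Qed.

Definition pole : sphere2.
Proof.
exists (1, (0, 0)); apply/mem_set; rewrite /sphere_set /= /norm2 /dot /=.
by rewrite !mulr0 !addr0 mulr1.
Defined.

Definition unit_vec (v : pt) : pt :=
  let r := Num.sqrt (norm2 v) in (v.1 / r, (v.2.1 / r, v.2.2 / r)).

Definition normalize (v : pt) : sphere2 :=
  match pselect (sphere_set (unit_vec v)) with
  | left h => exist _ (unit_vec v) (mem_set h)
  | right _ => pole
  end.

Lemma norm2_ge0 v : 0 <= norm2 v.
Proof. by rewrite /norm2 /dot -!expr2 !addr_ge0// sqr_ge0. Qed.

Lemma sval2_normalize v : norm2 v != 0 -> sval2 (normalize v) = unit_vec v.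
Proof.
move=> v0; rewrite /normalize; case: pselect => // -[].
rewrite /sphere_set /= /unit_vec /norm2 /dot /=; set r := Num.sqrt _.
have rr : r ^+ 2 = norm2 v by rewrite sqr_sqrtr// norm2_ge0.
have r0 : r != 0 by apply: contra v0 => /eqP r0; rewrite -rr r0 expr0n.
have -> : v.1 / r * (v.1 / r) + v.2.1 / r * (v.2.1 / r) + v.2.2 / r * (v.2.2 / r)
  = norm2 v / r ^+ 2 by rewrite /norm2 /dot; field.
by rewrite rr divff.
Qed.

Lemma normalize_id v : norm2 v = 1 -> sval2 (normalize v) = v.
Proof.
move=> v1; rewrite sval2_normalize ?v1 ?oner_eq0//.
by rewrite /unit_vec v1 sqrtr1 !divr1; case: v {v1} => [? []].
Qed.

Lemma normalize_continuous v : norm2 v != 0 -> {for v, continuous normalize}.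
Proof.
move=> v0; apply: cvg_sphere2.
have cid : (fun u : pt => u) @ v --> v by exact: cvg_id.
have cn : norm2 u @[u --> v] --> norm2 v by exact: cvg_dot.
rewrite sval2_normalize//.
have cr : (Num.sqrt (norm2 u))^-1 @[u --> v] --> (Num.sqrt (norm2 v))^-1.
  apply: cvgV; first by rewrite sqrtr_eq0 -ltNge lt_neqAle eq_sym v0 norm2_ge0.
  by apply: (@cvg_continuous _ _ _ Num.sqrt) cn; exact: sqrt_continuous.
have [c1 c2 c3] := cvg_coord (nbhs_filter v) cid.
have cu : unit_vec u @[u --> v] --> unit_vec v.
  exact: (cvg_pt _ (cvgM c1 cr) (cvgM c2 cr) (cvgM c3 cr)).
apply: cvg_trans cu; apply: near_eq_cvg.
have : \forall u \near v, 0 < norm2 u.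
  by apply: (cvgr_gt _ cn); rewrite lt_neqAle eq_sym v0 norm2_ge0.
by apply: filterS => u u0; rewrite sval2_normalize// gt_eqF.
Qed.

(** The arc joins [q] to the antipode of [p] without meeting [p]. *)
Definition arc (p q : pt) (t : R) : pt :=
  ((t - 1) * p.1 + t * q.1, ((t - 1) * p.2.1 + t * q.2.1,
                             (t - 1) * p.2.2 + t * q.2.2)).

Lemma collinear_unit (p q : pt) s t : norm2 p = 1 -> norm2 q = 1 -> p <> q ->
  t * q.1 = s * p.1 -> t * q.2.1 = s * p.2.1 -> t * q.2.2 = s * p.2.2 -> s = - t.
Proof.
move=> p1 q1 pq e1 e2 e3.
have : s ^+ 2 == t ^+ 2.
  apply/eqP; transitivity (s ^+ 2 * norm2 p); first by rewrite p1 mulr1.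
  have -> : s ^+ 2 * norm2 p = (s * p.1) ^+ 2 + (s * p.2.1) ^+ 2 + (s * p.2.2) ^+ 2.
    by rewrite /norm2 /dot; ring.
  rewrite -e1 -e2 -e3 -[RHS]mulr1 -q1 /norm2 /dot; ring.
rewrite eqf_sqr => /orP[/eqP st|/eqP //].
have [t0|t0] := eqVneq t 0; first by rewrite st t0 oppr0.
case: pq; move: e1 e2 e3; rewrite st; case: p q {p1 q1} => [a [b c]] [a' [b' c']] /=.
by move=> /(mulfI t0) -> /(mulfI t0) -> /(mulfI t0) ->.
Qed.

Lemma arc_neq0 (p q : pt) t : norm2 p = 1 -> norm2 q = 1 -> p <> q ->
  norm2 (arc p q t) != 0.
Proof.
move=> p1 q1 pq; apply/eqP => n0.
have z0 (x y z : R) : x ^+ 2 + y ^+ 2 + z ^+ 2 = 0 -> [/\ x = 0, y = 0 & z = 0].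
  move=> /eqP; rewrite !paddr_eq0 ?addr_ge0 ?sqr_ge0// !sqrf_eq0.
  by move=> /andP[/andP[/eqP -> /eqP ->] /eqP ->].
have [] := z0 _ _ _ n0; rewrite /arc /= => h1 h2 h3.
have := collinear_unit (s := 1 - t) (t := t) p1 q1 pq.
by move=> /(_ ltac:(lra) ltac:(lra) ltac:(lra)); lra.
Qed.

Lemma arc_avoids (p q : pt) t : norm2 p = 1 -> norm2 q = 1 -> p <> q ->
  sval2 (normalize (arc p q t)) <> p.
Proof.
move=> p1 q1 pq; have n0 := arc_neq0 t p1 q1 pq; rewrite sval2_normalize// => E.
set r := Num.sqrt (norm2 (arc p q t)).
have r0 : 0 < r by rewrite sqrtr_gt0 lt_neqAle eq_sym n0 norm2_ge0.
have scale (x y : R) : x / r = y -> x = r * y.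
  by move=> <-; rewrite mulrC divfK// gt_eqF.
have h1 := scale _ _ (congr1 (fun v => v.1) E).
have h2 := scale _ _ (congr1 (fun v => v.2.1) E).
have h3 := scale _ _ (congr1 (fun v => v.2.2) E).
rewrite /arc /= in h1 h2 h3.
have := collinear_unit (s := r + 1 - t) (t := t) p1 q1 pq.
by move=> /(_ ltac:(lra) ltac:(lra) ltac:(lra)); lra.
Qed.
(** Connectedness of the punctured sphere: any two points are joined, through the
    antipode of [p], by arcs which avoid [p]. *)
Lemma punctured_sphere_clopen (p : sphere2) (U O D : set sphere2) :
  open O -> closed D ->
  (forall q, q <> p -> (U q <-> O q)) -> (forall q, q <> p -> (U q <-> D q)) ->
  forall q q', q <> p -> q' <> p -> U q -> U q'.
Proof.
move=> oO cD UO UD q q' qp q'p Uq.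
have vp (x : sphere2) : x <> p -> sval2 p <> sval2 x by move=> xp /sval2_inj/esym.
pose g (x : sphere2) (t : R) := normalize (arc (sval2 p) (sval2 x) t).
have gp (x : sphere2) t : x <> p -> g x t <> p.
  by move=> /vp xp E; apply: (arc_avoids (t := t) (sval2P p) (sval2P x) xp);
    rewrite -/(g x t) E.
have cg (x : sphere2) : x <> p -> continuous (g x).
  move=> /vp xp t; apply: (@cvg_continuous _ _ _ normalize).
    by apply: normalize_continuous; apply: arc_neq0 => //; exact: sval2P.
  have ct : (fun t => t : R) @ t --> t by exact: cvg_id.
  have ct1 : (fun t => t - 1 : R) @ t --> (t - 1 : R) by apply: cvgB => //; exact: cvg_cst.
  apply: cvg_pt; apply: cvgD; apply: cvgM => //; exact: cvg_cst.
have g1 (x : sphere2) : g x 1 = x.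
  apply: sval2_inj; rewrite normalize_id /arc subrr !mul0r !mul1r !add0r.
    by case: (sval2 x) => [? []].
  by case: (sval2 x) (sval2P x) => [? []].
have g0 (x y : sphere2) : g x 0 = g y 0.
  by rewrite /g /arc !mul0r.
have all (x : sphere2) t t' : x <> p -> U (g x t) -> U (g x t').
  move=> xp Ut.
  have cR : connected [set: R] by apply/connected_intervalP.
  have E (W : set sphere2) : (forall y, y <> p -> (U y <-> W y)) ->
      g x @^-1` U = setT `&` g x @^-1` W.
    move=> UW; rewrite setTI; apply/seteqP; split=> s /=;
    by have := UW _ (gp x s xp) => -[].
  have -> // : U (g x t') = (g x @^-1` U) t' by [].
  rewrite (cR (g x @^-1` U)) //; first by exists t.
    by exists (g x @^-1` O); [exact: (continuousP (g x)).1 (cg x xp) O oO|exact: E].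
  by exists (g x @^-1` D); [apply: closed_comp => // s _; exact: cg|exact: E].
rewrite -(g1 q'); apply: (all q' 0) => //; rewrite (g0 q' q).
by apply: (all q 1) => //; rewrite g1.
Qed.

End Sphere.

(** * The tautological line bundle of the sphere *)
Section SphereLines.
Context {R : realType}.
Local Notation C := (R[i]^o).

Definition lat (q : @sphere2 R) : R := (sval2 q).1.
Definition equ (q : @sphere2 R) : C := (sval2 q).2.1 +i* (sval2 q).2.2.

Lemma lat_continuous : continuous lat.
Proof.
move=> q; have [c _ _] := cvg_coord (nbhs_filter q) (cvg_sval2 cvg_id); exact: c.
Qed.

Lemma equ_continuous : continuous equ.
Proof.
move=> q; have [_ c1 c2] := cvg_coord (nbhs_filter q) (cvg_sval2 cvg_id).
exact: (cvg_complex _ c1 c2).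
Qed.

Lemma lat_equ q : lat q ^+ 2 + ((sval2 q).2.1 ^+ 2 + (sval2 q).2.2 ^+ 2) = 1.
Proof. by rewrite addrA /lat -[RHS](sval2P q) /norm2 /dot !expr2. Qed.

Lemma lat_bounds q : -1 <= lat q <= 1.
Proof.
have := lat_equ q; have := sqr_ge0 (sval2 q).2.1; have := sqr_ge0 (sval2 q).2.2.
move: (_ ^+ 2) => b b0; move: ((sval2 q).2.1 ^+ 2) => a a0 E.
by apply/andP; split; nra.
Qed.

(** The line bundle on the sphere whose fibre over [q] is the line
    [conj w * v1 = (1 + s) * v2] of the plane is the tautological one.
    A nonvanishing section would have [v1 != 0] above the equator, [v2 != 0]
    below it and [v1 = w * v2] along it. *)
Lemma tautological_no_section (v1 v2 : @sphere2 R -> C) :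
  continuous v1 -> continuous v2 ->
  (forall q, (equ q)^* * v1 q = (1 + lat q)%:C * v2 q) ->
  (forall q, (1 - lat q)%:C * v1 q = equ q * v2 q) ->
  (forall q, v1 q != 0 \/ v2 q != 0) -> False.
Proof.
move=> c1 c2 l1 l2 v0.
pose h (p : R * R) := Num.sqrt (1 - (p.1 ^+ 2 + p.2 ^+ 2)).
have h_ge0 p : 0 <= h p by exact: sqrtr_ge0.
have cid (p : R * R) : (fun x : R * R => x) @ p --> p by exact: cvg_id.
have cp1 (p : R * R) : x.1 @[x --> p] --> p.1 by exact: cvg_fst.
have cp2 (p : R * R) : x.2 @[x --> p] --> p.2 by exact: cvg_snd.
have ch : continuous h.
  move=> p; apply: (@cvg_continuous _ _ _ Num.sqrt); first exact: sqrt_continuous.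
  apply: cvgB; first exact: cvg_cst.
  exact: (cvgD (cvgM (cp1 p) (cp1 p)) (cvgM (cp2 p) (cp2 p))).
(* extended radially outside of the disc, where [h] vanishes, to be total *)
pose cap (e : R) (p : R * R) := normalize (e * h p, p).
have n0 e p : e ^+ 2 = 1 -> norm2 (e * h p, p) != 0.
  move=> e1; rewrite gt_eqF// /norm2 /dot /= -!expr2 exprMn e1 mul1r.
  have [p1|p1] := leP (p.1 ^+ 2 + p.2 ^+ 2) 1.
    by rewrite -addrA sqr_sqrtr ?subr_ge0// subrK.
  by have := sqr_ge0 (h p); lra.
have lat_cap e p : e ^+ 2 = 1 -> 0 <= e * lat (cap e p).
  move=> e1; rewrite /lat sval2_normalize ?n0// /unit_vec /= mulrA mulrA -expr2 e1 mul1r.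
  by rewrite divr_ge0// sqrtr_ge0.
have ccap e : e ^+ 2 = 1 -> continuous (cap e).
  move=> e1 p; apply: (@cvg_continuous _ _ _ normalize).
    by apply: normalize_continuous; exact: n0.
  have cc := cvg_pair (cvgM (cvg_cst e) (ch p)) (cid p).
  exact: cc.
have e1 : (1 : R) ^+ 2 = 1 by rewrite expr1n.
have eN1 : (-1 : R) ^+ 2 = 1 by rewrite sqrrN expr1n.
have v1n p : v1 (cap 1 p) != 0.
  have := lat_cap 1 p e1; rewrite mul1r => l0; apply/eqP => z1.
  have := l1 (cap 1 p); rewrite z1 mulr0 => /esym/eqP; rewrite mulf_eq0.
  have := v0 (cap 1 p); rewrite z1 eqxx => -[//|/negbTE ->]; rewrite orbF.
  by move/eqP => [] ; lra.
have v2n p : v2 (cap (-1) p) != 0.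
  have := lat_cap (-1) p eN1; rewrite mulN1r => l0; apply/eqP => z2.
  have := l2 (cap (-1) p); rewrite z2 mulr0 => /eqP; rewrite mulf_eq0.
  have := v0 (cap (-1) p); rewrite z2 eqxx => -[/negbTE ->|//]; rewrite orbF.
  by move/eqP => []; lra.
apply: (@no_retraction R (fun p => v1 (cap 1 p) / v2 (cap (-1) p))).
- move=> p; apply: cvg_complexM.
    by apply: (@cvg_continuous _ _ _ v1); [exact: c1|exact: ccap].
  apply: cvg_complexV; first exact: v2n.
  by apply: (@cvg_continuous _ _ _ v2); [exact: c2|exact: ccap].
- by move=> p; rewrite mulf_neq0// invr_eq0.
move=> y z yz; have hp : h (y, z) = 0 by rewrite /h /= yz subrr sqrtr0.
have cE e : sval2 (cap e (y, z)) = (0, (y, z)).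
  rewrite /cap hp mulr0 normalize_id// /norm2 /dot /= mulr0 add0r.
  by rewrite -!expr2.
have E : cap 1 (y, z) = cap (-1) (y, z) by apply: sval2_inj; rewrite !cE.
have := l2 (cap (-1) (y, z)); rewrite /lat /equ cE /= subr0 mul1r => vE.
by rewrite E vE mulfK.
Qed.

End SphereLines.

(** * The base space *)

Section BaseSpace.
Context {R : realType}.
Local Notation S2 := (@sphere2 R).

(** The spheres of a chain are placed one after the other along the height
    axis, every second one being reversed, so that consecutive ones touch at a
    pole. *)
Definition bead_height (k : nat) (q : S2) : R := 2 * k%:R + (-1) ^+ k * lat q.

Definition chains_set : set (nat * (R * S2)) :=
  [set x | exists k, x.2.1 = bead_height k x.2.2].

Definition chains : Type := chains_set.
HB.instance Definition _ := Topological.on chains.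

Definition component (b : chains) : nat := (set_val b).1.
Definition height (b : chains) : R := (set_val b).2.1.
Definition spot (b : chains) : S2 := (set_val b).2.2.

Fact bead_subproof n k q : chains_set (n, (bead_height k q, q)).
Proof. by exists k. Qed.

Definition bead n k q : chains := exist _ (n, (bead_height k q, q))
  (mem_set (bead_subproof n k q)).

Lemma chainsP (b b' : chains) : component b = component b' ->
  height b = height b' -> spot b = spot b' -> b = b'.
Proof.
move=> h1 h2 h3; apply: val_inj; change (set_val b = set_val b').
move: h1 h2 h3; rewrite /component /height /spot.
by case: (set_val b) (set_val b') => [? [? ?]] [? [? ?]] /= -> -> ->.
Qed.

Lemma beadE (b : chains) : exists k, b = bead (component b) k (spot b).
Proof.
have [k hk] : chains_set (set_val b) by exact: set_valP.
by exists k; apply: chainsP.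
Qed.

Lemma cvg_chains (T : Type) (F : set_system T) (f : T -> chains) (b : chains) :
  Filter F -> component (f x) @[x --> F] --> component b ->
  height (f x) @[x --> F] --> height b -> spot (f x) @[x --> F] --> spot b ->
  f x @[x --> F] --> b.
Proof.
move=> FF h1 h2 h3; apply: cvg_set_type.
have E (x : nat * (R * S2)) : x = (x.1, (x.2.1, x.2.2)) by case: x => [? []].
rewrite (E (set_val b)) [X in X @ _ --> _](_ : _ = fun x =>
  ((set_val (f x)).1, ((set_val (f x)).2.1, (set_val (f x)).2.2))).
  exact: (cvg_pair h1 (cvg_pair h2 h3)).
by apply/funext => x; rewrite -E.
Qed.

Lemma component_continuous : continuous component.
Proof.
move=> b; have c : (fun x : chains => set_val x) @ b --> set_val b.
  exact: initial_continuous.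
by apply: cvg_comp c _; exact: cvg_fst.
Qed.

Lemma height_continuous : continuous height.
Proof.
move=> b; have c : (fun x : chains => set_val x) @ b --> set_val b.
  exact: initial_continuous.
have c2 : (fun x : chains => (set_val x).2) @ b --> (set_val b).2.
  by apply: cvg_comp c _; exact: cvg_snd.
by apply: cvg_comp c2 _; exact: cvg_fst.
Qed.

Lemma spot_continuous : continuous spot.
Proof.
move=> b; have c : (fun x : chains => set_val x) @ b --> set_val b.
  exact: initial_continuous.
have c2 : (fun x : chains => (set_val x).2) @ b --> (set_val b).2.
  by apply: cvg_comp c _; exact: cvg_snd.
by apply: cvg_comp c2 _; exact: cvg_snd.
Qed.

Lemma bead_height_continuous k : continuous (bead_height k).
Proof.
move=> q; have FF : Filter (nbhs (q : S2)) by exact: nbhs_filter.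
exact: (cvgD (cvg_cst _) (cvgM (cvg_cst _) (@lat_continuous R q))).
Qed.

Lemma bead_continuous n k : continuous (bead n k).
Proof.
move=> q; have FF : Filter (nbhs (q : S2)) by exact: nbhs_filter.
apply: cvg_chains.
- exact: cvg_cst.
- exact: bead_height_continuous.
- exact: cvg_id.
Qed.

Lemma bead_height_bounds k q : 2 * k%:R - 1 <= bead_height k q <= 2 * k%:R + 1.
Proof.
have /andP[l1 l2] := lat_bounds q; rewrite /bead_height -signr_odd.
by case: odd; rewrite ?expr1 ?expr0; apply/andP; split; lra.
Qed.

Lemma near_component (b : chains) : \forall b' \near b, component b' = component b.
Proof.
have cb : nbhs (component b) [set n | n = component b] by exact/principal_filterP.
by have := @component_continuous b _ cb.
Qed.

Lemma closed_chains_set : closed chains_set.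
Proof.
move=> x xc; have [N xN] : exists N : nat, x.2.1 + 2 < N%:R.
  exists (Num.bound `|x.2.1 + 2|).
  exact: le_lt_trans (ler_norm _) (archi_boundP (normr_ge0 _)).
pose F k : set (nat * (R * S2)) := [set x | x.2.1 - bead_height k x.2.2 = 0].
have cF k : closed (F k).
  have ch : continuous (fun x : nat * (R * S2) => x.2.1 - bead_height k x.2.2).
    move=> y.
    have c2 : (x.2 : R * S2) @[x --> y] --> y.2 by exact: cvg_snd.
    apply: cvgB; first by apply: cvg_comp c2 _; exact: cvg_fst.
    apply: (@cvg_continuous _ _ _ (bead_height k)); first exact: bead_height_continuous.
    by apply: cvg_comp c2 _; exact: cvg_snd.
  by apply: (@closed_comp _ _ _ [set r : R | r = 0]) => [y _|]; [exact: ch|exact: closed_eq].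
have : closed (\bigcup_(k in `I_N) F k) by apply: closed_bigcup => //; exact: finite_II.
move=> /(_ x); case.
  move=> U xU.
  have xh : \forall y \near x, y.2.1 < x.2.1 + 1.
    have c : (y.2.1 : R) @[y --> x] --> x.2.1.
      have c2 : (y.2 : R * S2) @[y --> x] --> x.2 by exact: cvg_snd.
      by apply: cvg_comp c2 _; exact: cvg_fst.
    by apply: (cvgr_lt _ c); lra.
  have [y [[k yk] [Uy yh]]] := xc _ (filterI xU xh).
  exists y; split=> //; exists k; last by rewrite /F /= yk subrr.
  have /andP[b1 b2] := bead_height_bounds k y.2.2; rewrite /= -(ltr_nat R).
  by rewrite yk in yh; have := ler0n R k; lra.
by move=> k _ /subr0_eq xk; exists k.
Qed.

Lemma compact_sphere : compact [set: S2].
Proof.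
apply: compact_set_type.
pose K : set (R * (R * R)) := `[-1, 1] `*` (`[-1, 1] `*` `[-1, 1]).
have Kc : compact K by do ?[apply: compact_setX]; exact: segment_compact.
have cid (v : R * (R * R)) : (fun x : R * (R * R) => x) @ v --> v by exact: cvg_id.
apply: (subclosed_compact _ Kc).
  apply: (@closed_comp _ _ _ [set r : R | r = 1]) => [v _|]; last exact: closed_eq.
  exact: cvg_dot.
move=> [a [b c]]; rewrite /sphere_set /norm2 /dot /K /= => E.
by do ![split=> /=]; rewrite in_itv /=; apply/andP; split; nra.
Qed.

Lemma closed_sphere_set : closed (@sphere_set R).
Proof.
have cid (v : R * (R * R)) : (fun x : R * (R * R) => x) @ v --> v by exact: cvg_id.
apply: (@closed_comp _ _ _ [set r : R | r = 1]) => [v _|]; last exact: closed_eq.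
exact: cvg_dot.
Qed.

Lemma polish_chains : polish R chains.
Proof.
apply: (polish_closed closed_chains_set); apply: polish_prod; first exact: polish_nat.
apply: polish_prod; first exact: polish_real.
apply: (polish_closed closed_sphere_set).
by do ?[apply: polish_prod]; exact: polish_real.
Qed.

Lemma hausdorff_chains : hausdorff_space chains.
Proof. by have [_ [d dX _]] := polish_chains; exact: metric_hausdorff dX. Qed.

Definition bead_sphere n k : set chains := range (bead n k).

Lemma compact_bead_sphere n k : compact (bead_sphere n k).
Proof.
apply: continuous_compact; last exact: compact_sphere.
by apply: continuous_subspaceT; exact: bead_continuous.
Qed.

Lemma bead_sphereP n k b : bead_sphere n k b <->
  component b = n /\ height b = bead_height k (spot b).
Proof.
by split=> [[q _ <-]|[<- hb]]; [|exists (spot b) => //; apply: chainsP].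
Qed.

(** A neighbourhood of the [k]-th sphere of the [n]-th chain meeting only its
    two neighbours. *)
Definition bead_nbhd n k : set chains :=
  [set b | component b = n /\ `|height b - 2 * k%:R| < 2].

Lemma bead_nbhd_open n k : open (bead_nbhd n k).
Proof.
apply: openI.
  by apply: (@open_comp _ _ component [set n]) => [b _|];
    [exact: component_continuous|exact: discrete_open].
have c : continuous (fun b : chains => `|height b - 2 * k%:R|).
  move=> b; have FF : Filter (nbhs (b : chains)) by exact: nbhs_filter.
  apply: cvg_norm; apply: cvgB; [exact: height_continuous|exact: cvg_cst].
apply: (@open_comp _ _ (fun b : chains => `|height b - 2 * k%:R|) [set r | r < 2]).
  by move=> b _; exact: c.
exact: open_lt.
Qed.

Lemma bead_sphere_nbhd n k : bead_sphere n k `<=` bead_nbhd n k.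
Proof.
move=> b /bead_sphereP[bn bh]; split=> //; rewrite bh ltr_norml.
by have /andP[h1 h2] := bead_height_bounds k (spot b); apply/andP; split; lra.
Qed.

Lemma bead_nbhd_sphere n k j b : bead_nbhd n k b -> bead_sphere n j b ->
  (k <= j.+1)%N /\ (j <= k.+1)%N.
Proof.
move=> [_ bk] /bead_sphereP[_ bj].
have /andP[h1 h2] := bead_height_bounds j (spot b).
move: bk; rewrite ltr_norml bj => /andP[h3 h4].
have : (k%:R : R) < j.+2%:R /\ (j%:R : R) < k.+2%:R.
  by rewrite -[j.+2]addn2 -[k.+2]addn2 !natrD; split; lra.
by rewrite !ltr_nat !ltnS.
Qed.

Lemma locally_compact_chains : locally_compact [set: chains].
Proof.
move=> b _; have [k bE] := beadE b; set n := component b in bE.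
pose K := bead_sphere n k.-1 `|` bead_sphere n k `|` bead_sphere n k.+1.
have Kc : compact K by do ?[apply: compactU]; exact: compact_bead_sphere.
exists K; last by split => //; apply: compact_closed Kc; exact: hausdorff_chains.
apply: (@filterS _ (nbhs b) _ (bead_nbhd n k)).
  move=> b' [b'n b'k] _; have [j b'E] := beadE b'.
  have b'j : bead_sphere n j b' by rewrite b'E -b'n; exists (spot b').
  have [kj jk] := bead_nbhd_sphere (conj b'n b'k) b'j.
  have : [\/ j = k.-1, j = k | j = k.+1].
    have [->|[->|->]] : j = k.-1 \/ j = k \/ j = k.+1 by lia.
    - by constructor 1.
    - by constructor 2.
    - by constructor 3.
  by case=> jE; rewrite jE in b'j; [left; left|left; right|right].
apply: open_nbhs_nbhs; split; first exact: bead_nbhd_open.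
by apply: bead_sphere_nbhd; rewrite bE; exists (spot b).
Qed.

End BaseSpace.
Arguments chains : clear implicits.

(** * The cell structure *)

Lemma cvg_row (T : Type) (K : ptopologicalType) (F : set_system T) m
    (f : T -> 'rV[K]_m) (l : 'rV[K]_m) : Filter F ->
  (forall j, f x ord0 j @[x --> F] --> l ord0 j) -> f x @[x --> F] --> l.
Proof.
move=> FF fl A [P lP PA].
have : F [set x | forall j, P ord0 j (f x ord0 j)].
  by apply: (filter_forall (f := fun j x => P ord0 j (f x ord0 j))) => j; apply: fl; exact: lP.
move=> FP; apply: (@filterS _ F _ _ _ _ FP) => x Px.
by apply: PA => i j; rewrite ord1; exact: Px.
Qed.

Section Cells.
Context {R : realType}.
Local Notation pt := (R * (R * R))%type.

(** Over a pair (chain, sphere), [None] is the lower pole of the sphere and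
    [Some (two_dimensional, sign)] a half meridian or a hemisphere. *)
Definition cell_index := (nat * nat * option (bool * bool))%type.

Definition cell_dimension (o : option (bool * bool)) : nat :=
  match o with None => 0%N | Some (false, _) => 1%N | Some (true, _) => 2%N end.

Definition cell_graph (k : nat) (o : option (bool * bool)) :
    'rV[R]_(cell_dimension o) -> pt :=
  match o with
  | None => fun=> (- (-1) ^+ k, (0, 0))
  | Some (false, e) => fun x =>
      (x ord0 ord0, ((-1) ^+ e * Num.sqrt (1 - x ord0 ord0 ^+ 2), 0))
  | Some (true, e) => fun x => (x ord0 ord0, (x ord0 (lift ord0 ord0),
      (-1) ^+ e * Num.sqrt (1 - (x ord0 ord0 ^+ 2 + x ord0 (lift ord0 ord0) ^+ 2))))
  end.

Definition cell_map (i : cell_index) (x : 'rV[R]_(cell_dimension i.2)) : chains R :=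
  bead i.1.1 i.1.2 (normalize (cell_graph i.1.2 x)).

Definition pt_coord (v : pt) (j : nat) : R := if j == 0%N then v.1 else v.2.1.

Definition cell_coord (d : nat) (b : chains R) : 'rV[R]_d :=
  \row_j pt_coord (sval2 (spot b)) j.

Lemma cell_graph_norm k o (x : 'rV_(cell_dimension o)) : disc _ x ->
  norm2 (cell_graph k x) = 1.
Proof.
case: o x => [[[] e]|] x; rewrite /disc /= ?big_ord_recl ?big_ord0 ?addr0 => xd;
  rewrite /norm2 /dot /= -!expr2 ?exprMn ?sqrr_sign ?mul1r ?expr0n ?addr0.
- by rewrite sqr_sqrtr ?subr_ge0// addrC subrK.
- by rewrite sqr_sqrtr ?subr_ge0// addrC subrK.
- by rewrite sqrrN sqrr_sign.
Qed.

Lemma open_disc_disc n : @open_disc R n `<=` disc n.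
Proof. by move=> x; rewrite /open_disc /disc /= => /ltW. Qed.

Lemma sphere_disc n : @sphere R n `<=` disc n.
Proof. by move=> x; rewrite /sphere /disc /= => ->. Qed.

Lemma cell_graph_continuous k o : continuous (@cell_graph k o).
Proof.
have cc n (j : 'I_n) (x : 'rV[R]_n) : (fun y : 'rV[R]_n => y ord0 j) @ x --> x ord0 j.
  exact: coord_continuous.
case: o => [[[] e]|] x.
- have FF : Filter (nbhs (x : 'rV[R]_2)) by exact: nbhs_filter.
  have c1 := cc _ ord0 x; have c2 := cc _ (lift ord0 ord0) x.
  apply: cvg_pt => //; apply: cvgM; first exact: cvg_cst.
  apply: (@cvg_continuous _ _ _ Num.sqrt); first exact: sqrt_continuous.
  apply: cvgB; first exact: cvg_cst.
  exact: (cvgD (cvgM c1 c1) (cvgM c2 c2)).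
- have FF : Filter (nbhs (x : 'rV[R]_1)) by exact: nbhs_filter.
  have c1 := cc _ ord0 x.
  apply: cvg_pt => //; last exact: cvg_cst.
  apply: cvgM; first exact: cvg_cst.
  apply: (@cvg_continuous _ _ _ Num.sqrt); first exact: sqrt_continuous.
  by apply: cvgB; [exact: cvg_cst|exact: (cvgM c1 c1)].
- have FF : Filter (nbhs (x : 'rV[R]_0)) by exact: nbhs_filter.
  exact: cvg_cst.
Qed.

Lemma cell_map_continuous i x : disc _ x -> {for x, continuous (@cell_map i)}.
Proof.
move=> xd; apply: (@cvg_continuous _ _ _ (bead i.1.1 i.1.2)).
  exact: bead_continuous.
apply: (@cvg_continuous _ _ _ normalize); last exact: cell_graph_continuous.
by apply: normalize_continuous; rewrite cell_graph_norm// oner_neq0.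
Qed.

Lemma cell_coordK i x : disc _ x -> cell_coord _ (@cell_map i x) = x.
Proof.
move=> xd; apply/rowP => j; rewrite mxE /cell_map /spot /= normalize_id ?cell_graph_norm//.
case: i x xd j => [[n k] [[[] e]|]] x _ j /=; last by case: j.
- by case: j => -[|[|//]] h; congr (x _ _); apply: val_inj.
- by case: j => -[|//] h; congr (x _ _); apply: val_inj.
Qed.

Lemma cell_coord_continuous d : continuous (@cell_coord d).
Proof.
move=> b; have FF : Filter (nbhs (b : chains R)) by exact: nbhs_filter.
apply: cvg_row => j; rewrite mxE.
rewrite [X in X @ _ --> _](_ : _ = fun b => pt_coord (sval2 (spot b)) j); last first.
  by apply/funext => c; rewrite mxE.
have [c1 c2 _] := cvg_coord FF (cvg_sval2 (@spot_continuous R b)).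
by rewrite /pt_coord; case: ifP.
Qed.

Definition cell_kind (b : chains R) : option (bool * bool) :=
  let y := (sval2 (spot b)).2.1 in let z := (sval2 (spot b)).2.2 in
  if z != 0 then Some (true, z < 0)
  else if y != 0 then Some (false, y < 0) else None.

Lemma sign_sqrt (e : bool) (r : R) : 0 < r ->
  ((-1) ^+ e * Num.sqrt r != 0) * (((-1) ^+ e * Num.sqrt r < 0) = e).
Proof.
move=> r0; have s0 : 0 < Num.sqrt r by rewrite sqrtr_gt0.
case: e; rewrite /= ?expr1 ?expr0 ?mulN1r ?mul1r ?oppr_eq0 ?oppr_lt0 ?gt_eqF//.
by rewrite ltNge ltW.
Qed.

Lemma cell_map_kind i x : open_disc _ x -> cell_kind (@cell_map i x) = i.2.
Proof.
move=> xd; have := open_disc_disc xd => xd'.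
rewrite /cell_kind /cell_map /spot /= normalize_id ?cell_graph_norm//.
case: i x xd {xd'} => [[n k] [[[] e]|]] x; rewrite /open_disc /= ?eqxx//=.
  rewrite 2!big_ord_recl big_ord0 addr0 => xd.
  by rewrite !sign_sqrt ?subr_gt0.
rewrite big_ord_recl big_ord0 addr0 => xd.
by rewrite !sign_sqrt ?subr_gt0.
Qed.

Lemma bead_inj_index n k n' k' (q q' : @sphere2 R) : bead n k q = bead n' k' q' ->
  (-1 < lat q < 1) \/ (lat q = - (-1) ^+ k /\ lat q' = - (-1) ^+ k') ->
  [/\ n = n', k = k' & q = q'].
Proof.
move=> E; have nn : n = n' by have := congr1 component E.
have qq : q = q' by have := congr1 spot E.
have := congr1 height E; rewrite -qq /height /= /bead_height => hh [/andP[l1 l2]|[l1 l2]].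
  split=> //; move: hh; rewrite -[(-1) ^+ k]signr_odd -[(-1) ^+ k']signr_odd => hh.
  have : (k%:R : R) < k'.+1%:R /\ (k'%:R : R) < k.+1%:R.
    rewrite -[k'.+1]addn1 -[k.+1]addn1 !natrD.
    by move: hh; do 2!case: odd; rewrite ?expr1 ?expr0 => hh; split; lra.
  by rewrite !ltr_nat; lia.
split=> //; move: hh; rewrite {1}l1 l2 !mulrN -!expr2 -!exprM ![(_ * 2)%N]mulnC !exprM.
rewrite sqrrN expr1n !expr1n => hh.
by apply/eqP; rewrite -(eqr_nat R); apply/eqP; lra.
Qed.

Lemma cell_map_inj_index (i j : cell_index) x y : open_disc _ x -> open_disc _ y ->
  @cell_map i x = @cell_map j y -> i = j.
Proof.
move=> xd yd E; have kE : i.2 = j.2.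
  by rewrite -(cell_map_kind xd) -(cell_map_kind yd) E.
have := bead_inj_index E; rewrite /lat !normalize_id ?cell_graph_norm//;
  try exact: open_disc_disc.
case: i j x y kE xd yd {E} => [[n k] o] [[n' k'] o'] x y /= kE.
rewrite -kE in y *; case: o x y {kE} => [[[] e]|] x y; rewrite /open_disc /=.
- rewrite 2!big_ord_recl big_ord0 addr0 => xd _ [|-> -> _//]; left.
  by have := sqr_ge0 (x ord0 (lift ord0 ord0)) => h; apply/andP; split; nra.
- rewrite big_ord_recl big_ord0 addr0 => xd _ [|-> -> _//]; left.
  by apply/andP; split; nra.
- by move=> _ _ [|-> -> _//]; right.
Qed.

(** Every point lies in an open cell whose kind can be read off from the signs of
    its coordinates; at the upper pole this is a vertex of the next sphere. *)
Lemma bead_in_cell n k (q : @sphere2 R) : exists (i : cell_index) x,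
  [/\ open_disc _ x, @cell_map i x = bead n k q, i.2 = cell_kind (bead n k q),
      i.1.1 = n & i.1.2 = k \/ i.1.2 = k.+1].
Proof.
have E := lat_equ q; rewrite /cell_kind /spot /=.
move: E; rewrite /lat; set s := (sval2 q).1; set y := (sval2 q).2.1;
  set z := (sval2 q).2.2 => E.
have qE : sval2 q = (s, (y, z)) by rewrite /s /y /z; case: (sval2 q) => [? []].
have q1 := sval2P q.
have sgnE (r a : R) : r != 0 -> r ^+ 2 = a -> (-1) ^+ (r < 0)%R * Num.sqrt a = r.
  move=> r0 <-; rewrite sqrtr_sqr; case: ltP => rr /=.
    by rewrite expr1 ltr0_norm// mulN1r opprK.
  by rewrite expr0 mul1r ger0_norm.
have bE i x : open_disc _ x -> i.1.1 = n -> i.1.2 = k ->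
    @cell_graph i.1.2 i.2 x = sval2 q -> @cell_map i x = bead n k q.
  move=> xd <- <- gE; rewrite /cell_map gE; congr bead; apply: sval2_inj.
  by rewrite normalize_id.
have [z0|z0] := eqVneq z 0; last first.
  have zp : 0 < z ^+ 2 by rewrite lt_neqAle eq_sym sqrf_eq0 z0 sqr_ge0.
  pose x : 'rV[R]_2 := \row_(j < 2) (if j == ord0 then s else y).
  have xE : (x ord0 ord0 = s) * (x ord0 (lift ord0 ord0) = y) by rewrite !mxE.
  exists (n, k, Some (true, z < 0)), x.
  have xd : open_disc 2 x.
    by rewrite /open_disc /= 2!big_ord_recl big_ord0 addr0 !xE; lra.
  split=> //=; last by left.
  apply: bE => //=; rewrite !xE qE sgnE//; lra.
have [y0|y0] := eqVneq y 0; last first.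
  have yp : 0 < y ^+ 2 by rewrite lt_neqAle eq_sym sqrf_eq0 y0 sqr_ge0.
  pose x : 'rV[R]_1 := \row_(j < 1) s.
  have xE : x ord0 ord0 = s by rewrite !mxE.
  have zz : z ^+ 2 = 0 by rewrite z0 expr0n.
  exists (n, k, Some (false, y < 0)), x.
  have xd : open_disc 1 x.
    by rewrite /open_disc /= big_ord_recl big_ord0 addr0 !xE; lra.
  split=> //=; last by left.
  by apply: bE => //=; rewrite !xE qE sgnE ?z0//; lra.
have ss : s ^+ 2 = 1 by move: E; rewrite y0 z0 expr0n /= !addr0.
have xd : open_disc 0 (0 : 'rV[R]_0) by rewrite /open_disc /= big_ord0 ltr01.
have [sE|sE] : s = - (-1) ^+ k \/ s = (-1) ^+ k.
  move/eqP: ss; rewrite -subr_eq0 subr_sqr_1 mulf_eq0 subr_eq0 addr_eq0.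
  by rewrite -signr_odd => /orP[]/eqP ->; case: odd => /=;
     rewrite ?expr1 ?expr0 ?opprK; [left|right|right|left].
  exists (n, k, None), 0; split=> //=; last by left.
  by apply: bE => //=; rewrite qE y0 z0 sE.
exists (n, k.+1, None), 0; split=> //=; last by right.
have nE : normalize (- (-1) ^+ k.+1, (0, 0)) = q.
  apply: sval2_inj; have pE : (- (-1) ^+ k.+1, (0, 0)) = sval2 q.
    by rewrite qE y0 z0 sE exprS mulN1r opprK.
  by rewrite pE normalize_id.
apply: chainsP => //=; rewrite /height /cell_map /= nE// /bead_height /lat -/s sE.
rewrite exprS mulN1r mulNr -!expr2 -exprM mulnC exprM sqrrN !expr1n mulrSr.
by lra.
Qed.

Lemma cell_in_bead_sphere (i : cell_index) x : bead_sphere i.1.1 i.1.2 (@cell_map i x).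
Proof. by eexists. Qed.

Lemma chains_cells_cover : \bigcup_i (@cell_map i @` open_disc _) = [set: chains R].
Proof.
apply/seteqP; split=> // b _; have [k bE] := beadE b.
have [i [x [xd ix _ _ _]]] := bead_in_cell (component b) k (spot b).
by exists i => //; exists x => //; rewrite ix -bE.
Qed.

Lemma cell_boundary (i : cell_index) : exists J : set cell_index,
  [/\ finite_set J, forall j, J j -> (cell_dimension j.2 < cell_dimension i.2)%N &
    @cell_map i @` sphere _ `<=` \bigcup_(j in J) (@cell_map j @` open_disc _)].
Proof.
pose s := [seq ((i.1.1, k), o) | k <- [:: i.1.2; i.1.2.+1],
  o <- [:: None; Some (false, false); Some (false, true)]] : seq cell_index.
exists [set j | j \in s /\ (cell_dimension j.2 < cell_dimension i.2)%N]; split.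
- by apply: (sub_finite_set _ (finite_seq s)) => j [].
- by move=> j [].
move=> _ [x xs <-].
have [j [y [yd jy j2 j1 jk]]] :=
  bead_in_cell i.1.1 i.1.2 (normalize (cell_graph i.1.2 x)).
have kdim : (cell_dimension j.2 < cell_dimension i.2)%N.
  rewrite j2 /cell_kind /spot /= normalize_id ?cell_graph_norm//; last exact: sphere_disc.
  case: i x xs {s j y yd jy j2 j1 jk} => [[n k] [[[] e]|]] x; rewrite /sphere /=.
  - rewrite 2!big_ord_recl big_ord0 addr0 => ->.
    by rewrite subrr sqrtr0 mulr0 eqxx /=; case: ifP.
  - by rewrite big_ord_recl big_ord0 addr0 => ->; rewrite subrr sqrtr0 mulr0 !eqxx.
  - by rewrite big_ord0 => /eqP; rewrite eq_sym oner_eq0.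
exists j; last by exists y.
split=> //.
have d2 : (cell_dimension j.2 < 2)%N.
  by apply: leq_trans kdim _; case: (i.2) => [[[]]|].
apply/allpairsP; exists (j.1.2, j.2) => /=; split.
- by rewrite !inE; case: jk => ->; rewrite eqxx ?orbT.
- by case: (j.2) d2 => [[[] []]|].
- by rewrite -j1; case: (j) => [[]].
Qed.

Lemma cells_locally_finite :
  locally_finite [set: cell_index] (fun i => @cell_map i @` disc _).
Proof.
move=> b; have [k bE] := beadE b; set n := component b in bE.
exists (bead_nbhd n k).
  apply: open_nbhs_nbhs; split; first exact: bead_nbhd_open.
  by apply: bead_sphere_nbhd; rewrite bE; exists (spot b).
pose s := [seq ((n, j), o) | j <- iota 0 k.+2,
  o <- [:: None; Some (false, false); Some (false, true);
           Some (true, false); Some (true, true)]] : seq cell_index.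
apply: (sub_finite_set _ (finite_seq s)) => i [_ [c [Nb [x _ ixE]]]].
have ib := @cell_in_bead_sphere i x; rewrite ixE in ib.
have [ic _] := (bead_sphereP _ _ _).1 ib.
have nE : i.1.1 = n by rewrite -ic; exact: Nb.1.
rewrite nE in ib; have [_ ik] := bead_nbhd_sphere Nb ib.
apply/allpairsP; exists (i.1.2, i.2); split.
- by rewrite mem_iota add0n ltnS.
- by case: (i.2) => [[[] []]|].
- by rewrite -nE; case: (i) => [[]].
Qed.

Lemma cells_closed (A : set (chains R)) :
  (forall i, closed (A `&` @cell_map i @` disc _)) -> closed A.
Proof.
move=> cA b bA; apply: contrapT => nAb.
have [N bN fN] := cells_locally_finite b.
pose I := [set i | [set: cell_index] i /\ N `&` (@cell_map i @` disc _) !=set0].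
have cI : closed (\bigcup_(i in I) (A `&` @cell_map i @` disc _)).
  by apply: closed_bigcup.
apply: nAb; have [|i _ []//] := cI b.
move=> U bU; have [a [Aa [Na Ua]]] := bA _ (filterI bN bU).
exists a; split=> //; have : [set: chains R] a by [].
rewrite -chains_cells_cover => -[i _ [x xd xa]]; exists i.
  by split=> //; exists a; split=> //; exists x => //; exact: open_disc_disc.
by split=> //; exists x => //; exact: open_disc_disc.
Qed.

Lemma chains_CW : exists S : @CW_structure R (chains R),
  CW_countable (chains R) S /\ CW_locally_finite (chains R) S.
Proof.
have h1 : hausdorff_space (chains R) := hausdorff_chains.
have h2 i : {within disc (cell_dimension i.2), continuous (@cell_map i)}.
  by apply: continuous_in_subspaceT => x /set_mem; exact: cell_map_continuous.
have h3 (i : cell_index) : exists g : chains R -> 'rV[R]_(cell_dimension i.2),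
    homeo_between (open_disc _) (@cell_map i @` open_disc _) (@cell_map i) g.
  exists (cell_coord _); split.
  - by move=> x xd; exists x.
  - by move=> _ [x xd <-]; rewrite cell_coordK//; exact: open_disc_disc.
  - by move=> x /open_disc_disc; exact: cell_coordK.
  - by move=> _ [x /open_disc_disc xd <-]; rewrite cell_coordK.
  split; last by apply: continuous_subspaceT; exact: cell_coord_continuous.
  apply: continuous_in_subspaceT => x /set_mem /open_disc_disc.
  exact: cell_map_continuous.
have h4 : trivIset [set: cell_index] (fun i => @cell_map i @` open_disc _).
  move=> i j _ _ [_ [[x xd <-] [y yd yx]]].
  by apply: (cell_map_inj_index xd yd); rewrite yx.
exists (@CWStructure R (chains R) cell_index _ (@cell_map) h1 h2 h3 h4
  chains_cells_cover cell_boundary cells_closed).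
split; last exact: cells_locally_finite.
exact: countableP.
Qed.

End Cells.

(** * Line bundles on the base space *)

Section ComplexFacts.
Context {R : realType}.
Local Notation C := (R[i]^o).
Local Notation re := complex.Re.
Local Notation im := complex.Im.

Lemma cvg_real_complex (T : Type) (F : set_system T) (f : T -> R) (a : R) :
  Filter F -> f x @[x --> F] --> a -> ((f x)%:C : C) @[x --> F] --> (a%:C : C).
Proof. by move=> FF fa; apply: cvg_complex => //; exact: cvg_cst. Qed.

Lemma cvg_conj (T : Type) (F : set_system T) (f : T -> C) (a : C) :
  Filter F -> f x @[x --> F] --> a -> ((f x)^* : C) @[x --> F] --> (a^* : C).
Proof.
move=> FF fa; have E (z : C) : z^* = re z +i* - im z by case: z.
rewrite E [X in X @ _ --> _](_ : _ = fun x => re (f x) +i* - im (f x)).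
  by apply: cvg_complex; [exact: cvg_re|apply: cvgN; exact: cvg_im].
by apply/funext => x; rewrite E.
Qed.

Lemma real_complexM (x y : R) : (x * y)%:C = x%:C * y%:C :> C.
Proof. by apply/eqP; rewrite eq_complex /= !mulr0 mul0r subr0 addr0 !eqxx. Qed.

Lemma unit_complex_norm (z : C) :
  Num.norm (if z == 0 then 1 else z / `|z| : C) = 1.
Proof.
case: eqVneq => [_|z0]; first exact: normr1.
by rewrite normrM normfV normr_id divff// normr_eq0.
Qed.

Definition unit_complex (z : C) : circle R := to_circle (unit_complex_norm z).

Lemma unit_complex_val (z : C) : z != 0 -> circle_val (unit_complex z) = z / `|z|.
Proof.
move=> /negbTE z0.
have -> : circle_val (unit_complex z) = if z == 0 then 1 else z / `|z| by [].
by rewrite z0.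
Qed.

Lemma cvg_norm_complex (T : Type) (F : set_system T) (f : T -> C) (a : C) :
  Filter F -> f x @[x --> F] --> a -> (`|f x| : C) @[x --> F] --> (`|a| : C).
Proof.
move=> FF fa; rewrite normc_eq [X in X @ _ --> _](_ : _ = fun x =>
  (Num.sqrt (re (f x) ^+ 2 + im (f x) ^+ 2))%:C : C).
  apply: cvg_real_complex; apply: (@cvg_continuous _ _ _ Num.sqrt).
    exact: sqrt_continuous.
  exact: (cvgD (cvgM (cvg_re fa) (cvg_re fa)) (cvgM (cvg_im fa) (cvg_im fa))).
by apply/funext => x; rewrite normc_eq.
Qed.

Lemma cvg_circle (T : Type) (F : set_system T) (f : T -> circle R) (l : circle R) :
  Filter F -> (circle_val (f x) : C) @[x --> F] --> (circle_val l : C) ->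
  f x @[x --> F] --> l.
Proof. by move=> FF fl; exact: cvg_set_type. Qed.

Lemma cvg_unit_complex (T : Type) (F : set_system T) (f : T -> C) (a : C) :
  Filter F -> a != 0 -> f x @[x --> F] --> a ->
  unit_complex (f x) @[x --> F] --> unit_complex a.
Proof.
move=> FF a0 fa; apply: cvg_circle; rewrite (unit_complex_val a0).
have ca := cvg_complexM FF fa
  (cvg_complexV FF (_ : `|a| != 0) (cvg_norm_complex FF fa)).
apply: cvg_trans (ca _); last by rewrite normr_eq0.
apply: near_eq_cvg.
have : \forall x \near F, 0 < re (`|f x|).
  apply: (cvgr_gt (re `|a|) (cvg_re (cvg_norm_complex FF fa))).
  by rewrite normc_eq /= sqrtr_gt0 lt_neqAle eq_sym addr_ge0 ?sqr_ge0// andbT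
    paddr_eq0 ?sqr_ge0// !sqrf_eq0; case: (a) a0 => u v; rewrite eq_complex.
apply: filterS => x fx; rewrite unit_complex_val//.
by apply/eqP => f0; move: fx; rewrite f0 normr0 ltxx.
Qed.

End ComplexFacts.

Section Twist.
Context {R : realType}.
Local Notation C := (R[i]^o).
Local Notation B := (chains R).

Definition position (b : B) : nat := projT1 (cid (beadE b)).

Lemma positionP (b : B) : b = bead (component b) (position b) (spot b).
Proof. by rewrite /position; case: cid. Qed.

Lemma position_sphere (b : B) : bead_sphere (component b) (position b) b.
Proof. by exists (spot b) => //; exact/esym/positionP. Qed.

Definition slat (b : B) : R := lat (spot b).

Lemma slat_continuous : continuous slat.
Proof.
move=> b; apply: (@cvg_continuous _ _ _ lat); first exact: lat_continuous.
exact: spot_continuous.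
Qed.

(** Off the poles, the sphere to which a point belongs is locally constant. *)
Lemma near_position (b : B) : -1 < slat b < 1 ->
  \forall b' \near b, component b' = component b /\ position b' = position b.
Proof.
move=> /andP[s1 s2].
have hb : height b = bead_height (position b) (spot b).
  by rewrite [in LHS](positionP b).
have [h1 h2] : 2 * (position b)%:R - 1 < height b /\ height b < 2 * (position b)%:R + 1.
  rewrite hb /bead_height -/(slat b) -signr_odd; case: odd;
  by rewrite ?expr1 ?expr0; split; lra.
have FF : Filter (nbhs (b : B)) by exact: nbhs_filter.
have n1 : \forall b' \near b, 2 * (position b)%:R - 1 < height b'.
  exact: (cvgr_gt _ (@height_continuous R b)).
have n2 : \forall b' \near b, height b' < 2 * (position b)%:R + 1.
  exact: (cvgr_lt _ (@height_continuous R b)).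
have n3 := near_component b.
apply: (@filterS _ (nbhs b) _ _ _ _ (filterI n1 (filterI n2 n3))).
move=> b' [h1' [h2' ->]]; split=> //.
have := bead_height_bounds (position b') (spot b').
have -> : bead_height (position b') (spot b') = height b'.
  by rewrite [in RHS](positionP b').
move=> /andP[h3 h4].
have : ((position b')%:R : R) < (position b).+1%:R /\
       ((position b)%:R : R) < (position b').+1%:R.
  by rewrite -[(position b).+1]addn1 -[(position b').+1]addn1 !natrD; split; lra.
by rewrite !ltr_nat !ltnS => -[p1 p2]; apply/eqP; rewrite eqn_leq p1.
Qed.

(** The map to the sphere which classifies the bundle is the identity on the
    spheres selected by [beta] and folds the others onto a half meridian. *)
Definition fold_equ (q : @sphere2 R) : C :=
  (Num.sqrt ((sval2 q).2.1 ^+ 2 + (sval2 q).2.2 ^+ 2))%:C.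

Definition twist (beta : nat -> nat -> bool) (b : B) : C :=
  if beta (component b) (position b) then equ (spot b) else fold_equ (spot b).

Lemma fold_equ_continuous : continuous fold_equ.
Proof.
move=> q; have FF : Filter (nbhs (q : sphere2)) by exact: nbhs_filter.
have [_ c1 c2] := cvg_coord FF (cvg_sval2 cvg_id).
apply: cvg_real_complex; apply: (@cvg_continuous _ _ _ Num.sqrt).
  exact: sqrt_continuous.
exact: (cvgD (cvgM c1 c1) (cvgM c2 c2)).
Qed.

Lemma fold_equ_norm q : fold_equ q = `|equ q|.
Proof. by rewrite normc_eq. Qed.

Lemma norm_twist beta b : `|twist beta b| = fold_equ (spot b).
Proof. by rewrite /twist; case: ifP; rewrite fold_equ_norm// normr_id. Qed.

Lemma fold_equ_sqr q : fold_equ q ^+ 2 = (1 - lat q ^+ 2)%:C.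
Proof.
rewrite /fold_equ -rmorphXn sqr_sqrtr ?addr_ge0 ?sqr_ge0//.
by congr _%:C; rewrite -[X in _ = X - _](lat_equ q); ring.
Qed.

Lemma twist_conj beta b : twist beta b * (twist beta b)^* = (1 - slat b ^+ 2)%:C.
Proof. by rewrite -fold_equ_sqr -(norm_twist beta) sqr_normc. Qed.

Lemma twist_continuous beta : continuous (twist beta).
Proof.
move=> b; have FF : Filter (nbhs (b : B)) by exact: nbhs_filter.
have ce : (fun x : B => equ (spot x)) @ b --> equ (spot b).
  by apply: (@cvg_continuous _ _ _ equ); [exact: equ_continuous|exact: spot_continuous].
have cf : (fun x : B => fold_equ (spot x)) @ b --> fold_equ (spot b).
  apply: (@cvg_continuous _ _ _ fold_equ); first exact: fold_equ_continuous.
  exact: spot_continuous.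
have [sb|sb] := boolP (-1 < slat b < 1).
  have nb := near_position sb.
  have c : (fun x : B => if beta (component b) (position b) then equ (spot x)
      else fold_equ (spot x)) @ b --> twist beta b.
    by rewrite /twist; case: ifP.
  apply: cvg_trans c; apply: near_eq_cvg.
  by apply: (@filterS _ (nbhs b) _ _ _ _ nb) => x [h1 h2]; rewrite /twist h1 h2.
(* at a pole the twist vanishes whatever [beta] is *)
have f0 : fold_equ (spot b) = 0.
  have /andP[l1 l2] := lat_bounds (spot b); rewrite -/(slat b) in l1 l2.
  have ss : slat b ^+ 2 = 1.
    move: sb; rewrite negb_and -!leNgt => /orP[h|h].
      have -> : slat b = -1 by lra.
      by rewrite sqrrN expr1n.
    have -> : slat b = 1 by lra.
    by rewrite expr1n.
  by apply/eqP; rewrite -sqrf_eq0 fold_equ_sqr -/(slat b) ss subrr.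
have t0 : twist beta b = 0.
  by apply/eqP; rewrite -normr_eq0 norm_twist f0.
have c : (fun x : B => twist beta x) @ b --> (0 : C).
  apply: (iffLR (@norm_cvg0P _ _ _ (nbhs b) FF (twist beta))).
  rewrite f0 in cf; apply: cvg_trans cf; apply: near_eq_cvg.
  by apply: nearW => x; rewrite norm_twist.
by rewrite -t0 in c; exact: c.
Qed.

Definition cos_half (b : B) : R := Num.sqrt ((1 + slat b) / 2).
Definition sin_half (b : B) : R := Num.sqrt ((1 - slat b) / 2).

Lemma slat_bounds b : -1 <= slat b <= 1. Proof. exact: lat_bounds. Qed.

Lemma cos_half_sqr b : (1 + slat b)%:C = 2 * (cos_half b)%:C ^+ 2.
Proof.
have /andP[h1 h2] := slat_bounds b.
rewrite -[2]/(2%:R) -(rmorph_nat (real_complex R)) -rmorphXn -rmorphM.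
by congr _%:C; rewrite sqr_sqrtr; [field|lra].
Qed.

Lemma sin_half_sqr b : (1 - slat b)%:C = 2 * (sin_half b)%:C ^+ 2.
Proof.
have /andP[h1 h2] := slat_bounds b.
rewrite -[2]/(2%:R) -(rmorph_nat (real_complex R)) -rmorphXn -rmorphM.
by congr _%:C; rewrite sqr_sqrtr; [field|lra].
Qed.

Lemma cos_half_continuous : continuous cos_half.
Proof.
move=> b; have FF : Filter (nbhs (b : B)) by exact: nbhs_filter.
apply: (@cvg_continuous _ _ _ Num.sqrt); first exact: sqrt_continuous.
exact: (cvgMl (cvgD (cvg_cst _) (@slat_continuous b))).
Qed.

Lemma sin_half_continuous : continuous sin_half.
Proof.
move=> b; have FF : Filter (nbhs (b : B)) by exact: nbhs_filter.
apply: (@cvg_continuous _ _ _ Num.sqrt); first exact: sqrt_continuous.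
exact: (cvgMl (cvgB (cvg_cst _) (@slat_continuous b))).
Qed.

Lemma twist_half beta b : twist beta b * (twist beta b)^* =
  4 * (cos_half b)%:C ^+ 2 * (sin_half b)%:C ^+ 2.
Proof.
rewrite twist_conj; have -> : 1 - slat b ^+ 2 = (1 + slat b) * (1 - slat b) by ring.
by rewrite real_complexM cos_half_sqr sin_half_sqr; ring.
Qed.

Lemma fold_half b : fold_equ (spot b) = 2 * (cos_half b)%:C * (sin_half b)%:C.
Proof.
have r2 : (2 : C) = (2 : R)%:C by rewrite -[2]/(2%:R) -(rmorph_nat (real_complex R)).
apply/eqP; rewrite -(@eqrXn2 _ 2)//; last 2 first.
- by rewrite fold_equ_norm normr_ge0.
- by rewrite r2 -!rmorphM lecR !mulr_ge0// sqrtr_ge0.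
apply/eqP; rewrite fold_equ_sqr -/(slat b).
have -> : 1 - slat b ^+ 2 = (1 + slat b) * (1 - slat b) by ring.
by rewrite real_complexM cos_half_sqr sin_half_sqr; ring.
Qed.

End Twist.

Section Trivializations.
Context {R : realType}.
Local Notation C := (R[i]^o).
Local Notation B := (chains R).
Variable beta : nat -> nat -> bool.
Local Notation tw := (twist beta).
Local Notation P b := ((cos_half b)%:C : C).
Local Notation M b := ((sin_half b)%:C : C).

(** [true] stands for the complement of the south poles, [false] for that of
    the north poles. *)
Definition chart_dom (j : bool) : set B :=
  [set b | if j then -1 < slat b else slat b < 1].

Definition in_line (b : B) (v : C * C) : Prop :=
  (tw b)^* * v.1 = (1 + slat b)%:C * v.2 /\
  (1 - slat b)%:C * v.1 = tw b * v.2.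

(** At longitude [p] and where [slat b = cos t], the line over a sphere of bit 1 is
    spanned by [(cos (t/2), exp (- i p) sin (t/2))]. The two trivializations take
    as unit vector the multiple of it whose first, respectively second coordinate
    is real; written with [twist] they make sense for both values of the bit. *)
Definition line_vec (j : bool) (b : B) (f : C) : C * C :=
  if j then (f * P b, f * (tw b)^* / (2 * P b))
  else (f * tw b / (2 * M b), f * M b).

Definition line_coord (j : bool) (b : B) (v : C * C) : C :=
  if j then v.1 / P b else v.2 / M b.

Definition line_transition (j j' : bool) (b : B) : circle R :=
  match j, j' with
  | true, false => unit_complex (tw b)^*
  | false, true => unit_complex (tw b)
  | _, _ => 1%g
  end.

Lemma two_neq0 : (2 : C) != 0.
Proof. by rewrite pnatr_eq0. Qed.

Lemma real_complex_eq0 (r : R) : ((r%:C : C) == 0) = (r == 0).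
Proof. by rewrite eq_complex /= eqxx andbT. Qed.

Lemma cos_half_neq0 b : chart_dom true b -> P b != 0.
Proof.
rewrite /chart_dom /= => s1; rewrite real_complex_eq0 gt_eqF// sqrtr_gt0; lra.
Qed.

Lemma sin_half_neq0 b : chart_dom false b -> M b != 0.
Proof.
rewrite /chart_dom /= => s1; rewrite real_complex_eq0 gt_eqF// sqrtr_gt0; lra.
Qed.

Lemma line_vec_in_line j b f : in_line b (line_vec j b f).
Proof.
have T := twist_half beta b; have two0 := two_neq0.
rewrite /in_line cos_half_sqr sin_half_sqr; case: j => /=.
  have [P0|P0] := eqVneq (P b) 0.
    by move: T; rewrite P0 !mulr0 !invr0 !mulr0 expr0n /= ?mulr0 ?mul0r.
  split; first by field; rewrite ?P0 ?two0.
  have -> : tw b * (f * (tw b)^* / (2 * P b)) = f * (tw b * (tw b)^*) / (2 * P b) by ring.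
  by rewrite T; field; rewrite ?P0 ?two0.
have [M0|M0] := eqVneq (M b) 0.
  by move: T; rewrite M0 !mulr0 !invr0 !mulr0 expr0n /= ?mulr0 ?mul0r.
split; last by field; rewrite ?M0 ?two0.
have -> : (tw b)^* * (f * tw b / (2 * M b)) = f * (tw b * (tw b)^*) / (2 * M b) by ring.
by rewrite T; field; rewrite ?M0 ?two0.
Qed.

Lemma line_coordK j b f : chart_dom j b -> line_coord j b (line_vec j b f) = f.
Proof.
by case: j => [/cos_half_neq0|/sin_half_neq0] h; rewrite /line_coord /line_vec /= mulfK.
Qed.

Lemma line_vecK j b v : chart_dom j b -> in_line b v ->
  line_vec j b (line_coord j b v) = v.
Proof.
have two0 := two_neq0; case: v => v1 v2.
rewrite /in_line cos_half_sqr sin_half_sqr /=.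
case: j => [/cos_half_neq0|/sin_half_neq0] h [e1 e2]; rewrite /line_coord /line_vec /=.
  congr (_, _); first by rewrite divfK.
  have -> : v1 / P b * (tw b)^* / (2 * P b) = (tw b)^* * v1 / (2 * P b ^+ 2).
    by field; rewrite ?h ?two0.
  by rewrite e1; field; rewrite ?h ?two0.
congr (_, _); last by rewrite divfK.
have -> : v2 / M b * tw b / (2 * M b) = tw b * v2 / (2 * M b ^+ 2).
  by field; rewrite ?h ?two0.
by rewrite -e2; field; rewrite ?h ?two0.
Qed.

Lemma twist_neq0 b : chart_dom true b -> chart_dom false b -> tw b != 0.
Proof.
move=> /cos_half_neq0 h1 /sin_half_neq0 h2.
by rewrite -normr_eq0 norm_twist fold_half !mulf_neq0// two_neq0.
Qed.

Lemma conj_neq0 (z : C) : z != 0 -> z^* != 0.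
Proof. by rewrite conjc_eq0. Qed.

Lemma line_transitionE j j' b f : chart_dom j b -> chart_dom j' b ->
  line_coord j' b (line_vec j b f) = rotation (line_transition j j' b) f.
Proof.
have two0 := two_neq0.
case: j j' => [] [] h h'.
- by rewrite line_coordK// /rotation mul1r.
- have t0 := twist_neq0 h h'.
  have [p0 m0] := (cos_half_neq0 h, sin_half_neq0 h').
  rewrite /line_coord /line_vec /line_transition /rotation unit_complex_val ?conj_neq0//.
  rewrite normcJ norm_twist fold_half /=.
  by field; rewrite ?p0 ?m0 ?two0.
- have t0 := twist_neq0 h' h.
  have [p0 m0] := (cos_half_neq0 h', sin_half_neq0 h).
  rewrite /line_coord /line_vec /line_transition /rotation unit_complex_val//.
  rewrite norm_twist fold_half /=.
  by field; rewrite ?p0 ?m0 ?two0.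
- by rewrite line_coordK// /rotation mul1r.
Qed.

Lemma line_transition_continuous j j' b : chart_dom j b -> chart_dom j' b ->
  {for b, continuous (line_transition j j')}.
Proof.
have FF : Filter (nbhs (b : B)) by exact: nbhs_filter.
have ct : (fun x : B => tw x) @ b --> tw b by exact: twist_continuous.
case: j j' => [] [] h h'; try exact: cvg_cst.
- by apply: cvg_unit_complex; [exact/conj_neq0/twist_neq0|exact: cvg_conj].
- by apply: cvg_unit_complex; first exact: twist_neq0.
Qed.

Definition line_space : set (B * (C * C)) := [set x | in_line x.1 x.2].

Lemma cvg_real_base (f : B -> R) : continuous f ->
  forall x : B * (C * C), (fun y : B * (C * C) => (f y.1)%:C : C) @ x --> ((f x.1)%:C : C).
Proof.
move=> cf x; have FF : Filter (nbhs (x : B * (C * C))) by exact: nbhs_filter.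
apply: cvg_real_complex; apply: (@cvg_continuous _ _ _ f); first exact: cf.
exact: cvg_fst.
Qed.

Lemma cvg_vec (T : Type) (F : set_system T) (v : T -> C * C) (v0 : C * C) : Filter F ->
  v x @[x --> F] --> v0 ->
  ((v x).1 : C) @[x --> F] --> (v0.1 : C) /\ ((v x).2 : C) @[x --> F] --> (v0.2 : C).
Proof.
by move=> FF cv; split; apply: cvg_comp cv _; [exact: cvg_fst|exact: cvg_snd].
Qed.

Lemma closed_eq_complex (T : topologicalType) (f g : T -> C) :
  (forall x, f y @[y --> x] --> f x) -> (forall x, g y @[y --> x] --> g x) ->
  closed [set x | f x = g x].
Proof.
move=> cf cg.
have cl (h : T -> R) : continuous h -> closed [set x | h x = 0].
  by move=> ch; apply: (@closed_comp _ _ h [set r | r = 0]) => [x _|]; [exact: ch|exact: closed_eq].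
have -> : [set x | f x = g x] = [set x | complex.Re (f x) - complex.Re (g x) = 0] `&`
    [set x | complex.Im (f x) - complex.Im (g x) = 0].
  apply/seteqP; split=> x /=; first by move=> ->; rewrite !subrr.
  by case: (f x) (g x) => [a b] [c d] /= [/subr0_eq -> /subr0_eq ->].
apply: closedI; apply: cl => x; have FF := nbhs_filter x.
  exact: (cvgB (cvg_re (cf x)) (cvg_re (cg x))).
exact: (cvgB (cvg_im (cf x)) (cvg_im (cg x))).
Qed.
Lemma closed_line_space : closed line_space.
Proof.
have cs1 : continuous (fun b : B => 1 + slat b).
  move=> b; have FF : Filter (nbhs (b : B)) by exact: nbhs_filter.
  exact: (cvgD (cvg_cst _) (@slat_continuous R b)).
have cs2 : continuous (fun b : B => 1 - slat b).
  move=> b; have FF : Filter (nbhs (b : B)) by exact: nbhs_filter.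
  exact: (cvgB (cvg_cst _) (@slat_continuous R b)).
have ctw (x : B * (C * C)) : (fun y : B * (C * C) => tw y.1 : C) @ x --> (tw x.1 : C).
  apply: (@cvg_continuous _ _ _ tw); first exact: twist_continuous.
  exact: cvg_fst.
have cv (x : B * (C * C)) : (fun y : B * (C * C) => y.2) @ x --> x.2 by exact: cvg_snd.
apply: closedI; apply: closed_eq_complex => y;
  have FF : Filter (nbhs (y : B * (C * C))) by exact: nbhs_filter.
- exact: (cvg_complexM FF (cvg_conj FF (ctw y)) (cvg_vec FF (cv y)).1).
- exact: (cvg_complexM FF (@cvg_real_base _ cs1 y) (cvg_vec FF (cv y)).2).
- exact: (cvg_complexM FF (@cvg_real_base _ cs2 y) (cvg_vec FF (cv y)).1).
- exact: (cvg_complexM FF (ctw y) (cvg_vec FF (cv y)).2).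
Qed.
Definition line_total : topologicalType := line_space.

Lemma polish_line_total : polish R line_total.
Proof.
apply: (polish_closed closed_line_space); apply: polish_prod.
  exact: polish_chains.
by apply: polish_prod; exact: polish_complex.
Qed.

Definition line_proj (x : line_total) : B := (set_val x).1.
Definition line_chart (j : bool) (x : line_total) : B * C :=
  (line_proj x, line_coord j (line_proj x) (set_val x).2).
Definition line_point (b : B) (v : C * C) (h : in_line b v) : line_total :=
  exist _ (b, v) (mem_set (h : line_space (b, v))).
Definition line_chart_inv (j : bool) (y : B * C) : line_total :=
  line_point (line_vec_in_line j y.1 y.2).

Lemma line_proj_continuous : continuous line_proj.
Proof.
move=> x; have c : (fun y : line_total => set_val y) @ x --> set_val x.
  exact: initial_continuous.
by apply: cvg_comp c _; exact: cvg_fst.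
Qed.

Lemma line_totalP (x : line_total) : in_line (line_proj x) (set_val x).2.
Proof. exact: (set_valP x). Qed.

Lemma line_chartK j x : chart_dom j (line_proj x) ->
  line_chart_inv j (line_chart j x) = x.
Proof.
move=> h; apply: val_inj; change ((line_proj x, line_vec j (line_proj x)
  (line_coord j (line_proj x) (set_val x).2)) = set_val x).
rewrite line_vecK//; last exact: line_totalP.
by rewrite /line_proj; case: (set_val x).
Qed.

Lemma line_chart_invK j y : chart_dom j y.1 -> line_chart j (line_chart_inv j y) = y.
Proof.
move=> h; rewrite /line_chart /line_chart_inv /line_proj /= line_coordK//.
by case: (y).
Qed.

Lemma line_chart_continuous j x : chart_dom j (line_proj x) ->
  {for x, continuous (line_chart j)}.
Proof.
move=> h; have FF : Filter (nbhs (x : line_total)) by exact: nbhs_filter.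
have cp : (fun y : line_total => line_proj y) @ x --> line_proj x.
  exact: line_proj_continuous.
have c : (fun y : line_total => set_val y) @ x --> set_val x.
  exact: initial_continuous.
have cv : (fun y : line_total => (set_val y).2) @ x --> (set_val x).2.
  by apply: cvg_comp c _; exact: cvg_snd.
have [c1 c2] := cvg_vec FF cv.
have cl : (fun y : line_total => line_coord j (line_proj y) (set_val y).2 : C) @ x -->
    (line_coord j (line_proj x) (set_val x).2 : C).
  have cP : (fun y : line_total => P (line_proj y)) @ x --> P (line_proj x).
    apply: cvg_real_complex; apply: (@cvg_continuous _ _ _ cos_half) cp.
    exact: cos_half_continuous.
  have cM : (fun y : line_total => M (line_proj y)) @ x --> M (line_proj x).
    apply: cvg_real_complex; apply: (@cvg_continuous _ _ _ sin_half) cp.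
    exact: sin_half_continuous.
  rewrite /line_coord; case: j h => h.
    exact: (cvg_complexM FF c1 (cvg_complexV FF (cos_half_neq0 h) cP)).
  exact: (cvg_complexM FF c2 (cvg_complexV FF (sin_half_neq0 h) cM)).
exact: (cvg_pair cp cl).
Qed.

Lemma line_vec_continuous j (y : B * C) : chart_dom j y.1 ->
  {for y, continuous (fun y : B * C => line_vec j y.1 y.2)}.
Proof.
move=> h; have FF : Filter (nbhs (y : B * C)) by exact: nbhs_filter.
have c1 : (fun x : B * C => x.1) @ y --> y.1 by exact: cvg_fst.
have c2 : (fun x : B * C => x.2 : C) @ y --> (y.2 : C) by exact: cvg_snd.
have ct : (fun x : B * C => tw x.1 : C) @ y --> (tw y.1 : C).
  by apply: (@cvg_continuous _ _ _ tw) c1; exact: twist_continuous.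
have cP : (fun x : B * C => P x.1) @ y --> P y.1.
  apply: cvg_real_complex; apply: (@cvg_continuous _ _ _ cos_half) c1.
  exact: cos_half_continuous.
have cM : (fun x : B * C => M x.1) @ y --> M y.1.
  apply: cvg_real_complex; apply: (@cvg_continuous _ _ _ sin_half) c1.
  exact: sin_half_continuous.
have c22 : (fun x : B * C => 2 : C) @ y --> (2 : C) by exact: cvg_cst.
rewrite /line_vec; case: j h => h.
  have i0 : 2 * P y.1 != 0 by rewrite mulf_neq0 ?two_neq0// cos_half_neq0.
  exact: (cvg_pair (cvg_complexM FF c2 cP) (cvg_complexM FF
    (cvg_complexM FF c2 (cvg_conj FF ct)) (cvg_complexV FF i0 (cvg_complexM FF c22 cP)))).
have i0 : 2 * M y.1 != 0 by rewrite mulf_neq0 ?two_neq0// sin_half_neq0.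
exact: (cvg_pair (cvg_complexM FF
    (cvg_complexM FF c2 ct) (cvg_complexV FF i0 (cvg_complexM FF c22 cM)))
    (cvg_complexM FF c2 cM)).
Qed.

Lemma line_chart_inv_continuous j (y : B * C) : chart_dom j y.1 ->
  {for y, continuous (line_chart_inv j)}.
Proof.
move=> h; have FF : Filter (nbhs (y : B * C)) by exact: nbhs_filter.
apply: cvg_set_type.
have c1 : (fun x : B * C => x.1) @ y --> y.1 by exact: cvg_fst.
exact: (cvg_pair c1 (line_vec_continuous h)).
Qed.

Lemma line_chart_homeo j (D : set B) : D `<=` chart_dom j ->
  homeo_between (line_proj @^-1` D) (D `*` [set: C]) (line_chart j) (line_chart_inv j).
Proof.
move=> Dj; split.
- by move=> x Dx; split.
- by move=> y [Dy _].
- by move=> x /Dj; exact: line_chartK.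
- by move=> y [/Dj Dy _]; exact: line_chart_invK.
split; apply: continuous_in_subspaceT.
  by move=> x /set_mem/Dj; exact: line_chart_continuous.
by move=> y /set_mem[/Dj Dy _]; exact: line_chart_inv_continuous.
Qed.

End Trivializations.

(** * Covers, bundles and codes *)
Section Cover.
Context {R : realType}.
Local Notation B := (chains R).
Variable BB : set (set B).

(** The charts are indexed by sets, so the set has to decide which of the two
    trivializations is used. *)
Definition chart_side (U : set B) : bool := `[< U `<=` chart_dom true >].

Definition small (U : set B) : Prop :=
  U `<=` chart_dom (chart_side U) /\ exists n k, U `<=` bead_nbhd n k.

Lemma chart_dom_open j : open (chart_dom j : set B).
Proof.
case: j.
  apply: (@open_comp _ _ (@slat R) [set r | -1 < r]) => [x _|]; last exact: open_gt.
  exact: slat_continuous.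
apply: (@open_comp _ _ (@slat R) [set r | r < 1]) => [x _|]; last exact: open_lt.
exact: slat_continuous.
Qed.

Lemma chart_dom_cover (b : B) : exists j, chart_dom j b.
Proof.
have [h|h] := ltrP (-1) (slat b); first by exists true.
by exists false; rewrite /chart_dom /=; lra.
Qed.

(** Finite subfamilies, directed by inclusion, form the filter along which
    compactness is applied. *)
Lemma compact_finite_cover (T : topologicalType) (K : set T) (D : set (set T)) :
  compact K -> D `<=` open -> K `<=` \bigcup_(U in D) U ->
  exists2 W : set (set T), finite_set W /\ W `<=` D & K `<=` \bigcup_(U in W) U.
Proof.
move=> /compact_near_coveringP Kc Do KD.
pose F : set_system (set (set T)) := [set A | exists2 W, finite_set W /\ W `<=` D &
  forall W', finite_set W' /\ W' `<=` D -> W `<=` W' -> A W'].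
have FF : Filter F.
  split.
  - by exists set0; [split; [exact: finite_set0|by []]|].
  - move=> A A' [W [Wf WD] WA] [W' [Wf' WD'] WA']; exists (W `|` W').
      by split; [rewrite finite_setU|move=> U []; [exact: WD|exact: WD']].
    by move=> V VP WV; split; [apply: WA|apply: WA'] => // U WU; apply: WV; [left|right].
  - by move=> A A' AA' [W WP WA]; exists W => // V VP WV; exact/AA'/WA.
have [|W WP WA] := Kc _ F (fun W x => (\bigcup_(U in W) U) x) FF; last first.
  by exists W => //; exact: WA.
move=> x /KD[U DU Ux]; exists (U, [set W | W U]) => /=; last first.
  by move=> [y W] [Uy WU]; exists U.
split; first by apply: open_nbhs_nbhs; split=> //; exact: Do.
exists [set U]; last by move=> W _; exact.
by split=> [|V ->].
Qed.

Lemma bead_cover n k : basis BB ->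
  exists2 W : set (set B), finite_set W /\
      (forall U, W U -> [/\ BB U, small U & U `<=` bead_nbhd n k]) &
    bead_sphere n k `<=` \bigcup_(U in W) U.
Proof.
move=> [BBo BBn].
have [U [/BBo]//|b bS|W [Wf WD] Wb] := @compact_finite_cover B (bead_sphere n k)
    [set U | [/\ BB U, small U & U `<=` bead_nbhd n k]] (@compact_bead_sphere R n k).
  have [j jb] := chart_dom_cover b.
  have : nbhs b (chart_dom j `&` bead_nbhd n k).
    apply: open_nbhs_nbhs; split; last by split => //; exact: bead_sphere_nbhd.
    by apply: openI; [exact: chart_dom_open|exact: bead_nbhd_open].
  move=> /BBn[U [BU Ub] UV]; exists U => //; split=> //; last by move=> c /UV[].
  split; last by exists n, k => c /UV[].
  rewrite /chart_side; case: asboolP => // Ut.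
  by case: j jb UV => jb UV; [case: Ut|] => c /UV[].
by exists W.
Qed.

Lemma adapted_cover : basis BB -> exists C : set (set B),
  [/\ C `<=` BB, C `<=` open, \bigcup_(U in C) U = [set: B], locally_finite C id &
      forall U, C U -> small U].
Proof.
move=> bB; have [BBo _] := bB.
have /choice[W WP] : forall nk : nat * nat, exists W : set (set B), [/\ finite_set W,
      forall U, W U -> [/\ BB U, small U & U `<=` bead_nbhd nk.1 nk.2] &
      bead_sphere nk.1 nk.2 `<=` \bigcup_(U in W) U].
  by move=> [n k]; have [W [? ?] ?] := bead_cover n k bB; exists W.
exists (\bigcup_nk W nk); split.
- by move=> U [nk _ /(let: And3 _ h _ := WP nk in h) []].
- by move=> U [nk _ /(let: And3 _ h _ := WP nk in h) [/BBo]].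
- apply/seteqP; split=> // b _; have [_ _ /(_ b) h] := WP (component b, position b).
  have [|U WU Ub] := h; first by exists (spot b) => //; exact/esym/positionP.
  by exists U => //; exists (component b, position b).
- move=> b; set n := component b; set k := position b; exists (bead_nbhd n k).
    apply: open_nbhs_nbhs; split; first exact: bead_nbhd_open.
    by apply: bead_sphere_nbhd; exact: position_sphere.
  apply: (@sub_finite_set _ _ (\bigcup_(j in `I_k.+2) W (n, j))); last first.
    by apply: bigcup_finite => [|j _]; [exact: finite_II|have [] := WP (n, j)].
  move=> U [[[n' j] _ WU] [c [[cn ck] Uc]]].
  have [_ /(_ U WU)[_ _ /(_ c Uc)[/= cn' cj] _]] := WP (n', j).
  move: WU; rewrite -cn' cn => WU; exists j => //=.
  rewrite -(ltr_nat R) -addn2 natrD.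
  move: ck cj; rewrite !ltr_norml => /andP[c1 c2] /andP[c3 c4].
  have : (j%:R : R) < k%:R + 2 by lra.
  by [].
- by move=> U [nk _ /(let: And3 _ h _ := WP nk in h) []].
Qed.

End Cover.

Section Bundles.
Context {R : realType}.
Local Notation B := (chains R).
Local Notation C := (R[i]^o).
Variable W : set (set B).

Definition admissible_cover : Prop :=
  [/\ W `<=` open, \bigcup_(U in W) U = [set: B], locally_finite W id &
      forall U, W U -> small U].

Hypothesis hW : admissible_cover.

Lemma cover_side U b : W U -> U b -> chart_dom (chart_side U) b.
Proof. by move=> WU Ub; have [_ _ _ /(_ U WU)[h _]] := hW; exact: h. Qed.

Definition line_bundle (beta : nat -> nat -> bool) :
  fibre_bundle R B (@rotation R).
Proof.
apply: (@FibreBundle R B C (circle R) (@rotation R) (line_total beta) (@line_proj R beta) W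
  (fun U => @line_chart R beta (chart_side U)) (fun U => @line_chart_inv R beta (chart_side U))
  (fun U V => line_transition beta (chart_side U) (chart_side V))) => //.
- exact: polish_line_total.
- exact: line_proj_continuous.
- by have [] := hW.
- by have [] := hW.
- by have [] := hW.
- by move=> U WU; apply: line_chart_homeo => b; exact: cover_side.
- by move=> U b WU Ub; apply: line_chart_homeo => _ ->; exact: cover_side.
- move=> U V WU WV; apply: continuous_in_subspaceT => b /set_mem[Ub Vb].
  by apply: line_transition_continuous; exact: cover_side.
- move=> U V WU WV b f Ub Vb; congr (_, _).
  by apply: line_transitionE; exact: cover_side.
Defined.

Variable BB : set (set B).
Hypothesis WB : W `<=` BB.
Variable beta : nat -> nat -> bool.

Definition code_transition (U V : set B) (b : B) : circle R :=
  if `[< W U /\ W V >] then line_transition beta (chart_side U) (chart_side V) b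
  else 1%g.

Lemma code_transition_continuous (UV : (BB * BB)%type) : continuous
  (fun b : (set_val UV.1 `&` set_val UV.2 : set B) =>
    code_transition (set_val UV.1) (set_val UV.2) (set_val b)).
Proof.
move=> b; rewrite /code_transition; case: asboolP => [[WU WV]|_]; last first.
  by have FF := nbhs_filter b; exact: cvg_cst.
have [Ub Vb] := set_valP b.
apply: cvg_comp; first exact: initial_continuous.
by apply: line_transition_continuous; exact: cover_side.
Qed.

Definition code_transitions : transition_space (circle R) BB :=
  fun UV => mkcts (code_transition_continuous (UV := UV)).

Definition line_code : code_space (circle R) BB :=
  ((fun U : BB => `[< W (set_val U) >]) : {ptws BB -> bool}, code_transitions).

Lemma line_codes : codes line_code (line_bundle beta).
Proof.
split.
- apply/seteqP; split=> [U WU|_ [U /asboolP WU <-]//].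
  exists (exist _ U (mem_set (WB WU))) => //; apply/asboolP; exact: WU.
- move=> U V /asboolP WU /asboolP WV b.
  rewrite /code_trans /= /mkcts /code_transition; case: asboolP => // h.
  by case: h; split; [exact: WU|exact: WV].
- move=> U V UV b; rewrite /code_trans /= /mkcts /code_transition.
  by case: asboolP => // -[WU WV]; case: UV; split; apply/asboolP; [exact: WU|exact: WV].
Qed.

Definition line_bun : BunC R BB :=
  exist _ line_code (mem_set (ex_intro _ (line_bundle beta) line_codes)).

End Bundles.

(** A bead neighbourhood meets finitely many spheres, and the bits of these
    alone decide the transition maps over it. *)
Lemma line_transition_local (R : realType) (beta beta' : nat -> nat -> bool) j j' n k
    (b : chains R) : bead_nbhd n k b ->
  (forall l, (l < k.+2)%N -> beta n l = beta' n l) ->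
  line_transition beta j j' b = line_transition beta' j j' b.
Proof.
move=> bn E; have S : bead_sphere n (position b) b.
  by case: bn => <- _; exact: position_sphere.
have T : twist beta b = twist beta' b.
  by rewrite /twist; case: (bn) => -> _; rewrite E// ltnS; have [] := bead_nbhd_sphere bn S.
by rewrite /line_transition T.
Qed.

(** Chains are numbered by codes of pairs [(m, a)]; those whose number is not a
    code carry the trivial bundle. *)
Definition chain_bits (x : array) (n k : nat) : bool :=
  if @pickle_inv (nat * int)%type n is Some c then x (c, k) != 0 else false.

(** The code space is a product, so that one transition map can be considered at a
    time, and as a function of the array it is locally constant. *)
Lemma line_bun_locally_determined (R : realType) (W : set (set (chains R)))
    (hW : admissible_cover W) (BB : set (set (chains R))) (WB : W `<=` BB)
    (O : set (BunC R BB)) : open O ->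
  locally_determined ((fun x => line_bun hW WB (chain_bits x)) @^-1` O).
Proof.
move=> oO x Ox.
pose F : set_system array := [set A | exists L, forall y, agree L x y -> A y].
have FF : Filter F.
  split; first by exists [::].
  - move=> A A' [L LA] [L' LA']; exists (L ++ L') => y /agree_cat[h h'].
    by split; [exact: LA|exact: LA'].
  - by move=> A A' AA' [L LA]; exists L => y /LA/AA'.
suff : (fun y => line_bun hW WB (chain_bits y)) @ F --> line_bun hW WB (chain_bits x).
  by move=> /(_ O); apply; apply: open_nbhs_nbhs.
apply: cvg_set_type.
pose tr y : transition_space (circle R) BB := code_transitions hW (chain_bits y).
suff c : (fun y => tr y) @ F -->
    tr x.
  exact: (cvg_pair (cvg_cst _) c).
apply/cvg_sup => UV A [V] [[V'] oV' <-] Vx VA.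
apply: (filterS VA).
have [L LE] : exists L, forall y, agree L x y ->
    tr y UV = tr x UV.
  have [[WU WV]|nW] := pselect (W (set_val UV.1) /\ W (set_val UV.2)); last first.
    exists [::] => y _; apply: (iffRL (@continuousEP _ _ (tr y UV) (tr x UV))) => b.
    by rewrite /tr /code_transitions /= /mkcts /code_transition; case: asboolP.
  have [_ _ _ /(_ _ WU)[_ [n [k nk]]]] := hW.
  exists (if @pickle_inv (nat * int)%type n is Some c then [seq (c, l) | l <- iota 0 k.+2]
          else [::]) => y xy; apply: (iffRL (@continuousEP _ _ (tr y UV) (tr x UV))) => b.
  rewrite /tr /code_transitions /= /mkcts /code_transition; case: asboolP => // _.
  have [Ub _] := set_valP b; apply: (line_transition_local _ _ (nk _ Ub)) => l lk.
  move: xy; rewrite /chain_bits; case: pickle_inv => // c -> //.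
  by apply: map_f; rewrite mem_iota.
by exists L => y xy; rewrite /= /proj LE.
Qed.

(** * Isomorphisms permuting the chains *)
Section Relabelling.
Context {R : realType}.
Local Notation B := (chains R).
Local Notation C := (R[i]^o).

Lemma equ_pole (q : @sphere2 R) : ~~ (-1 < lat q < 1) -> equ q = 0.
Proof.
move=> nl; have /andP[l1 l2] := lat_bounds q; have E := lat_equ q.
have l : lat q ^+ 2 = 1.
  have [lt|ge] := ltrP (-1) (lat q); last first.
    have -> : lat q = -1 by lra.
    by rewrite sqrrN expr1n.
  move: nl; rewrite lt /= -leNgt => ge; have -> : lat q = 1 by lra.
  by rewrite expr1n.
have y0 := sqr_ge0 (sval2 q).2.1; have z0 := sqr_ge0 (sval2 q).2.2.
have y1 : (sval2 q).2.1 ^+ 2 = 0 by lra.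
have z1 : (sval2 q).2.2 ^+ 2 = 0 by lra.
move/eqP: y1; move/eqP: z1; rewrite !sqrf_eq0 /equ => /eqP -> /eqP -> //.
Qed.

(** At a point common to two spheres the position is ambiguous, but both values
    of the twist vanish there. *)
Lemma twist_bead beta n k (q : @sphere2 R) :
  twist beta (bead n k q) = if beta n k then equ q else fold_equ q.
Proof.
rewrite /twist; have := positionP (bead n k q); set j := position _.
rewrite -[component _]/n -[spot _]/q => E.
have [lq|/equ_pole e0] := boolP (-1 < lat q < 1).
  by have [_ <- _] := bead_inj_index E (or_introl lq).
have f0 : fold_equ q = 0 by rewrite fold_equ_norm e0 normr0.
by rewrite e0 f0 !if_same.
Qed.

Fact relabel_subproof (s : nat -> nat) (b : B) :
  chains_set (s (component b), (height b, spot b)).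
Proof. by exists (position b); rewrite /= [in LHS](positionP b). Qed.

Definition relabel s (b : B) : B :=
  exist _ (s (component b), (height b, spot b)) (mem_set (relabel_subproof s b)).

Lemma relabel_bead s n k q : relabel s (bead n k q) = bead (s n) k q.
Proof. exact: chainsP. Qed.

Lemma relabel_continuous s : continuous (relabel s).
Proof.
move=> b; have FF : Filter (nbhs (b : B)) by exact: nbhs_filter.
apply: cvg_chains.
- apply: cvg_near_cst; apply: (@filterS _ (nbhs b) _ _ _ _ (near_component b)).
  by move=> b' /= ->.
- exact: (@height_continuous R b).
- exact: (@spot_continuous R b).
Qed.

Lemma relabelK s s' : cancel s s' -> cancel (relabel s) (relabel s').
Proof. by move=> sK b; apply: chainsP => //; exact: sK. Qed.

Variables (beta beta' : nat -> nat -> bool) (s s' : nat -> nat).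
Hypothesis sK : cancel s s'.
Hypothesis s'K : cancel s' s.
Hypothesis betaE : forall n k, beta' (s n) k = beta n k.

Lemma twist_relabel b : twist beta' (relabel s b) = twist beta b.
Proof. by rewrite (positionP b) relabel_bead !twist_bead betaE. Qed.

Lemma in_line_relabel b v : in_line beta' (relabel s b) v <-> in_line beta b v.
Proof. by rewrite /in_line twist_relabel. Qed.

End Relabelling.

Section IsoRelabelling.
Context {R : realType}.
Local Notation B := (chains R).
Local Notation C := (R[i]^o).

Definition line_relabel beta beta' s s' (sK : cancel s s')
    (betaE : forall n k, beta' (s n) k = beta n k) (x : line_total (R := R) beta) :
  line_total (R := R) beta' :=
  line_point ((in_line_relabel betaE _ _).2 (line_totalP x)).

Lemma line_relabel_continuous beta beta' s s' (sK : cancel s s')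
    (betaE : forall n k, beta' (s n) k = beta n k) :
  continuous (@line_relabel beta beta' s s' sK betaE).
Proof.
move=> x; have FF : Filter (nbhs (x : line_total beta)) by exact: nbhs_filter.
apply: cvg_set_type.
have c : (fun y : line_total beta => set_val y) @ x --> set_val x.
  exact: initial_continuous.
have c1 : (fun y : line_total beta => relabel s (line_proj y)) @ x --> relabel s (line_proj x).
  apply: (@cvg_continuous _ _ _ (relabel s)); first exact: relabel_continuous.
  exact: line_proj_continuous.
have c2 : (fun y : line_total beta => (set_val y).2) @ x --> (set_val x).2.
  by apply: cvg_comp c _; exact: cvg_snd.
exact: (cvg_pair c1 c2).
Qed.

(** The fibres over a chain only depend on its sequence of bits, so a permutation of
    the chains which respects these lifts to the bundles, and in the charts
    the lift is given by the transition maps. *)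
Lemma line_bundle_relabel (W : set (set B)) (hW : admissible_cover W) beta beta' s s' :
  cancel s s' -> cancel s' s -> (forall n k, beta' (s n) k = beta n k) ->
  bundle_iso (line_bundle hW beta) (line_bundle hW beta').
Proof.
move=> sK s'K betaE.
have betaE' n k : beta (s' n) k = beta' n k by rewrite -betaE s'K.
exists (line_relabel sK betaE), (relabel s),
  (fun U V => line_transition beta (chart_side U) (chart_side V)); split.
- split; first exact: line_relabel_continuous.
  exists (line_relabel s'K betaE'); split; first exact: line_relabel_continuous.
  + move=> x; apply: val_inj; rewrite /= /line_proj /= relabelK//.
    by case: (x) => -[].
  + move=> x; apply: val_inj; rewrite /= /line_proj /= relabelK//.
    by case: (x) => -[].
- split; first exact: relabel_continuous.
  by exists (relabel s'); split; [exact: relabel_continuous|exact: relabelK|exact: relabelK].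
- by [].
- move=> U V WU WV; split.
    apply: continuous_in_subspaceT => b /set_mem[Ub Vb].
    apply: line_transition_continuous; first exact: (cover_side hW WU Ub).
    exact: (cover_side hW WV Vb).
  move=> b f Ub Vb; congr (_, _).
  exact: (@line_transitionE R beta (chart_side U) (chart_side V) b f
    (cover_side hW WU Ub) (cover_side hW WV Vb)).
Qed.

Lemma line_bun_iso (W : set (set B)) (hW : admissible_cover W) (BB : set (set B))
    (WB : W `<=` BB) (x x' : array) (f f' : nat * int -> nat * int) :
  cancel f f' -> cancel f' f -> (forall c k, x' (f c, k) = x (c, k)) ->
  BunC_iso (line_bun hW WB (chain_bits x)) (line_bun hW WB (chain_bits x')).
Proof.
move=> fK f'K xE.
pose s (f : nat * int -> nat * int) n :=
  if @pickle_inv (nat * int)%type n is Some c then pickle (f c) else n.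
have sK h h' : cancel h h' -> cancel (s h) (s h').
  move=> hK n; rewrite /s; case E: (@pickle_inv (nat * int)%type n) => [c|].
    rewrite pickleK_inv hK.
    by have := @pickle_invK (nat * int)%type n; rewrite /= /oapp E.
  by rewrite E.
exists (line_bundle hW (chain_bits x)), (line_bundle hW (chain_bits x')).
split; [exact: line_codes|exact: line_codes|].
apply: (line_bundle_relabel hW (sK _ _ fK) (sK _ _ f'K)) => n k.
rewrite /chain_bits /s; case E: (@pickle_inv (nat * int)%type n) => [c|].
  by rewrite pickleK_inv xE.
by rewrite E.
Qed.

End IsoRelabelling.

(** * Homeomorphisms of the base space *)
Section Caps.
Context {R : realType}.
Local Notation B := (chains R).
Local Notation S2 := (@sphere2 R).

Definition polar (k : nat) : S2 := normalize ((-1) ^+ k, (0, 0)).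

Lemma sval2_polar k : sval2 (polar k) = ((-1) ^+ k, (0, 0)).
Proof. by apply: normalize_id; rewrite /norm2 /dot /= !mul0r !addr0 -expr2 sqrr_sign. Qed.

Lemma lat_polar k : lat (polar k) = (-1) ^+ k.
Proof. by rewrite /lat sval2_polar. Qed.

Definition joint n k : B := bead n k (polar k).

Lemma joint_height n k : height (joint n k) = 2 * k%:R + 1.
Proof.
by rewrite -[LHS]/(bead_height k (polar k)) /bead_height lat_polar -expr2 sqrr_sign.
Qed.

Lemma spot_polar (q : S2) k : lat q = (-1) ^+ k -> q = polar k.
Proof.
move=> lq; apply: sval2_inj; rewrite sval2_polar.
have : equ q = 0.
  by apply: equ_pole; rewrite lq -signr_odd; case: odd; apply/negP => /andP[] /=; lra.
by move: lq; rewrite /lat /equ; case: (sval2 q) => a [b c] /= -> [-> ->].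
Qed.

Lemma near_bead (b : B) (k : nat) : 2 * k%:R - 1 <= height b <= 2 * k%:R + 1 ->
  [\/ position b = k,
      position b = k.+1 /\ height b = 2 * k%:R + 1 |
      k = (position b).+1 /\ height b = 2 * k%:R - 1].
Proof.
move=> /andP[h1 h2]; have := bead_height_bounds (position b) (spot b).
have <- : height b = bead_height (position b) (spot b) by rewrite [in LHS](positionP b).
move=> /andP[h3 h4].
have : ((position b)%:R : R) < k.+2%:R /\ (k%:R : R) < (position b).+2%:R.
  by rewrite -[k.+2]addn2 -[_.+2]addn2 !natrD; split; lra.
move=> [p1 p2].
have [lt|gt|->] := ltngtP (position b) k; last by constructor 1.
  have E : k = (position b).+1 by apply/eqP; rewrite eqn_leq lt -ltnS -(ltr_nat R) p2.
  constructor 3; split=> //; apply/eqP; rewrite eq_le h1 andbT.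
  by move: h4; rewrite E -[_.+1]addn1 natrD => h4; lra.
have E : position b = k.+1 by apply/eqP; rewrite eqn_leq gt andbT -ltnS -(ltr_nat R) p1.
constructor 2; split=> //; apply/eqP; rewrite eq_le h2 /=.
by move: h3; rewrite E -[k.+1]addn1 natrD => h3; lra.
Qed.

Lemma jointP (b : B) k : height b = 2 * k%:R + 1 -> b = joint (component b) k.
Proof.
move=> hb; apply: chainsP; rewrite ?joint_height//; apply: spot_polar.
have hs : height b = bead_height (position b) (spot b) by rewrite [in LHS](positionP b).
have sgn : (-1) ^+ k * lat (spot b) = 1 -> lat (spot b) = (-1) ^+ k.
  move=> E; transitivity ((-1) ^+ k * ((-1) ^+ k * lat (spot b))).
    by rewrite mulrA -expr2 sqrr_sign mul1r.
  by rewrite E mulr1.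
have [E|[E _]|[_ ?]] : [\/ position b = k,
      position b = k.+1 /\ height b = 2 * k%:R + 1 |
      k = (position b).+1 /\ height b = 2 * k%:R - 1].
- by apply: near_bead; rewrite hb; apply/andP; split; lra.
- move: hs; rewrite hb E /bead_height => hs.
  have h : (-1) ^+ k * lat (spot b) = 1 by apply: (addrI (2 * k%:R)); rewrite -hs.
  exact: sgn.
- move: hs; rewrite hb E /bead_height exprS mulN1r mulNr.
  move: ((-1) ^+ k * lat _) sgn => r sgn; rewrite -[k.+1]addn1 natrD => hs.
  by apply: sgn; lra.
- by exfalso; lra.
Qed.

Lemma joint_next n k : bead_sphere n k.+1 (joint n k).
Proof.
exists (polar k) => //.
have E : height (bead n k.+1 (polar k)) = 2 * k%:R + 1.
  rewrite -[LHS]/(bead_height k.+1 (polar k)) /bead_height lat_polar exprS -mulrA.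
  by rewrite -expr2 sqrr_sign -addn1 natrD; ring.
exact: (jointP E).
Qed.

Lemma joint_sphere n k : bead_sphere n k (joint n k).
Proof. by exists (polar k). Qed.

Lemma joint_inj n k n' k' : joint n k = joint n' k' -> n = n' /\ k = k'.
Proof.
move=> E; split; first exact: (congr1 component E).
have := congr1 height E; rewrite !joint_height => h.
by apply/eqP; rewrite -(eqr_nat R); apply/eqP; lra.
Qed.

Lemma bead_sphere_height n k (b : B) : bead_sphere n k b <->
  component b = n /\ 2 * k%:R - 1 <= height b <= 2 * k%:R + 1.
Proof.
split=> [[q _ <-]|[<- hb]]; first by split=> //; exact: bead_height_bounds.
have [E|[_ E]|[K E]] := near_bead hb.
- by rewrite -E; exact: position_sphere.
- by rewrite (jointP E); exact: joint_sphere.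
- have E' : height b = 2 * (position b)%:R + 1.
    by rewrite E {1}K -addn1 natrD; ring.
  by rewrite (jointP E') K; exact: joint_next.
Qed.

Definition lower n k : set B := [set b | component b = n /\ height b <= 2 * k%:R + 1].

Lemma lowerP n k b : lower n k b <-> exists2 j, (j <= k)%N & bead_sphere n j b.
Proof.
split=> [[bn hb]|[j jk /bead_sphere_height[bn /andP[_ h]]]]; last first.
  split=> //; apply: le_trans h _.
  by move: jk; rewrite -(ler_nat R) => jk; lra.
have [pk|kp] := leqP (position b) k.
  by exists (position b) => //; rewrite -bn; exact: position_sphere.
exists k => //; apply/bead_sphere_height; split=> //; rewrite hb andbT.
have /bead_sphere_height[_ /andP[h _]] : bead_sphere n (position b) b.
  by rewrite -bn; exact: position_sphere.
by move: kp; rewrite -(ltr_nat R) => kp; lra.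
Qed.

Lemma lower0 n : lower n 0 = bead_sphere n 0.
Proof.
apply/seteqP; split=> b; first by move=> /lowerP[j]; rewrite leqn0 => /eqP ->.
by move=> h; apply/lowerP; exists 0%N.
Qed.

Lemma compact_lower n k : compact (lower n k).
Proof.
elim: k => [|k IH]; first by rewrite lower0; exact: compact_bead_sphere.
have -> : lower n k.+1 = lower n k `|` bead_sphere n k.+1.
  apply/seteqP; split=> b.
    move=> /lowerP[j]; rewrite leq_eqVlt => /orP[/eqP -> h|jk h]; first by right.
    by left; apply/lowerP; exists j.
  by move=> [/lowerP[j jk h]|h]; apply/lowerP; [exists j => //; exact: leqW|exists k.+1].
by apply: compactU => //; exact: compact_bead_sphere.
Qed.

(** The pairs of a compact set and a point of it whose removal makes it open:
    a topological description of the initial segments of the chains. *)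
Definition cap (p : B) (K : set B) : Prop :=
  [/\ compact K, K p, open (K `\ p) & K `\ p !=set0].

Definition foot n : B := bead n 0 (polar 1).

Lemma foot_height n : height (foot n) = -1.
Proof.
rewrite -[LHS]/(bead_height 0 (polar 1)) /bead_height lat_polar expr0 expr1.
by ring.
Qed.

Lemma lower_foot n k : lower n k (foot n).
Proof. by split=> //; rewrite foot_height; have := ler0n R k; lra. Qed.

Lemma cap_lower n k : cap (joint n k) (lower n k).
Proof.
split; first exact: compact_lower.
- by split=> //; rewrite joint_height.
- have -> : lower n k `\ joint n k =
      component @^-1` [set n] `&` [set b | height b < 2 * k%:R + 1].
    apply/seteqP; split=> [b [[bn hb] nb]|b [/= bn hb]].
      split=> //=; rewrite lt_neqAle hb andbT; apply/eqP => /jointP E.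
      by apply: nb; rewrite /= E bn.
    split; first by split=> //; exact: ltW.
    by move=> E; move: hb; rewrite E joint_height ltxx.
  apply: openI.
    by apply: (@open_comp _ _ component [set n]) => [b _|];
      [exact: component_continuous|exact: discrete_open].
  apply: (@open_comp _ _ height [set r | r < 2 * k%:R + 1]) => [b _|].
    exact: (@height_continuous R b).
  exact: open_lt.
exists (foot n); split; first exact: lower_foot.
by move=> E; have := foot_height n; rewrite E joint_height; have := ler0n R k; lra.
Qed.

End Caps.

Section CapInversion.
Context {R : realType}.
Local Notation B := (chains R).
Local Notation S2 := (@sphere2 R).

Lemma third_point (q q' : S2) : exists r : S2, r <> q /\ r <> q'.
Proof.
have [e le] : exists e : S2, lat e = 0.
  exists (normalize (0, (1, 0))); rewrite /lat normalize_id//.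
  by rewrite /norm2 /dot /= !mul0r mul1r add0r addr0.
have l0 := lat_polar (R := R) 0; have l1 := lat_polar (R := R) 1.
rewrite expr0 expr1 in l0 l1.
have ne (a b : S2) : lat a <> lat b -> a <> b by move=> h ab; apply: h; rewrite ab.
have [h0|h0] := eqVneq (lat q) 0; have [h0'|h0'] := eqVneq (lat q') 0.
- by exists (polar 0); split; apply: ne; rewrite l0 ?h0 ?h0'; lra.
- have [h1|h1] := eqVneq (lat q') 1.
    by exists (polar 1); split; apply: ne; rewrite l1 ?h0 ?h1; lra.
  exists (polar 0); split; apply: ne; rewrite l0 ?h0; first by lra.
  by move=> E; rewrite -E eqxx in h1.
- have [h1|h1] := eqVneq (lat q) 1.
    by exists (polar 1); split; apply: ne; rewrite l1 ?h0' ?h1; lra.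
  exists (polar 0); split; apply: ne; rewrite l0 ?h0'; last by lra.
  by move=> E; rewrite -E eqxx in h1.
- by exists e; split; apply: ne; rewrite le => E;
  [rewrite -E eqxx in h0|rewrite -E eqxx in h0'].
Qed.

(** Off [p], the trace of a cap on a sphere is both open and closed, and a
    sphere stays connected without a point. *)
Lemma cap_sphere (p : B) K n j b b' : cap p K ->
  bead_sphere n j b -> bead_sphere n j b' -> b <> p -> b' <> p -> K b -> K b'.
Proof.
move=> [cK Kp oK _] [q _ <-] [q' _ <-] qp q'p Kq.
have clK := compact_closed (@hausdorff_chains R) cK.
have [q0 [q0q q0q'] Hp] : exists2 q0 : S2, q0 <> q /\ q0 <> q' &
    forall r, r <> q0 -> bead n j r <> p.
  have [[q0 _ E]|np] := pselect (bead_sphere n j p).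
    exists q0; first by split=> h; rewrite -E h in qp q'p.
    by move=> r rq; rewrite -E => /(congr1 (@spot R)) h; apply: rq.
  have [r rP] := third_point q q'; exists r => // r' _ E.
  by apply: np; rewrite -E; exists r'.
apply: (@punctured_sphere_clopen R q0 (bead n j @^-1` K) (bead n j @^-1` (K `\ p))
  (bead n j @^-1` K) _ _ _ _ q q') => //.
- by apply: open_comp => // r _; exact: bead_continuous.
- by apply: closed_comp => // r _; exact: bead_continuous.
- by move=> r rq; split=> [Kr|[]//]; split=> //; exact: Hp.
- by move=> h; apply: q0q.
- by move=> h; apply: q0q'.
Qed.

(** If no joint from the [i]-th on were [p], the cap would go on from one sphere
    to the next for ever, against compactness. *)
Lemma cap_above (p : B) K n i b : cap p K -> bead_sphere n i b -> b <> p -> K b ->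
  exists2 k, (i <= k)%N & p = joint n k.
Proof.
move=> cpK ib bp Kb; apply: contrapT => np.
have nj k : (i <= k)%N -> joint n k <> p.
  by move=> ik E; apply: np; exists k.
have Kj m : K (joint n (i + m)).
  elim: m => [|m IH].
    rewrite addn0; apply: (cap_sphere cpK ib) Kb => //; first exact: joint_sphere.
    exact: nj.
  rewrite addnS; apply: (cap_sphere cpK (joint_next n (i + m))) IH.
  - exact: joint_sphere.
  - by apply: nj; exact: leq_addr.
  - by apply: nj; rewrite -addnS; exact: leq_addr.
have [cK _ _ _] := cpK.
have : compact (height @` K).
  by apply: continuous_compact cK; apply: continuous_subspaceT => x; exact: (@height_continuous R x).
move=> /compact_bounded[M [_ /(_ (M + 1))]]; rewrite ltrDl ltr01 => /(_ isT) hM.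
pose m := Num.bound (`|M| + 1).
have := hM (height (joint n (i + m))) (ex_intro2 _ _ _ (Kj m) erefl).
rewrite joint_height natrD => h.
have hm : `|M| + 1 < m%:R by apply: archi_boundP; rewrite addr_ge0.
have h' : 2 * (i%:R + m%:R) + 1 <= M + 1 by apply: le_trans (ler_norm _) h.
by have := ler0n R i; have := ler0n R m; have := ler_norm M; lra.
Qed.

(** The point [p] has to be a joint, the only kind of point where a chain can be
    cut; the cap is then the part of the chain on one side of it, and it has to
    be the lower one by compactness. *)
Lemma cap_inv (p : B) K : cap p K -> exists n k, p = joint n k /\ K = lower n k.
Proof.
move=> cpK; have [_ Kp _ [u [Ku up]]] := cpK.
have [k uk pE] := cap_above cpK (position_sphere u) up Ku.
set n := component u in pE; set i := position u in uk.
exists n, k; split=> //; apply/seteqP; split=> b.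
  move=> Kb; have [->|bp] := pselect (b = p).
    by rewrite pE; split=> //; rewrite joint_height.
  have [k' bk' E] := cap_above cpK (position_sphere b) bp Kb.
  have [bn kk] : component b = n /\ k' = k by exact: (joint_inj (etrans (esym E) pE)).
  by apply/lowerP; exists (position b); [rewrite -kk|rewrite -bn; exact: position_sphere].
have jp m : (m < k)%N -> joint n m <> p.
  by move=> mk E; have [_ h] := joint_inj (etrans E pE); rewrite h ltnn in mk.
pose A m := forall b, bead_sphere n m b -> b <> p -> K b.
have A_S m c : bead_sphere n m c -> c <> p -> K c -> A m.
  by move=> mc cp Kc d md dp; exact: (cap_sphere cpK mc md).
have Ai : A i by exact: (A_S i u (position_sphere u) up Ku).
have Adown m : (m < k)%N -> A m.+1 -> A m.
  move=> mk Am; apply: (A_S m _ (joint_sphere n m) (jp m mk)).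
  exact: (Am _ (joint_next n m) (jp m mk)).
have Aup m : (m < k)%N -> A m -> A m.+1.
  move=> mk Am; apply: (A_S _ _ (joint_next n m) (jp m mk)).
  exact: (Am _ (joint_sphere n m) (jp m mk)).
have A0 : A 0%N.
  elim: (i) uk Ai => // m IH mk Am; apply: IH; first exact: ltnW.
  exact: Adown.
have Am m : (m <= k)%N -> A m.
  by elim: m => // m IH mk; apply: Aup => //; apply: IH; exact: ltnW.
move=> /lowerP[j jk jb]; have [->//|bp] := pselect (b = p).
exact: (Am j jk).
Qed.

Lemma cap_homeomorphism (rho : B -> B) p K : homeomorphism rho -> cap p K ->
  cap (rho p) (rho @` K).
Proof.
move=> [crho [g [cg rhoK gK]]] [cK Kp oK [u [Ku up]]]; split.
- by apply: continuous_compact cK; exact: continuous_subspaceT.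
- by exists p.
- have -> : rho @` K `\ rho p = g @^-1` (K `\ p).
    apply/seteqP; split=> [_ [[b Kb <-] bp]|b [Kb bp]].
      by rewrite /preimage /= rhoK; split=> // E; apply: bp; rewrite E.
    split; first by exists (g b) => //; exact: gK.
    by move=> E; apply: bp; rewrite E /= rhoK.
  by apply: open_comp oK => x _; exact: cg.
- exists (rho u); split; first by exists u.
  by move=> /(can_inj rhoK).
Qed.

Lemma increasing_surjection_id (s : nat -> nat) : {homo s : k l / (k < l)%N} ->
  (forall j, exists i, s i = j) -> forall k, s k = k.
Proof.
move=> sm ss.
have sge k : (k <= s k)%N by elim: k => // k /leq_ltn_trans; apply; exact: sm.
elim/ltn_ind => k IH; have [i ik] := ss k.
have : (i <= k)%N by rewrite -ik.
rewrite leq_eqVlt => /orP[/eqP E|ltik]; first by rewrite -{1}E.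
by move: (ltik); rewrite -(IH _ ltik) ik ltnn.
Qed.

(** A homeomorphism permutes the caps and preserves their inclusions. The caps of
    a chain are ordered like the natural numbers, so their ranks are preserved,
    and the [k]-th sphere is the difference of consecutive caps up to a joint. *)
Lemma homeomorphism_spheres (rho : B -> B) : homeomorphism rho ->
  forall n, exists n', forall k b, bead_sphere n k b -> bead_sphere n' k (rho b).
Proof.
move=> hrho n; have [crho [g [cg rhoK gK]]] := hrho.
have hg : homeomorphism g by split=> //; exists rho.
pose n' := component (rho (foot n)).
have /choice[s sP] : forall k, exists k', rho (joint n k) = joint n' k' /\
    rho @` lower n k = lower n' k'.
  move=> k; have [m [k' [E1 E2]]] := cap_inv (cap_homeomorphism hrho (cap_lower n k)).
  have : (rho @` lower n k) (rho (foot n)) by exists (foot n) => //; exact: lower_foot.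
  by rewrite E2 => -[h _]; exists k'; rewrite /n' h.
have sid : forall k, s k = k.
  apply: increasing_surjection_id => [k l kl|j].
    have [E1 E2] := sP k; have [E3 E4] := sP l.
    have : (rho @` lower n l) (joint n' (s k)).
      rewrite -E1; exists (joint n k) => //; split=> //.
      by rewrite joint_height; move: kl; rewrite -(ltr_nat R) => kl; lra.
    rewrite E4 => -[_]; rewrite joint_height => h.
    have : (s k <= s l)%N by rewrite -(ler_nat R); lra.
    rewrite leq_eqVlt => /orP[/eqP skl|//].
    have /(can_inj rhoK)/joint_inj[_ kl'] : rho (joint n k) = rho (joint n l).
      by rewrite E1 E3 skl.
    by rewrite kl' ltnn in kl.
  have [m [i [E1 E2]]] := cap_inv (cap_homeomorphism hg (cap_lower n' j)).
  have mn : m = n.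
    have : (g @` lower n' j) (g (foot n')) by exists (foot n') => //; exact: lower_foot.
    rewrite E2 => -[<- _].
    have : (rho @` lower n 0%N) (foot n').
      by have [_ ->] := sP 0%N; exact: lower_foot.
    by move=> [c [cn _] <-]; rewrite rhoK.
  exists i; have [E3 _] := sP i.
  have : rho (g (joint n' j)) = joint n' (s i) by rewrite E1 mn E3.
  by rewrite gK => /joint_inj[_ ->].
have low k b : lower n k b <-> lower n' k (rho b).
  have [_ E] := sP k; rewrite sid in E; split=> [h|].
    have : (rho @` lower n k) (rho b) by exists b.
    by rewrite E.
  move=> h; have : (rho @` lower n k) (rho b) by rewrite E.
  by move=> [c ch /(can_inj rhoK) <-].
exists n' => k b kb.
have kb' : lower n' k (rho b) by apply/low/lowerP; exists k.
case: k kb kb' => [|k] kb kb'; first by rewrite -lower0.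
have [h|h] := pselect (lower n k b); last first.
  have h' : ~ lower n' k (rho b) by move=> /low.
  move: kb' => /lowerP[j]; rewrite leq_eqVlt => /orP[/eqP -> //|jk jb].
  by case: h'; apply/lowerP; exists j.
move: h kb => [bn h1] /bead_sphere_height[_ /andP[h2 _]].
have E : height b = 2 * k%:R + 1.
  by apply/eqP; rewrite eq_le h1; move: h2; rewrite -addn1 natrD => h2; lra.
have [E1 _] := sP k; rewrite (jointP E) bn E1 sid; exact: joint_next.
Qed.

End CapInversion.

(** * Distinguishing the bundles *)

(** The chart changes of the two bundles and the local expressions of an
    isomorphism form a cocycle. *)
Lemma transition_iso (R : realType) (B F : topologicalType) (G : topologicalGroupType)
    (act : G -> F -> F) (p q : fibre_bundle R B act)
    (pi : bundle_total p -> bundle_total q) (rho : B -> B) (e : set B -> set B -> B -> G) :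
  (forall x, bundle_proj (pi x) = rho (bundle_proj x)) ->
  (forall U V, bundle_cover p U -> bundle_cover q V -> forall b f, U b -> V (rho b) ->
    chart V (pi (chart_inv p U (b, f))) = (rho b, act (e U V b) f)) ->
  forall U U' V V' b f, bundle_cover p U -> bundle_cover p U' ->
    bundle_cover q V -> bundle_cover q V' -> U b -> U' b -> V (rho b) -> V' (rho b) ->
  act (e U' V' b) (act (transition p U U' b) f) =
  act (transition q V V' (rho b)) (act (e U V b) f).
Proof.
move=> pirho eP U U' V V' b f pU pU' qV qV' Ub U'b Vb V'b.
set x := chart_inv p U (b, f).
have xb : bundle_proj x = b.
  by have [_ h _ _ _] := chart_fibre pU Ub; exact: (h (b, f)).
have Ex : x = chart_inv p U' (b, act (transition p U U' b) f).
  have [_ _ h _ _] := chart_homeo pU'.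
  by rewrite -(transitionE pU pU' f Ub U'b) h//= xb.
have Ey : pi x = chart_inv q V (rho b, act (e U V b) f).
  have [_ _ h _ _] := chart_homeo qV.
  by rewrite -(eP U V pU qV b f Ub Vb) h//= pirho xb.
have := eP U' V' pU' qV' b (act (transition p U U' b) f) U'b V'b.
rewrite -Ex Ey (transitionE qV qV' _ Vb V'b) => -[->] //.
Qed.

Section Distinguishing.
Context {R : realType}.
Local Notation B := (chains R).
Local Notation C := (R[i]^o).

(** On a folded sphere the twist is a nonnegative real number, and has no phase. *)
Lemma line_transition_fold (beta : nat -> nat -> bool) n k j j' (b : B) :
  bead_sphere n k b -> beta n k = false -> chart_dom j b -> chart_dom j' b ->
  line_transition beta j j' b = 1%g.
Proof.
move=> [q _ <-] bk jb j'b; apply: circle_val_inj.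
have T : twist beta (bead n k q) = `|twist beta (bead n k q)|.
  by rewrite norm_twist twist_bead bk.
case: j j' jb j'b => [] [] // jb j'b; rewrite /line_transition.
- have t0 := twist_neq0 beta jb j'b.
  have -> : (twist beta (bead n k q))^* = twist beta (bead n k q).
    by rewrite T norm_twist conjc_real.
  by rewrite unit_complex_val// -T divff.
- have t0 := twist_neq0 beta j'b jb.
  by rewrite unit_complex_val// -T divff.
Qed.

Lemma line_vec_neq0 (beta : nat -> nat -> bool) j (b : B) f : chart_dom j b -> f != 0 ->
  (line_vec beta j b f).1 != 0 \/ (line_vec beta j b f).2 != 0.
Proof.
move=> jb f0; apply/orP; rewrite -negb_and; apply/negP => /andP[/eqP v1 /eqP v2].
move: f0; rewrite -(line_coordK beta f jb) /line_coord v1 v2.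
by case: (j); rewrite mul0r eqxx.
Qed.

Lemma near_open_of_cvg (b : B) (V : set B) (T : Type) (F : set_system T)
    (f : T -> B) :
  Filter F -> f x @[x --> F] --> b -> open V -> V b -> \forall x \near F, V (f x).
Proof. by move=> FF fb oV Vb; apply: (fb V); exact: open_nbhs_nbhs. Qed.

Section Codes.
Variables (W : set (set B)) (hW : admissible_cover W) (BB : set (set B)) (WB : W `<=` BB).
Variables (beta : nat -> nat -> bool) (r : fibre_bundle R B (@rotation R)).
Hypothesis cr : codes (line_code hW BB beta) r.

Lemma line_code_cover : bundle_cover r = W.
Proof.
have [-> _ _] := cr; apply/seteqP; split=> [_ [U /asboolP WU <-]//|U WU].
by exists (exist _ U (mem_set (WB WU))) => //; apply/asboolP; exact: WU.
Qed.

Lemma line_code_transition U V b : W U -> W V -> U b -> V b ->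
  transition r U V b = line_transition beta (chart_side U) (chart_side V) b.
Proof.
have [_ h _] := cr => WU WV Ub Vb.
pose U' : BB := exist _ U (mem_set (WB WU)); pose V' : BB := exist _ V (mem_set (WB WV)).
have UVb : (set_val U' `&` set_val V') b by split.
have := h U' V' (asboolT WU) (asboolT WV) (exist _ b (mem_set UVb)).
rewrite /code_trans /= /mkcts /code_transition /= => <-.
by case: asboolP => // h'; case: h'; split.
Qed.

End Codes.

(** Pulled back by an isomorphism, the constant section over a folded sphere would
    be a section without zeros of the tautological bundle. *)
Lemma folded_not_tautological (W : set (set B)) (hW : admissible_cover W) (BB : set (set B))
    (WB : W `<=` BB) (beta beta' : nat -> nat -> bool) n :
  (forall n', exists k, beta n k /\ beta' n' k = false) ->
  ~ BunC_iso (line_bun hW WB beta) (line_bun hW WB beta').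
Proof.
move=> bits [p [q [cp cq [pi [rho [e [_ hrho pirho eP]]]]]]].
have [n' sph] := homeomorphism_spheres hrho n.
(* the [k]-th sphere of the [n]-th chain, where the first bundle is tautological,
   is mapped to a sphere where the second bundle is trivial *)
have [k [bk b'k]] := bits n'; have {}sph := sph k.
have Wp := line_code_cover WB cp; have Wq := line_code_cover WB cq.
have /choice[c cP] : forall b : B, exists U, W U /\ U b.
  move=> b; have [_ WT _ _] := hW; have : (\bigcup_(U in W) U) b by rewrite WT.
  by move=> [U WU Ub]; exists U.
have dom U b : W U -> U b -> chart_dom (chart_side U) b := @cover_side R W hW U b.
(* the coordinate in the chart over [U] of the section which is carried to the
   constant 1 in the chart over [V] *)
pose coord U V b : C := (circle_val (e U V b))^-1.
have coord_neq0 U V b : coord U V b != 0 by rewrite invr_eq0 circle_neq0.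
have change U U' V V' b : bead_sphere n k b -> W U -> W U' -> W V -> W V' ->
    U b -> U' b -> V (rho b) -> V' (rho b) ->
    line_vec beta (chart_side U) b (coord U V b) =
    line_vec beta (chart_side U') b (coord U' V' b).
  move=> Sb WU WU' WV WV' Ub U'b Vb V'b.
  have := @transition_iso _ _ _ _ _ p q pi rho e pirho (fun U V hU hV => (eP U V hU hV).2)
    U U' V V' b 1.
  rewrite Wp Wq => /(_ WU WU' WV WV' Ub U'b Vb V'b).
  rewrite (line_code_transition WB cp)// (line_code_transition WB cq)//.
  rewrite (line_transition_fold (sph _ Sb) b'k (dom _ _ WV Vb) (dom _ _ WV' V'b)).
  rewrite /rotation mul1r !mulr1 => E.
  have {}E : coord U' V' b =
      rotation (line_transition beta (chart_side U) (chart_side U') b) (coord U V b).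
    rewrite /coord /rotation -E invfM mulrCA mulfV ?circle_neq0// mulr1 //.
  rewrite E -line_transitionE; [|exact: dom|exact: dom].
  by rewrite line_vecK//; [exact: dom|exact: line_vec_in_line].
pose v (s : @sphere2 R) : C * C := let b := bead n k s in
  line_vec beta (chart_side (c b)) b (coord (c b) (c (rho b)) b).
have beadS s : bead_sphere n k (bead n k s : B) by exists s.
have cv s : v x @[x --> s] --> v s.
  have FF : Filter (nbhs (s : sphere2)) by exact: nbhs_filter.
  set b := bead n k s; set U := c b; set V := c (rho b).
  have [WU Ub] := cP b; have [WV Vb] := cP (rho b).
  have [Wo _ _ _] := hW; have [crho _] := hrho.
  have cb : bead n k x @[x --> s] --> b by exact: bead_continuous.
  have oUV : open (U `&` rho @^-1` V).
    by apply: openI; [exact: Wo|apply: open_comp => [x _|]; [exact: crho|exact: Wo]].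
  have nUV : \forall x \near s, (U `&` rho @^-1` V) (bead n k x).
    exact: (near_open_of_cvg FF cb oUV).
  have ce : e U V (bead n k x) @[x --> s] --> e U V b.
    apply: (@cvg_continuous _ _ _ (e U V)) cb.
    have [] := eP U V; rewrite ?Wp ?Wq// => + _.
    by rewrite continuous_open_subspace// => /(_ b); apply; rewrite inE.
  have cc : coord U V (bead n k x) @[x --> s] --> coord U V b.
    apply: (cvg_complexV FF (circle_neq0 _)); apply: (@cvg_continuous _ _ _ (@circle_val R)) ce.
    exact: circle_val_continuous.
  have cl : line_vec beta (chart_side U) (bead n k x) (coord U V (bead n k x)) @[x --> s]
      --> line_vec beta (chart_side U) b (coord U V b).
    have cp2 : (bead n k x, coord U V (bead n k x)) @[x --> s] --> (b, coord U V b).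
      exact: (cvg_pair cb cc).
    have lc := @line_vec_continuous R beta (chart_side U) (b, coord U V b) (dom U b WU Ub).
    exact: (@cvg_comp _ _ _ _ (fun y : B * C => line_vec beta (chart_side U) y.1 y.2)
      _ _ _ cp2 lc).
  apply: cvg_trans cl; apply: near_eq_cvg.
  apply: (@filterS _ (nbhs s) _ _ _ _ nUV) => x [Ux Vx].
  have [WU' U'x] := cP (bead n k x); have [WV' V'x] := cP (rho (bead n k x)).
  exact: change.
have line s : in_line beta (bead n k s) (v s) by exact: line_vec_in_line.
have tw s : twist beta (bead n k s) = equ s by rewrite twist_bead bk.
have cvs s : ((v x).1 : C) @[x --> s] --> ((v s).1 : C) /\
    ((v x).2 : C) @[x --> s] --> ((v s).2 : C).
  have FF : Filter (nbhs (s : sphere2)) by exact: nbhs_filter.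
  exact: (cvg_vec FF (cv s)).
apply: (@tautological_no_section R (fun s => (v s).1) (fun s => (v s).2)).
- by move=> s; exact: (cvs s).1.
- by move=> s; exact: (cvs s).2.
- by move=> s; have [h _] := line s; rewrite tw in h.
- by move=> s; have [_ h] := line s; rewrite tw in h.
- by move=> s; have [WU Ub] := cP (bead n k s); apply: line_vec_neq0 => //; exact: dom.
Qed.

End Distinguishing.

Theorem corollary6p2 (R : realType) :
  exists B : topologicalType,
    [/\ locally_compact [set: B], metrizable R B, @second_countable B,
        exists S : @CW_structure R B, CW_countable B S /\ CW_locally_finite B S &
        forall BB : set (set B), countable BB -> basis BB ->
          ~ classifiable_by_TSI R (@BunC_iso R B BB)].
Proof.
exists (chains R : topologicalType); split.
- exact: locally_compact_chains.
- exact/polish_metrizable/polish_chains.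
- exact: (polish_second_countable (@polish_chains R)).
- exact: chains_CW.
move=> BB _ bB cl; have [W [WB Wo WT Wlf Wsmall]] := adapted_cover bB.
have hW : admissible_cover W by [].
have [||D cD DP] := classifiable_generic_collapse
  (@line_bun_locally_determined R W hW BB WB) _ _ cl.
- move=> g x; apply: (@line_bun_iso R W hW BB WB x _ (fun c => (c.1, c.2 - g c.1))
    (fun c => (c.1, c.2 + g c.1))) => [[m a]|[m a]|[m a] k] /=.
  + by rewrite subrK.
  + by rewrite addrK.
  + by rewrite /shift /= subrK.
- move=> t x tK; apply: (@line_bun_iso R W hW BB WB x _ (fun c => (t c.1, c.2))
    (fun c => (t c.1, c.2))) => [[m a]|[m a]|[m a] k] /=; rewrite ?tK//.
  by rewrite /permute_rows /= tK.
have [x [x' [Dx Dx' xx']]] := generic_distinct_sequences cD.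
apply: (@folded_not_tautological R W hW BB WB (chain_bits x) (chain_bits x')
  (@pickle (nat * int)%type (0%N, 0))) (DP _ _ Dx Dx') => n'.
rewrite /chain_bits pickleK_inv; case: pickle_inv => [[m a]|].
  by have [k [xk x'k]] := xx' m a; exists k; rewrite x'k.
by have [k [xk _]] := xx' 0%N 0; exists k.
Qed.
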